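(* Let $m\ge 1$, let $a_1<a_2<\cdots<a_{2m}$ be real, let $J=\bigcup_{j=1}^m (a_{2j-1},a_{2j})$, let $\lambda>0$, and let $K$ be the integral operator on $L^2(J)$ with kernel $K(x,y)=\frac{A(x)A'(y)-A'(x)A(y)}{x-y}$, where $A(x)=\sqrt{\lambda}\,\mathrm{Ai}(x)$. Put $D(J;\lambda)=\det(I-K)$. With $\lambda$ fixed, regard all quantities below as functions of $a=(a_1,\dots,a_{2m})$ on the open set of those $a$ for which $I-K$ is invertible. Let $R(x,y)$ be the kernel of $K(I-K)^{-1}$, and let $q_j=\big((I-K)^{-1}A\big)(a_j)$, $p_j=\big((I-K)^{-1}A'\big)(a_j)$, $u=\big(A,(I-K)^{-1}A\big)$, $v=\big(A,(I-K)^{-1}A'\big)$, with inner products over $J$. Then for all $j,k\in\{1,\dots,2m\}$: $$\frac{\partial}{\partial a_j}\log D(J;\lambda)=-(-1)^jR(a_j,a_j),$$ $$\frac{\partial q_j}{\partial a_k}=(-1)^k\,\frac{q_jp_k-p_jq_k}{a_j-a_k}\,q_k\quad(j\ne k),\qquad \frac{\partial p_j}{\partial a_k}=(-1)^k\,\frac{q_jp_k-p_jq_k}{a_j-a_k}\,p_k\quad(j\neq k),$$ $$\frac{\partial q_j}{\partial a_j}=-\sum_{k\ne j}(-1)^k\,\frac{q_jp_k-p_jq_k}{a_j-a_k}\,q_k+p_j-q_ju,$$ $$\frac{\partial p_j}{\partial a_j}=-\sum_{k\ne j}(-1)^k\,\frac{q_jp_k-p_jq_k}{a_j-a_k}\,p_k+a_jq_j+p_ju-2q_jv,$$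 $$\frac{\partial u}{\partial a_j}=(-1)^jq_j^2,\qquad \frac{\partial v}{\partial a_j}=(-1)^jp_jq_j,$$ and $$R(a_j,a_j)=\sum_{k\ne j}(-1)^k\,\frac{(q_jp_k-p_jq_k)^2}{a_j-a_k}+p_j^2-a_jq_j^2-2p_jq_ju+2q_j^2v.$$
   Context: $\mathrm{Ai}$ is the Airy function, $\mathrm{Ai}''(x)=x\,\mathrm{Ai}(x)$, $\mathrm{Ai}(x)\to0$ as $x\to+\infty$. The kernel $K(x,y)$ is extended by continuity to $x=y$. $\det(I-K)$ is the Fredholm determinant of $K$ acting on $L^2(J)$. The inner product is $(f,g)=\int_J f(x)g(x)\,dx$. The functions $(I-K)^{-1}A$, $(I-K)^{-1}A'$ and the resolvent kernel $R(x,y)$ are smooth on $J$ (respectively $J\times J$) up to the boundary; values at the endpoints $a_j$ are the limits taken from inside $J$. Sums over $k\neq j$ run over $k\in\{1,\dots,2m\}\setminus\{j\}$. In the derivative formula for $\log D$, one may read $\partial\log D/\partial a_j$ as $D^{-1}\,\partial D/\partial a_j$. *)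

(* Defs.v *)
From HB Require Import structures.
From mathcomp Require Import all_boot all_order all_algebra.
From mathcomp Require Import all_classical all_reals all_analysis.

Set Implicit Arguments.
Unset Strict Implicit.
Unset Printing Implicit Defensive.

Import Order.TTheory GRing.Theory Num.Theory.
Import numFieldNormedType.Exports.

Local Open Scope classical_set_scope.
Local Open Scope ring_scope.

(* The first three clauses determine Ai up to a scalar factor; the last one
   fixes the factor by Ai(0) = pi^-1 * \int_0^oo cos(t^3/3) dt, the integral
   being conditionally convergent. *)
Definition is_airy (R : realType) (Ai : R -> R) : Prop :=
  [/\ forall x, derivable Ai x 1,
      forall x, is_derive x (1 : R) (derive1 Ai) (x * Ai x),
      Ai x @[x --> +oo] --> (0 : R) &
      (pi^-1 * \int[lebesgue_measure]_(t in `[0, T]) cos (t ^+ 3 / 3%:R))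
        @[T --> +oo] --> Ai 0].

(* On the diagonal: the extension by continuity. *)
Definition airy_kernel (R : realType) (A : R -> R) (x y : R) : R :=
  let k z := (A x * derive1 A z - derive1 A x * A z) / (x - z) in
  if x == y then lim (k z @[z --> x^']) else k y.

Lemma left_subproof (m : nat) (i : 'I_m) : (i.*2 < m.*2)%N.
Proof. by rewrite ltn_double. Qed.

Lemma right_subproof (m : nat) (i : 'I_m) : (i.*2.+1 < m.*2)%N.
Proof. by rewrite ltn_Sdouble. Qed.

(* Coordinates are numbered from 0: the coordinate a 0 j of the row vector a
   is the endpoint a_(j+1) of the informal numbering from 1. *)
Definition intervals (R : realType) (m : nat) (a : 'rV[R]_(m.*2)) : set R :=
  \bigcup_(i in [set: 'I_m])
    `]a 0 (Ordinal (left_subproof i)), a 0 (Ordinal (right_subproof i))[%classic.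

Section IntegralOperator.
Context (R : realType).
Implicit Types (J : set R) (K : R -> R -> R) (f g : R -> R).
Local Notation mu := (@lebesgue_measure R).

Definition inner_on J f g : R := \int[mu]_(x in J) (f x * g x).

(* L^2(J), a function on J being represented by its extension by zero. *)
Definition L2on J f : Prop := f \_ J \in Lfun mu 2%:E.

Definition norm2on J f : \bar R := 'N[mu]_2%:E[EFin \o (f \_ J)].

Definition ae_eq_on J f g : Prop := {ae mu, forall x, J x -> f x = g x}.

Definition int_op J K f (x : R) : R := \int[mu]_(y in J) (K x y * f y).

(* (I - K) g = f in L^2(J) *)
Definition solves J K f g : Prop :=
  L2on J g /\ ae_eq_on J (fun x => g x - int_op J K g x) f.

(* I - K is a bijection of L^2(J) onto itself with bounded inverse. *)
Definition invertible_ImK J K : Prop :=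
  [/\ forall f, L2on J f -> exists g, solves J K f g,
      forall f g h, L2on J f -> solves J K f g -> solves J K f h ->
        ae_eq_on J g h &
      exists C : R, forall f g, L2on J f -> solves J K f g ->
        (norm2on J g <= C%:E * norm2on J f)%E].

(* (I - K)^-1 f for continuous f: the representative that is continuous up to
   the boundary. It is unique on closure J when I - K is invertible and J is
   open, and its value at an endpoint of J is the limit from inside J. *)
Definition inv_ImK J K f : R -> R :=
  get [set g : R -> R | {within closure J, continuous g} /\ solves J K f g].

(* The kernel of K (I - K)^-1, continuous up to the boundary as well. *)
Definition is_resolvent_kernel J K (S : R -> R -> R) : Prop :=
  {within closure J `*` closure J, continuous (fun z : R * R => S z.1 z.2)} /\
  forall f g, L2on J f -> solves J K f g ->
    ae_eq_on J (int_op J K g) (int_op J S f).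

Definition resolvent_kernel J K : R -> R -> R :=
  get [set S : R -> R -> R | is_resolvent_kernel J K S].

(* iter_int J n F is the integral of F [:: x_1; ...; x_n] over J^n. *)
Fixpoint iter_int J (n : nat) (F : seq R -> R) : R :=
  if n is n'.+1 then
    \int[mu]_(x in J) iter_int J n' (fun s => F (x :: s))
  else F [::].

(* Fredholm's series
   \sum_n (-1)^n / n! * \int_(J^n) det (K(x_i, x_j)) dx_1 ... dx_n *)
Definition fredholm_det J K : R :=
  limn (series (fun n => (-1) ^+ n / n`!%:R *
    iter_int J n (fun s => \det (\matrix_(i < n, j < n) K s`_i s`_j)))).

End IntegralOperator.

(* Main.v *)
(* On a box containing all the endpoints, the integral T over J is a limit of
   Riemann sums, and Hadamard's inequality makes det (I - K T) the limit of the
   determinants of the discretised operators. If S is the kernel of K (I - K T)^-1,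
   so that I + S T = (I - K T)^-1, and T' is the integral for other endpoints, then
     (I - K T') (I + S T) = I - S (T' - T).
   Discretised, this identity bounds det (I - K T') / det (I - K T) - 1 + (T' - T) S(x, x)
   by O(|T' - T|^2); with T' = T it shows that det (I - K T) != 0, and with T' the
   integral for a moved endpoint a_k it gives the derivative of log D. In the same
   way the solution g of (I - K T') g = f is the fixed point of
     g = (I + S T) f + S (T' - T) g,
   which yields every derivative in the endpoints at a fixed argument, (I - K T)^-1 f
   changing at the rate (-1)^k S(., a_k) ((I - K T)^-1 f)(a_k). With q and p now
   standing for the functions (I - K)^-1 A and (I - K)^-1 A', the commutator of K with
   multiplication by x gives (x - y) S(x, y) = q(x) p(y) - p(x) q(y), and the identity
   (d/dx + d/dy) K = - A A gives, after integration by parts, the derivatives of q and p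
   in x. Letting y tend to x in the former formula gives R(x, x) = q' p - p' q. *)
Require Import Defs.
From HB Require Import structures.
From mathcomp Require Import all_boot all_order all_algebra.
From mathcomp Require Import perm.
From mathcomp Require Import all_classical all_reals all_analysis.
From mathcomp Require Import measurable_realfun.
From mathcomp Require Import ring lra zify.

Set Implicit Arguments.
Unset Strict Implicit.
Unset Printing Implicit Defensive.

Import Order.TTheory GRing.Theory Num.Theory.
Import numFieldNormedType.Exports.

Local Open Scope classical_set_scope.
Local Open Scope ring_scope.

(** * Hadamard's inequality *)

(** Invertibility of I - K is given at one endpoint vector only, and an endpoint moved outwards
    leaves the closure of the old J. Hence every function is taken on a box around all endpoints: S,
    obtained from the L^2 inverse on J, extends to the box through S = K + K T S, and so do the
    solutions. On the box the integral over J, its Riemann sums and the change T' - T are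
    functionals on one space, the bounded Lipschitz functions, and are compared through their norms.
    Lipschitz regularity is stable under products and kernels and makes quadrature errors
    proportional to the mesh. Derivatives are not exchanged with integrals or limits; each is read
    off from an explicit estimate C t^2. The Riemann sums for different endpoints share their nodes
    and differ only in the weights, so the discretised operators are matrices of one size and the
    determinant of a product is available; passing to the limit needs a summable majorant uniform in
    the mesh, which Hadamard's bound supplies. *)

Definition psd (R : realFieldType) n (G : 'M[R]_n) :=
  G^T = G /\ forall x : 'rV_n, 0 <= (x *m G *m x^T) 0 0.

Lemma psd_gram (R : realFieldType) m n (A : 'M[R]_(m, n)) : psd (A *m A^T).
Proof.
split=> [|x]; first by rewrite trmx_mul trmxK.
rewrite mulmxA -mulmxA -trmx_mul mxE sumr_ge0 // => i _.
by rewrite [X in _ * X]mxE -expr2 sqr_ge0.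
Qed.

Lemma psd_congr (R : realFieldType) m n (M : 'M[R]_(m, n)) G :
  psd G -> psd (M *m G *m M^T).
Proof.
move=> [symG posG]; split=> [|x].
  by rewrite !trmx_mul trmxK symG mulmxA.
by have := posG (x *m M); rewrite trmx_mul !mulmxA.
Qed.

Lemma psd_diag_ge0 (R : realFieldType) n (G : 'M[R]_n) i : psd G -> 0 <= G i i.
Proof.
move=> [_ /(_ (delta_mx 0 i))].
by rewrite trmx_delta -rowE -colE !mxE.
Qed.

(** With [G i i = 0] the form is affine along t e_i + e_j, and an affine function that stays
    nonnegative has slope 0. *)
Lemma psd_row0 (R : realFieldType) n (G : 'M[R]_n) i j :
  psd G -> G i i = 0 -> G i j = 0.
Proof.
move=> [symG posG] Gii.
have Gji : G j i = G i j by rewrite -{1}symG mxE.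
have quad t : 0 <= t * G i j *+ 2 + G j j.
  have := posG (t *: delta_mx 0 i + delta_mx 0 j).
  rewrite linearD linearZ /= !trmx_delta !mulmxDl !mulmxDr.
  rewrite -!scalemxAl -!scalemxAr -!rowE -!colE !mxE Gii Gji.
  by rewrite !mulr0 add0r addrA -mulr2n.
(* At this argument the form would take the value -1. *)
have := quad (- (G j j + 1) / (2 * G i j)).
case: (eqVneq (G i j) 0) => // nz; rewrite mulr2n.
have -> : - (G j j + 1) / (2 * G i j) * G i j = - (G j j + 1) / 2 by field.
lra.
Qed.

(** Induction by Schur complements. If the corner g is positive, [H] = M G M^T is the Schur
    complement: det G = g det H, [H] is positive semidefinite by congruence, and subtracting g^-1
    b^T b only lowers the diagonal. If the corner is 0, the first row vanishes. *)
Lemma psd_det (R : realFieldType) n (G : 'M[R]_n) :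
  psd G -> 0 <= \det G <= \prod_i G i i.
Proof.
elim: n G => [|n IHn] G psdG; first by rewrite det_mx00 big_ord0 ler01 lexx.
have [G00 | G00] := eqVneq (G 0 0) 0.
  have -> : \det G = 0.
    by rewrite (expand_det_row _ 0) big1 // => j _; rewrite (psd_row0 _ psdG G00) mul0r.
  by rewrite lexx prodr_ge0 // => i _; apply: psd_diag_ge0.
have g_gt0 : 0 < G 0 0 by rewrite lt_neqAle eq_sym G00 psd_diag_ge0.
move: G psdG G00 g_gt0; rewrite -[n.+1]/(1 + n)%N => G psdG G00 g_gt0.
set g := G 0 0 in G00 g_gt0.
pose b := ursubmx G; pose G' := drsubmx G.
have eG : G = block_mx (g%:M) b b^T G'.
  rewrite -[LHS]submxK; congr block_mx.
    rewrite [LHS]mx11_scalar; congr (_%:M); rewrite !mxE /g.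
    by congr (G _ _); apply: val_inj.
  by rewrite /b trmx_ursub psdG.1.
pose M : 'M[R]_(n, 1 + n) := row_mx (- (g^-1 *: b^T)) 1%:M.
pose H := M *m G *m M^T.
have psdH : psd H by apply: psd_congr.
have eMG : M *m G = row_mx 0 (G' - g^-1 *: (b^T *m b)).
  rewrite eG mul_row_block !mul1mx mulNmx mul_mx_scalar scalerA mulfV //.
  by rewrite scale1r addNr mulNmx -scalemxAl addrC.
have eH : H = G' - g^-1 *: (b^T *m b).
  by rewrite /H eMG tr_row_mx mul_row_col mul0mx add0r trmx1 mulmx1.
have detG : \det G = g * \det H.
  pose L : 'M[R]_(1 + n) := block_mx 1%:M 0 (- (g^-1 *: b^T)) 1%:M.
  have detL : \det L = 1 by rewrite det_lblock !det1 mulr1.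
  rewrite -[LHS]mul1r -detL -det_mulmx /L.
  rewrite {1}eG mulmx_block !mul1mx !mul0mx !addr0.
  rewrite !mulNmx mul_mx_scalar scalerA mulfV // scale1r addNr.
  by rewrite det_ublock det_scalar1 eH addrC -scalemxAl.
have Hle i : H i i <= G' i i.
  rewrite eH !mxE lerBlDr lerDl mulr_ge0 ?invr_ge0 1?(ltW g_gt0) //; apply: sumr_ge0 => k _.
  by rewrite !mxE -expr2 sqr_ge0.
have /andP[dH0 dH1] := IHn _ psdH.
rewrite detG; apply/andP; split; first by rewrite mulr_ge0 // ltW.
rewrite big_ord_recl; apply: ler_wpM2l; first exact: ltW.
apply: le_trans dH1 _; apply: ler_prod => i _.
rewrite psd_diag_ge0 //=; apply: le_trans (Hle i) _.
rewrite /G' !mxE.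
by have -> : rshift 1 i = lift 0 i :> 'I_(1 + n) by apply: val_inj.
Qed.

(** The Gram matrix A A^T has determinant (det A)^2 and diagonal entries at most n M^2; the squared
    form avoids a square root. *)
Lemma hadamard (R : realFieldType) n (A : 'M[R]_n) (M : R) :
  (forall i j, `|A i j| <= M) -> (\det A) ^+ 2 <= (M ^+ 2 *+ n) ^+ n.
Proof.
move=> AM.
have /andP[_] := psd_det (psd_gram A).
rewrite det_mulmx det_tr -expr2 => /le_trans; apply.
rewrite -[leRHS](_ : \prod_(i < n) (M ^+ 2 *+ n) = _); last first.
  by rewrite prodr_const card_ord.
apply: ler_prod => i _; rewrite (psd_diag_ge0 _ (psd_gram A)) mxE /=.
rewrite -[leRHS](_ : \sum_(i < n) (M ^+ 2) = _); last first.
  by rewrite sumr_const card_ord.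
apply: ler_sum => j _; rewrite mxE -expr2 -real_normK ?num_real //.
by rewrite lerXn2r ?nnegrE // (le_trans _ (AM i j)).
Qed.

(** * Expansion of det (I + W K) into minors *)

(** [iter_int] with an arbitrary functional in place of the integral over J, so that integrals and
    Riemann sums are iterated alike. *)
Fixpoint iterT (R X : Type) (T : (X -> R) -> R) n (F : seq X -> R) : R :=
  if n is n'.+1 then T (fun x => iterT T n' (fun s => F (x :: s))) else F [::].

Lemma det_perm_conj (R : comPzRingType) n (s : 'S_n) (M : 'M[R]_n) :
  \det (\matrix_(i, j) M (s i) (s j)) = \det M.
Proof.
have -> : \matrix_(i, j) M (s i) (s j) = row_perm s (col_perm s M).
  by apply/matrixP => i j; rewrite !mxE.
rewrite row_permE col_permE !det_mulmx !det_perm odd_permV.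
by rewrite mulrCA -expr2 sqrr_sign mulr1.
Qed.

Section MinorExpansion.
Context (R : realFieldType) (X : Type) (x0 : X) (K : X -> X -> R).
Implicit Types (F : seq X -> R) (ws : seq (X * R)) (l : seq (X * (R * bool))).

Definition minor n (s : seq X) :=
  \det (\matrix_(i < n, j < n) K (nth x0 s i) (nth x0 s j)).

Definition nsum ws (f : X -> R) := \sum_(p <- ws) p.2 * f p.1.

(* A node (x, (w, b)) contributes the row w K(x, .), plus a diagonal 1 if b. *)
Definition gdet n l :=
  \det (\matrix_(i < n, j < n)
    let p := nth (x0, (0, false)) l in
    (p i).2.1 * K (p i).1 (p j).1 + ((p i).2.2 && (i == j))%:R).

Lemma nth_bump_cat (T : Type) (d x : T) (t l : seq T) i :
  nth d (t ++ x :: l) (bump (size t) i) = nth d (t ++ l) i.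
Proof.
rewrite !nth_cat /bump; case: (leqP (size t) i) => [le_ti|lt_it].
  by rewrite add1n ltnNge leqW //= subSn.
by rewrite add0n lt_it.
Qed.

(** The row of the node is w K(x, .) plus a unit vector. The determinant is linear in this row, and
    expanding along the unit vector deletes the node. *)
Lemma gdet_step t x w l n : n = (size t + size l)%N ->
  gdet n.+1 (t ++ (x, (w, true)) :: l) =
  gdet n (t ++ l) + w * gdet n.+1 (t ++ (x, (1, false)) :: l).
Proof.
move=> en; have lt_t : (size t < n.+1)%N by rewrite en ltnS leq_addr.
pose i0 := Ordinal lt_t; rewrite {1 3}/gdet.
set A := \matrix_(_, _) _; set C := \matrix_(_, _) _.
pose B := \matrix_(i, j) if i == i0 then (i == j)%:R else A i j.
have nt d (p : X * (R * bool)) : nth d (t ++ p :: l) (size t) = p.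
  by rewrite nth_cat ltnn subnn.
have nnt d (p q : X * (R * bool)) i : i != size t ->
    nth d (t ++ p :: l) i = nth d (t ++ q :: l) i.
  rewrite !nth_cat; case: ltnP => // le_ti ne.
  by case: (i - size t)%N (subn_eq0 i (size t)) => //=; lia.
have nt1 d v c v' c' i :
  (nth d (t ++ (x, (v, c)) :: l) i).1 = (nth d (t ++ (x, (v', c')) :: l) i).1.
  have [->|ne] := eqVneq i (size t); first by rewrite !nt.
  by rewrite (nnt _ _ (x, (v', c'))).
rewrite (@determinant_multilinear _ _ A B C i0 1 w); first last.
- apply/matrixP=> i j; rewrite !mxE /=.
  have nb : bump (size t) i != size t by rewrite eq_sym neq_bump.
  by rewrite (nnt _ (x, (1, false)) (x, (w, true)) _ nb) (nt1 _ 1 false w true).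
- apply/matrixP=> i j; rewrite 2!mxE [RHS]mxE eq_sym.
  by rewrite (negPf (neq_lift i0 i)).
- apply/rowP=> j; rewrite !mxE eqxx /= !nt /=.
  by rewrite (nt1 _ w true 1 false) addr0 !mul1r addrC.
congr (_ + _); rewrite mul1r (expand_det_row _ i0) (bigD1 i0) //= big1; last first.
  by move=> j nj; rewrite mxE eqxx eq_sym (negPf nj) mul0r.
rewrite addr0 mxE !eqxx mul1r /cofactor -signr_odd oddD addbb mul1r.
congr (\det _); apply/matrixP=> i j.
rewrite !mxE eq_sym (negPf (neq_lift _ _)) /= !nth_bump_cat.
by rewrite (inj_eq lift_inj).
Qed.

(** The exchange carries no sign because exchanging two points of a minor exchanges rows and columns
    together. *)
Definition alt n F := forall s1 x y s2, size (s1 ++ [:: x, y & s2]) = n ->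
  F (s1 ++ [:: x, y & s2]) = F (s1 ++ [:: y, x & s2]) /\
  F (s1 ++ [:: x, x & s2]) = 0.

Lemma alt_cat t n F : alt (size t + n) F -> alt n (fun s => F (t ++ s)).
Proof.
move=> aF s1 x y s2 sz; rewrite !catA; apply: aF.
by rewrite -catA size_cat sz.
Qed.

Lemma alt_minor n : alt n (minor n).
Proof.
move=> s1 x y s2; rewrite size_cat /= => sz.
have lt1 : (size s1 < n)%N by lia.
have lt2 : ((size s1).+1 < n)%N by lia.
pose i1 := Ordinal lt1; pose i2 := Ordinal lt2.
have n1 p q : nth x0 (s1 ++ [:: p, q & s2]) (size s1) = p.
  by rewrite nth_cat ltnn subnn.
have n2 p q : nth x0 (s1 ++ [:: p, q & s2]) (size s1).+1 = q.
  by rewrite nth_cat ltnNge leqnSn /= subSnn.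
split; last first.
  apply: (determinant_alternate (_ : i1 != i2)) => [|j].
    by rewrite -val_eqE /= neq_ltn ltnSn.
  by rewrite !mxE /= n1 n2.
have E i : nth x0 (s1 ++ [:: y, x & s2]) i =
    nth x0 (s1 ++ [:: x, y & s2])
      (if i == size s1 then (size s1).+1 else if i == (size s1).+1 then size s1 else i).
  case: eqP => [->|ne1]; first by rewrite n1 n2.
  case: eqP => [->|ne2]; first by rewrite n1 n2.
  rewrite !nth_cat; case: ltnP => // le_ti.
  have : (i - size s1 > 1)%N by lia.
  by case: (i - size s1)%N => [//|[//|k]].
have tv k : val (tperm i1 i2 k) = (if val k == size s1 then (size s1).+1 else
    if val k == (size s1).+1 then size s1 else val k).
  have -> : (val k == size s1) = (k == i1) by rewrite -val_eqE.
  have -> : (val k == (size s1).+1) = (k == i2) by rewrite -val_eqE.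
  case: tpermP => [->|->|/eqP/negPf-> /eqP/negPf->] //; rewrite eqxx //.
  by rewrite -val_eqE /= (gtn_eqF (ltnSn _)).
rewrite /minor -[LHS](det_perm_conj (tperm i1 i2)); congr (\det _).
by apply/matrixP => i j; rewrite !mxE !E -!tv.
Qed.

Lemma eq_iterT ws n F G : F =1 G -> iterT (nsum ws) n F = iterT (nsum ws) n G.
Proof.
elim: n F G => [|n IHn] F G FG /=; first exact: FG.
by apply: eq_bigr => p _; congr (_ * _); apply: IHn => s; apply: FG.
Qed.

Lemma iterT0 ws n F : (forall s, size s = n -> F s = 0) -> iterT (nsum ws) n F = 0.
Proof.
elim: n F => [|n IHn] F F0 /=; first exact: F0.
rewrite /nsum big1 // => p _; rewrite IHn ?mulr0 // => s sz.
by rewrite F0 //= sz.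
Qed.

Lemma iterT_nsum_eq ws n F G : (forall s, size s = n -> F s = G s) ->
  iterT (nsum ws) n F = iterT (nsum ws) n G.
Proof.
elim: n F G => [|n IHn] F G FG /=; first exact: FG.
apply: eq_bigr => p _; congr (_ * _); apply: IHn => s sz; apply: FG.
by rewrite /= sz.
Qed.

(** Among the tuples that involve the new node, those using it twice contribute 0, and those using
    it once agree for all [n.+1] positions of the node. *)
Lemma iterT_cons p ws n F : alt n.+1 F ->
  iterT (nsum (p :: ws)) n.+1 F =
  iterT (nsum ws) n.+1 F +
  n.+1%:R * (p.2 * iterT (nsum ws) n (fun s => F (p.1 :: s))).
Proof.
elim: n F => [|n IHn] F aF.
  by rewrite /= /nsum big_cons mul1r addrC.
have altx x : alt n.+1 (fun s => F (x :: s)) by apply: (@alt_cat [:: x]).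
have -> : iterT (nsum (p :: ws)) n.+2 F =
    p.2 * iterT (nsum (p :: ws)) n.+1 (fun s => F (p.1 :: s)) +
    nsum ws (fun x => iterT (nsum (p :: ws)) n.+1 (fun s => F (x :: s))).
  by rewrite [LHS]/= {1}/nsum big_cons.
rewrite IHn // (@iterT0 ws n (fun s => F [:: p.1, p.1 & s])) ?mulr0 ?addr0; last first.
  by move=> s sz; apply: (aF [::] p.1 p.1 s _).2; rewrite /= sz.
have -> : nsum ws (fun x => iterT (nsum (p :: ws)) n.+1 (fun s => F (x :: s))) =
  nsum ws (fun x => iterT (nsum ws) n.+1 (fun s => F (x :: s)) +
     n.+1%:R * (p.2 * iterT (nsum ws) n (fun s => F [:: x, p.1 & s]))).
  by apply: eq_bigr => q _; rewrite IHn.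
have -> : nsum ws (fun x => iterT (nsum ws) n.+1 (fun s => F (x :: s)) +
     n.+1%:R * (p.2 * iterT (nsum ws) n (fun s => F [:: x, p.1 & s]))) =
   iterT (nsum ws) n.+2 F + n.+1%:R * (p.2 * iterT (nsum ws) n.+1 (fun s => F (p.1 :: s))).
  rewrite /= /nsum !mulr_sumr -big_split /=; apply: eq_bigr => q _.
  rewrite mulrDr; congr (_ + _); rewrite !mulrA; congr (_ * _).
    by rewrite -mulrA mulrC.
  apply: iterT_nsum_eq => s sz.
  by rewrite (aF [::] q.1 p.1 s _).1 //= sz.
rewrite -[n.+2%:R]natr1; ring.
Qed.

(** In the induction [t] lists the nodes already chosen as rows of the minor and [ws] the undecided
    ones; each step decides one node. Any [M] that is large enough will do, as further terms vanish;
    this freedom lets sums for different meshes be cut at the same place. *)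
Lemma gdet_expansion ws t M : (size ws <= M)%N ->
  gdet (size t + size ws)
    ([seq (x, (1, false)) | x <- t] ++ [seq (p.1, (p.2, true)) | p <- ws]) =
  \sum_(n < M.+1) n`!%:R^-1 *
     iterT (nsum ws) n (fun s => minor (size t + n) (t ++ s)).
Proof.
elim: ws t M => [|p ws IHws] t M /=.
  move=> _; rewrite big_ord_recl big1 /= => [|i _]; last first.
    by rewrite [nsum _ _]big_nil mulr0.
  rewrite fact0 invr1 mul1r addr0 !addn0 !cats0 /gdet /minor.
  congr (\det _); apply/matrixP => i j; rewrite !mxE.
  by rewrite !(nth_map x0) //= mul1r addr0.
case: M => // M; rewrite ltnS => leM.
rewrite addnS gdet_step ?size_map //.
rewrite (IHws _ M.+1) ?leqW //.
have := IHws (rcons t p.1) M leM.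
rewrite map_rcons cat_rcons size_rcons addSn => ->.
rewrite big_ord_recl [RHS]big_ord_recl -addrA; congr (_ + _).
rewrite mulr_sumr -big_split; apply: eq_bigr => i _.
rewrite lift0 [in RHS](@iterT_cons p ws i (fun s => minor (size t + i.+1) (t ++ s))); last first.
  by apply: alt_cat; apply: alt_minor.
rewrite mulrDr; congr (_ + _).
rewrite factS natrM invfM.
have i1 : i.+1%:R != 0 :> R by rewrite pnatr_eq0.
under [in RHS]eq_iterT do rewrite -cat_rcons.
have b0 : i`!%:R != 0 :> R by rewrite pnatr_eq0 -lt0n fact_gt0.
rewrite addnS addSn; move: (i.+1%:R) (i`!%:R) i1 b0 => c d c0 d0; field.
by rewrite c0 d0.
Qed.

End MinorExpansion.

Definition nodes (R X : Type) N (x : 'I_N -> X) (w : 'I_N -> R) : seq (X * R) :=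
  [seq (x i, w i) | i <- enum 'I_N].

Lemma nsum_nodes (R : realFieldType) X N (x : 'I_N -> X) (w : 'I_N -> R) f :
  nsum (nodes x w) f = \sum_i w i * f (x i).
Proof. by rewrite /nsum big_map big_enum. Qed.

Lemma det_expansion (R : realFieldType) (X : Type) (x0 : X) (K : X -> X -> R)
    N (x : 'I_N -> X) (w : 'I_N -> R) M : (N <= M)%N ->
  \det (1%:M + \matrix_(i, j) (w i * K (x i) (x j))) =
  \sum_(n < M.+1) n`!%:R^-1 * iterT (nsum (nodes x w)) n (minor x0 K n).
Proof.
move=> NM; have sz : size (nodes x w) = N by rewrite size_map size_enum_ord.
have := @gdet_expansion R X x0 K (nodes x w) [::] M; rewrite sz => /(_ NM) /= <-.
rewrite /gdet add0n; congr (\det _); apply/matrixP => i j; rewrite !mxE /=.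
have E (k : 'I_N) : nth (x0, (0, false)) [seq (p.1, (p.2, true)) | p <- nodes x w] k
    = (x k, (w k, true)).
  rewrite (nth_map (x k, w k)) ?sz // (nth_map k) ?size_enum_ord //.
  by rewrite nth_ord_enum.
by rewrite !E /= addrC.
Qed.

Lemma norm_iterT_nsum (R : realFieldType) X (ws : seq (X * R)) n (F : seq X -> R) (B V : R) :
  \sum_(p <- ws) `|p.2| <= V -> 0 <= B ->
  (forall s, size s = n -> `|F s| <= B) -> `|iterT (nsum ws) n F| <= V ^+ n * B.
Proof.
move=> wV B0.
have V0 : 0 <= V by apply: le_trans wV; apply: sumr_ge0.
elim: n F => [|n IHn] F FB /=; first by rewrite expr0 mul1r; apply: FB.
apply: (le_trans (ler_norm_sum _ _ _)).
apply: (@le_trans _ _ (\sum_(p <- ws) `|p.2| * (V ^+ n * B))).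
  apply: ler_sum => p _; rewrite normrM; apply: ler_wpM2l => //.
  by apply: IHn => s sz; apply: FB; rewrite /= sz.
rewrite -mulr_suml exprS -mulrA; apply: ler_wpM2r => //.
by rewrite mulr_ge0 // exprn_ge0.
Qed.

Lemma norm_det_crude (R : realFieldType) n (A : 'M[R]_n) :
  (forall i j, `|A i j| <= 1) -> `|\det A| <= n`!%:R.
Proof.
move=> A1; apply: le_trans (ler_norm_sum _ _ _) _.
rewrite -card_Sn -sum1_card natr_sum; apply: ler_sum => s _.
rewrite normrM normr_sign mul1r normr_prod.
apply: prodr_ile1 => i _; rewrite normr_ge0 /=; exact: A1.
Qed.

Lemma sum_geo_le (R : realFieldType) (t : R) m n : 0 <= t -> t <= 2^-1 ->
  \sum_(i < n) t ^+ (m + i) <= 2 * t ^+ m.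
Proof.
move=> t0 t1; have tm : 0 <= t ^+ m by rewrite exprn_ge0.
suff : \sum_(i < n) t ^+ (m + i) <= 2 * t ^+ m - 2 * t ^+ (m + n).
  by move=> /le_trans; apply; rewrite lerBlDr lerDl mulr_ge0 // exprn_ge0.
elim: n => [|n IHn]; first by rewrite big_ord0 addn0 subrr.
rewrite big_ord_recr /= addnS exprS.
have tn : 0 <= t ^+ (m + n) by rewrite exprn_ge0.
have : t * t ^+ (m + n) <= 2^-1 * t ^+ (m + n) by rewrite ler_wpM2r.
lra.
Qed.

(** Writing E i j = v i * K i j with |K i j| <= 1 makes [E] a weighted kernel. In the expansion into
    minors the orders 0 and 1 give 1 and the trace, and the order n is at most t^n, the bound n! of
    a minor cancelling 1/n!. *)
Lemma det_small_perturbation (R : realFieldType) N (E : 'M[R]_N) (v : 'I_N -> R) (t : R) :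
  (forall i j, `|E i j| <= v i) -> \sum_i v i <= t -> t <= 2^-1 ->
  `|\det (1%:M + E) - 1 - \tr E| <= 2 * t ^+ 2.
Proof.
case: N E v => [|N] E v Ev vt t1.
  rewrite det_mx00 /mxtrace big_ord0 !subrr normr0.
  by rewrite mulr_ge0 // sqr_ge0.
have v0 i : 0 <= v i by apply: le_trans (Ev i i).
have t0 : 0 <= t by apply: le_trans vt; apply: sumr_ge0.
(* Where [v i = 0] the row of [E] vanishes, so the default quotient 0 is the right value. *)
pose K i j := E i j / v i.
have vK i j : v i * K i j = E i j.
  rewrite /K; have [vi|vi] := eqVneq (v i) 0; last by rewrite mulrC divfK.
  by have := Ev i j; rewrite vi normr_le0 => /eqP ->; rewrite !mul0r.
have K1 i j : `|K i j| <= 1.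
  rewrite /K normrM normfV (ger0_norm (v0 i)).
  have [->|vi] := eqVneq (v i) 0; first by rewrite invr0 mulr0.
  by rewrite ler_pdivrMr ?mul1r // lt_neqAle eq_sym vi v0.
pose F n := iterT (nsum (nodes id v)) n (minor ord0 K n).
have -> : E = \matrix_(i, j) (v i * K i j) by apply/matrixP => i j; rewrite mxE vK.
rewrite (@det_expansion R _ ord0 K N.+1 id v N.+2) // big_ord_recl big_ord_recl.
have tr1 : iterT (nsum (nodes id v)) 1 (minor ord0 K 1) =
   \tr (\matrix_(i, j) (v i * K i j)).
  rewrite /= nsum_nodes; apply: eq_bigr => i _.
  by rewrite /minor det_mx11 !mxE.
rewrite lift0 tr1 [iterT _ _ (minor _ _ 0)]/= [minor _ _ 0 _]det_mx00 !invr1 !mul1r.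
set S := \sum_(i < _) _; rewrite (_ : _ - 1 - _ = S); last by ring.
apply: le_trans (ler_norm_sum _ _ _) _.
apply: le_trans (sum_geo_le 2 N.+1 t0 t1); apply: ler_sum => i _.
rewrite !lift0 normrM normfV (@ger0_norm _ (_`!)%:R) ?ler0n //.
rewrite ler_pdivrMl ?ltr0n ?fact_gt0 // mulrC.
apply: norm_iterT_nsum.
- by rewrite big_map big_enum /=; under eq_bigr do rewrite ger0_norm //.
- exact: ler0n.
- by move=> s _; apply: norm_det_crude => k l; rewrite mxE.
Qed.

Lemma minorN (R : realFieldType) X (x0 : X) (K : X -> X -> R) n s :
  minor x0 (fun x y => - K x y) n s = (-1) ^+ n * minor x0 K n s.
Proof.
rewrite /minor -detZ; congr (\det _); apply/matrixP => i j.
by rewrite !mxE mulN1r.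
Qed.

Lemma iterTZ (R : realFieldType) X (ws : seq (X * R)) n c F :
  iterT (nsum ws) n (fun s => c * F s) = c * iterT (nsum ws) n F.
Proof.
elim: n F => [|n IHn] F //=; rewrite /nsum mulr_sumr.
by apply: eq_bigr => p _; rewrite IHn mulrCA.
Qed.

(** * Lipschitz functions and bounded functionals *)

(* Only nonnegativity of the distance is used, so that points, pairs and
   sequences of points can share one notion of Lipschitz function. *)
Record dommet (R : realType) (Y : Type) := Dommet {
  ldom : Y -> Prop;
  ldist : Y -> Y -> R;
  ldist_ge0 : forall y y', 0 <= ldist y y' }.

Section Lip.
Context (R : realType) (Y : Type) (E : dommet R Y).
Implicit Types f g : Y -> R.

(** One constant bounds values and slopes; boundedness is included because products of Lipschitz
    functions need it. *)
Definition lipM f := exists C : R, [/\ 0 <= C,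
  forall y, ldom E y -> `|f y| <= C &
  forall y y', ldom E y -> ldom E y' -> `|f y - f y'| <= C * ldist E y y'].

Lemma eq_lipM f g : (forall y, ldom E y -> f y = g y) -> lipM f -> lipM g.
Proof.
move=> fg [C [C0 Cb Cl]]; exists C; split=> // [y yE|y y' yE y'E].
  by rewrite -fg // Cb.
by rewrite -!fg // Cl.
Qed.

Lemma lipM_cst c : lipM (fun=> c).
Proof.
exists `|c|; split=> // y y' _ _; rewrite subrr normr0 mulr_ge0 //.
exact: ldist_ge0.
Qed.

Lemma lipMD f g : lipM f -> lipM g -> lipM (fun y => f y + g y).
Proof.
move=> [C [C0 Cb Cl]] [D [D0 Db Dl]]; exists (C + D); split=> [|y yE|y y' yE y'E].
- exact: addr_ge0.
- by apply: le_trans (ler_normD _ _) _; apply: lerD; [exact: Cb|exact: Db].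
- rewrite opprD addrACA mulrDl; apply: le_trans (ler_normD _ _) _.
  by apply: lerD; [exact: Cl|exact: Dl].
Qed.

Lemma lipMM f g : lipM f -> lipM g -> lipM (fun y => f y * g y).
Proof.
move=> [C [C0 Cb Cl]] [D [D0 Db Dl]].
have CD0 : 0 <= C * D by rewrite mulr_ge0.
exists (C * D *+ 2); split=> [|y yE|y y' yE y'E].
- exact: mulrn_wge0.
- rewrite normrM mulr2n; apply: (@le_trans _ _ (C * D)); last by rewrite lerDl.
  by apply: ler_pM => //; [exact: Cb|exact: Db].
- have -> : f y * g y - f y' * g y' = f y * (g y - g y') + (f y - f y') * g y'.
    by ring.
  rewrite mulr2n [leRHS]mulrDl; apply: le_trans (ler_normD _ _) _.
  rewrite !normrM -(mulrA C D); apply: lerD.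
    by apply: ler_pM => //; [exact: Cb|exact: Dl].
  rewrite (mulrC D) mulrA; apply: ler_pM => //; [exact: Cl|exact: Db].
Qed.

Lemma lipMN f : lipM f -> lipM (fun y => - f y).
Proof.
move=> [C [C0 Cb Cl]]; exists C; split=> // [y yE|y y' yE y'E].
  by rewrite normrN Cb.
by rewrite -opprD normrN Cl.
Qed.

Lemma lipMB f g : lipM f -> lipM g -> lipM (fun y => f y - g y).
Proof. by move=> lf lg; apply: lipMD => //; apply: lipMN. Qed.

Lemma lipM_sum (I : Type) (r : seq I) (P : pred I) (F : I -> Y -> R) :
  (forall i, lipM (F i)) -> lipM (fun y => \sum_(i <- r | P i) F i y).
Proof.
move=> lF; elim: r => [|i r IHr].
  by apply: eq_lipM (lipM_cst 0) => y _; rewrite big_nil.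
have [Pi|Pi] := boolP (P i).
  apply: eq_lipM (lipMD (lF i) IHr) => y _; by rewrite big_cons Pi.
by apply: eq_lipM IHr => y _; rewrite big_cons (negPf Pi).
Qed.

Lemma lipM_prod (I : Type) (r : seq I) (P : pred I) (F : I -> Y -> R) :
  (forall i, lipM (F i)) -> lipM (fun y => \prod_(i <- r | P i) F i y).
Proof.
move=> lF; elim: r => [|i r IHr].
  by apply: eq_lipM (lipM_cst 1) => y _; rewrite big_nil.
have [Pi|Pi] := boolP (P i).
  apply: eq_lipM (lipMM (lF i) IHr) => y _; by rewrite big_cons Pi.
by apply: eq_lipM IHr => y _; rewrite big_cons (negPf Pi).
Qed.

End Lip.

Lemma lipM_comp (R : realType) Y Y' (E : dommet R Y) (E' : dommet R Y')
    (h : Y -> Y') (f : Y' -> R) :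
  (forall y, ldom E y -> ldom E' (h y)) ->
  (forall y y', ldom E y -> ldom E y' -> ldist E' (h y) (h y') <= ldist E y y') ->
  lipM E' f -> lipM E (fun y => f (h y)).
Proof.
move=> hE hd [C [C0 Cb Cl]]; exists C; split=> // [y yE|y y' yE y'E].
  exact/Cb/hE.
apply: le_trans (Cl _ _ (hE _ yE) (hE _ y'E)) _.
by apply: ler_wpM2l => //; apply: hd.
Qed.

Section Box.
Context (R : realType) (al be : R).

Definition inbox (x : R) := al <= x <= be.

Definition box1 : dommet R R :=
  @Dommet R R inbox (fun x y => `|x - y|) (fun x y => normr_ge0 _).

Lemma box2_ge0 (z z' : R * R) : 0 <= `|z.1 - z'.1| + `|z.2 - z'.2|.
Proof. exact: addr_ge0. Qed.

Definition box2 : dommet R (R * R) :=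
  @Dommet R (R * R) (fun z => inbox z.1 /\ inbox z.2) _ box2_ge0.

Lemma boxn_ge0 n (s s' : seq R) : 0 <= \sum_(i < n) `|s`_i - s'`_i|.
Proof. exact: sumr_ge0. Qed.

Definition boxn n : dommet R (seq R) :=
  @Dommet R (seq R) (fun s => size s = n /\ all inbox s) _ (@boxn_ge0 n).

Definition lip1 (f : R -> R) := lipM box1 f.
Definition lip2 (k : R -> R -> R) := lipM box2 (fun z => k z.1 z.2).
Definition lipn n (F : seq R -> R) := lipM (boxn n) F.

Lemma lip2_row k x : lip2 k -> inbox x -> lip1 (fun y => k x y).
Proof.
move=> lk bx; apply: (lipM_comp (E' := box2) (h := fun y => (x, y)) _ _ lk) => //=.
by move=> y y' _ _; rewrite subrr normr0 add0r.
Qed.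

Lemma lip2_col k y : lip2 k -> inbox y -> lip1 (fun x => k x y).
Proof.
move=> lk bx; apply: (lipM_comp (E' := box2) (h := fun x => (x, y)) _ _ lk) => //=.
by move=> x x' _ _; rewrite subrr normr0 addr0.
Qed.

Lemma lip2_swap k : lip2 k -> lip2 (fun x y => k y x).
Proof.
move=> lk; apply: (lipM_comp (E' := box2) (h := fun z => (z.2, z.1)) _ _ lk) => /=.
  by move=> y [].
by move=> y y' _ _; rewrite addrC.
Qed.

Lemma lip2_fst f : lip1 f -> lip2 (fun x _ => f x).
Proof.
move=> lf; apply: (lipM_comp (E' := box1) (h := fst) _ _ lf) => /=.
  by move=> y [].
by move=> y y' _ _; rewrite lerDl.
Qed.

Lemma lip2_snd f : lip1 f -> lip2 (fun _ y => f y).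
Proof.
move=> lf; apply: (lipM_comp (E' := box1) (h := snd) _ _ lf) => /=.
  by move=> y [].
by move=> y y' _ _; rewrite lerDr.
Qed.

Lemma lip2_diag k : lip2 k -> lip1 (fun x => k x x).
Proof.
move=> [C [C0 Cb Cl]]; exists (C *+ 2); split=> [|x bx|x x' bx bx'].
- exact: mulrn_wge0.
- by apply: le_trans (Cb (x, x) _) _ => //; rewrite mulr2n lerDl.
- apply: le_trans (Cl (x, x) (x', x') _ _) _ => //=.
  by rewrite -mulr2n mulrnAr mulrnAl.
Qed.

Lemma lip1_id : lip1 id.
Proof.
exists (`|al| + `|be| + 1); split=> [|x /andP[ax xb]|x x' _ _].
- by rewrite addr_ge0 // addr_ge0.
- rewrite ler_norml; have := ler_norm be; have := ler_norm (- al).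
  rewrite normrN; have := normr_ge0 be; have := normr_ge0 al; lra.
- by apply: ler_peMl => //; rewrite lerDr addr_ge0.
Qed.

Lemma inbox_nth n s (i : 'I_n) : ldom (boxn n) s -> inbox s`_i.
Proof. by move=> [sz /all_nthP]; apply; rewrite sz. Qed.

Lemma lipn_nth n k (i j : 'I_n) : lip2 k -> lipn n (fun s => k s`_i s`_j).
Proof.
move=> [C [C0 Cb Cl]]; exists (C *+ 2); split=> [|s bs|s s' bs bs'].
- exact: mulrn_wge0.
- apply: le_trans (Cb (s`_i, s`_j) _) _; last by rewrite mulr2n lerDl.
  by split; apply: inbox_nth bs.
- apply: le_trans (Cl (s`_i, s`_j) (s'`_i, s'`_j) _ _) _.
  + by split; apply: inbox_nth bs.
  + by split; apply: inbox_nth bs'.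
  have ineq (l : 'I_n) : `|s`_l - s'`_l| <= ldist (boxn n) s s'.
    by rewrite /= (bigD1 l) //= lerDl; apply: sumr_ge0.
  rewrite /= mulrnAl -mulrnAr; apply: ler_wpM2l => //.
  by rewrite mulr2n; apply: lerD; apply: ineq.
Qed.

Lemma lipn_minor n k : lip2 k -> lipn n (minor 0 k n).
Proof.
move=> lk; apply: lipM_sum => s; apply: lipMM; first exact: lipM_cst.
apply: lipM_prod => i; apply: eq_lipM (lipn_nth i (s i) lk) => y _.
by rewrite mxE.
Qed.

Lemma lipn_cons n F x : lipn n.+1 F -> inbox x -> lipn n (fun s => F (x :: s)).
Proof.
move=> lF bx; apply: (lipM_comp (E' := boxn n.+1) (h := cons x) _ _ lF) => /=.
  by move=> s [-> ->]; rewrite bx.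
by move=> s s' _ _; rewrite big_ord_recl /= subrr normr0 add0r.
Qed.

(* T is a bounded linear functional on the Lipschitz functions of the box. *)
Record bfun (T : (R -> R) -> R) (V : R) : Prop := {
  bfun_ge0 : 0 <= V;
  bfunD : forall f g, lip1 f -> lip1 g -> T (fun x => f x + g x) = T f + T g;
  bfunZ : forall c f, lip1 f -> T (fun x => c * f x) = c * T f;
  bfun_le : forall f B, lip1 f -> (forall x, inbox x -> `|f x| <= B) ->
    `|T f| <= V * B }.

Section Bfun.
Context (T : (R -> R) -> R) (V : R) (bT : bfun T V).

Lemma bfunN f : lip1 f -> T (fun x => - f x) = - T f.
Proof.
move=> lf; rewrite -[RHS]mulN1r -(bfunZ bT) //.
by congr T; apply/funext => x; rewrite mulN1r.
Qed.

Lemma bfunB f g : lip1 f -> lip1 g -> T (fun x => f x - g x) = T f - T g.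
Proof. by move=> lf lg; rewrite (bfunD bT) ?bfunN //; apply: lipMN. Qed.

(** The norm bound with [B = 0]: a bounded functional sees only the box. *)
Lemma eq_bfun f g : lip1 f -> (forall x, inbox x -> f x = g x) -> T f = T g.
Proof.
move=> lf fg; have lg : lip1 g by apply: eq_lipM lf.
apply/eqP; rewrite -subr_eq0 -normr_le0 -bfunB //.
rewrite -(mulr0 V); apply: (bfun_le bT); first exact: lipMB.
by move=> x bx; rewrite fg // subrr normr0.
Qed.

Lemma bfun_dist f g B : lip1 f -> lip1 g ->
  (forall x, inbox x -> `|f x - g x| <= B) -> `|T f - T g| <= V * B.
Proof.
by move=> lf lg fg; rewrite -bfunB //; apply: (bfun_le bT) => //; apply: lipMB.
Qed.

Lemma bfun0 : T (fun=> 0) = 0.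
Proof.
rewrite -[RHS](mul0r (T (fun=> 0))) -(bfunZ bT); last exact: lipM_cst.
by congr T; apply/funext => x; rewrite mul0r.
Qed.

Lemma bfun_sum (I : Type) (r : seq I) (F : I -> R -> R) :
  (forall i, lip1 (F i)) ->
  T (fun x => \sum_(i <- r) F i x) = \sum_(i <- r) T (F i).
Proof.
move=> lF; elim: r => [|i r IHr].
  by rewrite big_nil -[RHS]bfun0; congr T; apply/funext => x; rewrite big_nil.
rewrite big_cons -IHr -(bfunD bT) //; last exact: lipM_sum.
by congr T; apply/funext => x; rewrite big_cons.
Qed.

Lemma lip1_bfun k : lip2 k -> lip1 (fun x => T (fun y => k x y)).
Proof.
move=> lk; have [C [C0 Cb Cl]] := lk; have V0 := bfun_ge0 bT.
exists (V * C); split=> [|x bx|x x' bx bx']; first exact: mulr_ge0.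
  apply: (bfun_le bT); first exact: lip2_row.
  by move=> y b_y; apply: (Cb (x, y)).
rewrite -mulrA; apply: bfun_dist => [||y b_y]; try exact: lip2_row.
apply: le_trans (Cl (x, y) (x', y) _ _) _ => //=.
by rewrite subrr normr0 addr0.
Qed.

(** Both claims share one induction: the estimate for [n] iterations, applied to a difference, makes
    the inner expression Lipschitz in the outer variable, so that [T] can act on it. *)
Lemma bfun_iterTB_le n :
  (forall F G, lipn n F -> lipn n G ->
     iterT T n (fun s => F s - G s) = iterT T n F - iterT T n G) /\
  (forall F B, lipn n F -> (forall s, ldom (boxn n) s -> `|F s| <= B) ->
     `|iterT T n F| <= V ^+ n * B).
Proof.
have V0 := bfun_ge0 bT.
elim: n => [|n [IHB IHle]] /=.
  by split=> // F B _ FB; rewrite expr0 mul1r; apply: FB; split.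
have lip_it F : lipn n.+1 F -> lip1 (fun x => iterT T n (fun s => F (x :: s))).
  move=> lF; have [C [C0 Cb Cl]] := lF.
  exists (V ^+ n * C); split=> [|x bx|x x' bx bx'].
  - by rewrite mulr_ge0 // exprn_ge0.
  - apply: IHle; first exact: lipn_cons.
    by move=> s [sz bs]; apply: Cb; split; rewrite /= ?sz ?bx.
  - rewrite -mulrA -IHB; [|exact: lipn_cons|exact: lipn_cons].
    apply: IHle => [|s [sz bs]]; first by apply: lipMB; exact: lipn_cons.
    apply: le_trans (Cl (x :: s) (x' :: s) _ _) _; try by split; rewrite /= ?sz ?bx ?bx'.
    rewrite /= big_ord_recl /= big1 ?addr0 // => i _.
    by rewrite subrr normr0.
split=> [F G lF lG|F B lF FB].
  rewrite -bfunB; [|exact: lip_it|exact: lip_it].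
  apply: eq_bfun => [|x bx]; last by rewrite IHB //; exact: lipn_cons.
  by apply: (lip_it (fun s => F s - G s)); apply: lipMB.
rewrite exprS -mulrA; apply: (bfun_le bT); first exact: lip_it.
move=> x bx; apply: IHle; first exact: lipn_cons.
by move=> s [sz bs]; apply: FB; split; rewrite /= ?sz ?bx.
Qed.

Lemma iterT_dist n F F' B : lipn n F -> lipn n F' ->
  (forall s, ldom (boxn n) s -> `|F s - F' s| <= B) ->
  `|iterT T n F - iterT T n F'| <= V ^+ n * B.
Proof.
move=> lF lF' FB; have [iB ile] := bfun_iterTB_le n.
by rewrite -iB //; apply: ile => //; apply: lipMB.
Qed.

Lemma iterT_lip n F L : lipn n.+1 F -> 0 <= L ->
  (forall s s', ldom (boxn n.+1) s -> ldom (boxn n.+1) s' ->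
    `|F s - F s'| <= L * ldist (boxn n.+1) s s') ->
  forall x x', inbox x -> inbox x' ->
  `|iterT T n (fun s => F (x :: s)) - iterT T n (fun s => F (x' :: s))|
     <= V ^+ n * L * `|x - x'|.
Proof.
move=> lF L0 FL x x' bx bx'; rewrite -mulrA; apply: iterT_dist.
- exact: lipn_cons.
- exact: lipn_cons.
move=> s [sz bs]; apply: le_trans (FL (x :: s) (x' :: s) _ _) _.
- by split; rewrite /= ?sz ?bx.
- by split; rewrite /= ?sz ?bx'.
rewrite /= big_ord_recl /= big1 ?addr0 // => i _.
by rewrite subrr normr0.
Qed.

End Bfun.

End Box.

Lemma cvgn_unique (R : realType) (u : nat -> R) (l l' : R) :
  u @ \oo --> l -> u @ \oo --> l' -> l = l'.
Proof. exact: cvg_unique. Qed.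

Lemma cvgn_norm_le (R : realType) (u : nat -> R) (l B : R) :
  u @ \oo --> l -> (forall n, `|u n| <= B) -> `|l| <= B.
Proof.
move=> ul uB; have cv : `|u n| @[n --> \oo] --> `|l| by exact: cvg_norm.
by apply: (@cvgr_to_le _ _ _ _ _ _ _ cv); apply: nearW.
Qed.

(** * Riemann sums *)

Section Disc.
Context (R : realType) (al be : R) (hab : al <= be).
Local Notation inbox := (inbox al be).
Local Notation lip1 := (lip1 al be).
Local Notation lip2 := (lip2 al be).
Local Notation lipn := (lipn al be).
Local Notation bfun := (bfun al be).

Definition eta (N : nat) : R := (be - al) / N.+1%:R.
Definition xn N (i : 'I_N.+1) : R := al + i%:R * eta N.

Lemma eta_ge0 N : 0 <= eta N.
Proof. by rewrite divr_ge0 // subr_ge0. Qed.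

Lemma inbox_xn N (i : 'I_N.+1) : inbox (xn i).
Proof.
rewrite /inbox /xn lerDl mulr_ge0 ?eta_ge0 //= -lerBrDl /eta mulrCA.
rewrite ler_piMr ?subr_ge0 // ler_pdivrMr ?ltr0n // mul1r ler_nat.
exact/ltnW/ltn_ord.
Qed.

Lemma cvg_eta : eta @ \oo --> 0.
Proof.
by rewrite -(mulr0 (be - al)); apply: cvgMr; exact: cvg_harmonic.
Qed.

Lemma eta_cvg (u : nat -> R) (l C : R) : (forall N, `|l - u N| <= C * eta N) ->
  u @ \oo --> l.
Proof.
move=> ule; apply/cvgrPdist_le => e e0.
have : C * eta N @[N --> \oo] --> 0.
  by rewrite -(mulr0 C); apply: cvgMr; exact: cvg_eta.
move=> /cvgr0Pnorm_le/(_ _ e0); apply: filterS => N.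
by rewrite ler_norml => /andP[_]; apply: le_trans; exact: ule.
Qed.

Lemma eta_eq (x y C : R) : (forall N, `|x - y| <= C * eta N) -> x = y.
Proof.
move=> xy; apply/esym; apply: (@cvgn_unique _ (fun=> x)); last exact: cvg_cst.
by apply: (@eta_cvg _ y C) => N; rewrite distrC; apply: xy.
Qed.

Definition Tn (w : forall N, 'I_N.+1 -> R) N (f : R -> R) : R :=
  nsum (nodes (@xn N) (w N)) f.

Lemma TnE w N f : Tn w N f = \sum_i w N i * f (xn i).
Proof. exact: nsum_nodes. Qed.

(* T is approximated by Riemann sums with nodes xn and weights w of total
   mass at most V. *)
Record disc (T : (R -> R) -> R) (V : R) (w : forall N, 'I_N.+1 -> R) : Prop := {
  disc_weight : forall N, \sum_i `|w N i| <= V;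
  disc_err : forall N f L, 0 <= L ->
    (forall x x', inbox x -> inbox x' -> `|f x - f x'| <= L * `|x - x'|) ->
    `|T f - Tn w N f| <= V * L * eta N }.

Lemma lip1_Lip f : lip1 f -> exists2 L, 0 <= L &
  forall x x', inbox x -> inbox x' -> `|f x - f x'| <= L * `|x - x'|.
Proof. by move=> [C [C0 _ Cl]]; exists C. Qed.

Section OneDisc.
Context T V w (dT : disc T V w).

Lemma disc_ge0 : 0 <= V.
Proof. by apply: le_trans (disc_weight dT 0); apply: sumr_ge0. Qed.

Lemma bfun_Tn N : bfun (Tn w N) V.
Proof.
split=> [|f g _ _|c f _|f B lf fB]; first exact: disc_ge0.
- by rewrite !TnE -big_split; apply: eq_bigr => i _; rewrite mulrDr.
- by rewrite !TnE mulr_sumr; apply: eq_bigr => i _; rewrite mulrCA.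
rewrite TnE; apply: le_trans (ler_norm_sum _ _ _) _.
have B0 : 0 <= B by apply: le_trans (fB _ (inbox_xn (@ord0 0))).
apply: le_trans (ler_wpM2r B0 (disc_weight dT N)).
rewrite mulr_suml; apply: ler_sum => i _; rewrite normrM.
by apply: ler_wpM2l => //; apply/fB/inbox_xn.
Qed.

Lemma disc_cvg f : lip1 f -> Tn w N f @[N --> \oo] --> T f.
Proof.
move=> /lip1_Lip[L L0 fL]; apply: (@eta_cvg _ _ (V * L)) => N.
exact: disc_err dT _ _ _ L0 fL.
Qed.

Lemma disc_bfun : bfun T V.
Proof.
split=> [|f g lf lg|c f lf|f B lf fB]; first exact: disc_ge0.
- apply: (@cvgn_unique _ (fun N => Tn w N (fun x => f x + g x))).
    by apply: disc_cvg; apply: lipMD.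
  under eq_fun do rewrite (bfunD (bfun_Tn _)) //.
  by apply: cvgD; apply: disc_cvg.
- apply: (@cvgn_unique _ (fun N => Tn w N (fun x => c * f x))).
    by apply: disc_cvg; apply: lipMM => //; exact: lipM_cst.
  under eq_fun do rewrite (bfunZ (bfun_Tn _)) //.
  by apply: cvgMr; apply: disc_cvg.
- apply: (cvgn_norm_le (disc_cvg lf)) => N.
  exact: (bfun_le (bfun_Tn N)).
Qed.

(** A Riemann sum in place of [T] commutes with [U] by linearity, and on either side the replacement
    costs a multiple of the mesh; no product measure is involved. *)
Lemma disc_fubini U VU k : bfun U VU -> lip2 k ->
  T (fun x => U (fun y => k x y)) = U (fun y => T (fun x => k x y)).
Proof.
move=> bU lk; have [C [C0 Cb Cl]] := lk.
have bT := disc_bfun; have VU0 := bfun_ge0 bU.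
apply: (@eta_eq _ _ (V * (VU * C) + VU * (V * C))) => N.
set m := Tn w N (fun x => U (fun y => k x y)).
rewrite -(subrK m (T _)) -addrA; apply: le_trans (ler_normD _ _) _.
rewrite [leRHS]mulrDl; apply: lerD.
  apply: (disc_err dT); first exact: mulr_ge0.
  move=> x x' bx bx'; rewrite -mulrA; apply: (bfun_dist bU); try exact: lip2_row.
  move=> y b_y; apply: le_trans (Cl (x, y) (x', y) _ _) _ => //=.
  by rewrite subrr normr0 addr0.
have -> : m = U (fun y => Tn w N (fun x => k x y)).
  rewrite /m TnE; under [in RHS]eq_fun do rewrite TnE.
  rewrite (bfun_sum bU) => [|i].
    apply: eq_bigr => i _; rewrite (bfunZ bU) //.
    exact/lip2_row/inbox_xn.
  apply: lipMM; first exact: lipM_cst.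
  exact/lip2_row/inbox_xn.
rewrite -mulrA; apply: (bfun_dist bU).
- exact: (lip1_bfun (bfun_Tn N) (lip2_swap lk)).
- exact: (lip1_bfun bT (lip2_swap lk)).
- move=> y b_y; rewrite distrC; apply: (disc_err dT) => // x x' bx bx'.
  apply: le_trans (Cl (x, y) (x', y) _ _) _ => //=.
  by rewrite subrr normr0 addr0.
Qed.

(** The integrals are replaced one at a time, each at the cost V^n C times the mesh. *)
Lemma disc_iterT n F : lipn n F ->
  iterT (Tn w N) n F @[N --> \oo] --> iterT T n F.
Proof.
move=> lF; have [C [C0 _ Cl]] := lF.
have bT := disc_bfun; have V0 := disc_ge0.
apply: (@eta_cvg _ _ (n%:R * V ^+ n * C)) => N.
elim: n F lF Cl => [|n IHn] F lF Cl; first by rewrite /= subrr normr0 !mul0r.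
have Cl' x s s' : inbox x -> ldom (boxn al be n) s -> ldom (boxn al be n) s' ->
    `|F (x :: s) - F (x :: s')| <= C * ldist (boxn al be n) s s'.
  move=> bx [sz bs] [sz' bs']; apply: le_trans (Cl (x :: s) (x :: s') _ _) _.
  - by split; rewrite /= ?sz ?bx.
  - by split; rewrite /= ?sz' ?bx.
  by rewrite /= big_ord_recl /= subrr normr0 add0r.
have [_ bl] := bfun_iterTB_le bT n; have [_ bl'] := bfun_iterTB_le (bfun_Tn N) n.
have lipit T' : bfun T' V -> lip1 (fun x => iterT T' n (fun s => F (x :: s))).
  move=> bT'; have [D [D0 Db _]] := lF; have [_ bl''] := bfun_iterTB_le bT' n.
  have VC : 0 <= V ^+ n * C by rewrite mulr_ge0 // exprn_ge0.
  have VD : 0 <= V ^+ n * D by rewrite mulr_ge0 // exprn_ge0.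
  exists (V ^+ n * C + V ^+ n * D); split=> [|x bx|x x' bx bx'].
  - exact: addr_ge0.
  - apply: (@le_trans _ _ (V ^+ n * D)); last by rewrite lerDr.
    apply: bl''; first exact: lipn_cons.
    by move=> s [sz bs]; apply: Db; split; rewrite /= ?sz ?bx.
  - apply: le_trans (iterT_lip bT' lF C0 Cl bx bx') _.
    by apply: ler_wpM2r => //; rewrite lerDl.
rewrite [in leLHS]/=.
set m := Tn w N (fun x => iterT T n (fun s => F (x :: s))).
rewrite -(subrK m (T _)) -addrA; apply: le_trans (ler_normD _ _) _.
have -> : n.+1%:R * V ^+ n.+1 * C * eta N =
    V * (V ^+ n * C) * eta N + V * (n%:R * V ^+ n * C * eta N).
  by rewrite exprS -natr1; ring.
apply: lerD.
  apply: (disc_err dT); first by rewrite mulr_ge0 ?exprn_ge0.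
  by move=> x x' bx bx'; apply: (iterT_lip bT).
apply: (bfun_dist (bfun_Tn N)).
- exact: lipit.
- by apply: lipit; exact: bfun_Tn.
- move=> x bx; apply: IHn; first exact: lipn_cons.
  by move=> s s'; apply: Cl'.
Qed.

End OneDisc.

End Disc.

(** * Fredholm determinants *)

Lemma sum_half_tail (R : realType) (x : nat -> R) (B : R) M M' :
  0 <= B -> (forall n, `|x n| <= B * 2^-1 ^+ n) -> (M <= M')%N ->
  `|\sum_(M <= n < M') x n| <= 2 * B * 2^-1 ^+ M.
Proof.
move=> B0 xB MM'; apply: le_trans (ler_norm_sum _ _ _) _.
have -> : 2 * B * 2^-1 ^+ M = B * (2 * 2^-1 ^+ M) by ring.
have h0 : 0 <= 2^-1 :> R by rewrite invr_ge0.
apply: le_trans (ler_wpM2l B0 (sum_geo_le M (M' - M) h0 (lexx _))).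
rewrite mulr_sumr -[X in \sum_(X <= _ < _) _]add0n big_addn big_mkord.
by apply: ler_sum => i _; rewrite addnC; exact: xB.
Qed.

Lemma cvg_half_tail (R : realType) (B : R) :
  2 * B * 2^-1 ^+ n @[n --> \oo] --> (0 : R).
Proof.
have h1 : `|2^-1 : R| < 1 by rewrite ger0_norm ?invr_ge0 // invf_lt1 ?ltr1n.
have half0 : 2^-1 ^+ n @[n --> \oo] --> (0 : R).
  by under eq_fun do rewrite -[_ ^+ _]mul1r; exact: cvg_geometric.
by rewrite -(mulr0 (2 * B)); apply: cvgMr.
Qed.

Lemma is_cvg_series_half (R : realType) (c : nat -> R) (B : R) : 0 <= B ->
  (forall n, `|c n| <= B * 2^-1 ^+ n) -> cvgn (series c).
Proof.
move=> B0 cB; apply/cauchy_cvgP/cauchy_seriesP => e e0.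
have /cvgr0Pnorm_lt/(_ _ e0) [M _ HM] := cvg_half_tail B.
exists ([set n | M <= n]%N, [set n | M <= n]%N); first by split; exists M.
move=> [n m] /= [Mn Mm]; case: (leqP n m) => nm; last first.
  by rewrite big_geq ?normr0 // ltnW.
apply: le_lt_trans (sum_half_tail B0 cB nm) _.
by apply: le_lt_trans (ler_norm _) _; exact: HM.
Qed.

Lemma series_half_dist (R : realType) (c : nat -> R) (B : R) M : 0 <= B ->
  (forall n, `|c n| <= B * 2^-1 ^+ n) ->
  `|limn (series c) - \sum_(n < M) c n| <= 2 * B * 2^-1 ^+ M.
Proof.
move=> B0 cB; have cvs := is_cvg_series_half B0 cB.
have cv : series c n - \sum_(n < M) c n @[n --> \oo] -->
    limn (series c) - \sum_(n < M) c n by apply: cvgB => //; exact: cvg_cst.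
apply: (cvgr_to_le (cvg_norm cv)); exists M => // n /= Mn.
rewrite /series /= -(big_mkord predT c) (big_cat_nat (n := M)) //=.
by rewrite addrC addrK; exact: sum_half_tail.
Qed.

(** Tannery's theorem: the geometric majorant, valid for all N, controls the tails, and a fixed head
    converges term by term. The finite sum equals [d N] for every large [M], so it can be made to
    contain the head. *)
Lemma tannery (R : realType) (c : nat -> R) (cN : nat -> nat -> R) (d : nat -> R) (B : R) :
  0 <= B ->
  (forall n, `|c n| <= B * 2^-1 ^+ n) ->
  (forall N n, `|cN N n| <= B * 2^-1 ^+ n) ->
  (forall n, cN N n @[N --> \oo] --> c n) ->
  (forall N M, (N.+1 < M)%N -> d N = \sum_(n < M) cN N n) ->
  d @ \oo --> limn (series c).
Proof.
move=> B0 cB cNB cNc dE.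
apply/cvgrPdist_le => e e0.
have e3 : 0 < e / 3 by rewrite divr_gt0.
have /cvgr0Pnorm_le/(_ _ e3) [M _ HM] := cvg_half_tail B.
have : \sum_(n < M) cN N n @[N --> \oo] --> \sum_(n < M) c n.
  by apply: cvg_big => [|i _]; [exact: add_continuous|exact: cNc].
move=> /cvgrPdist_le/(_ _ e3); apply: filterS => N HN.
rewrite (dE N (maxn N.+2 M)) ?leq_maxl //.
rewrite -(big_mkord predT (cN N)) (big_cat_nat (n := M)) ?leq_maxr //= big_mkord.
have T0 := le_trans (ler_norm _) (HM M (leqnn M)).
have T1 := le_trans (series_half_dist M B0 cB) T0.
have T4 := le_trans (sum_half_tail B0 (cNB N) (leq_maxr N.+2 M)) T0.
set a := limn _ in T1 *; set b := \sum_(n < M) c n in T1 HN *.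
set s := \sum_(n < M) _ in HN *; set t := \sum_(_ <= _ < _) _ in T4 *.
have -> : a - (s + t) = (a - b) + (b - s) + (- t) by ring.
have -> : e = e / 3 + e / 3 + e / 3 by field.
apply: le_trans (ler_normD _ _) _; rewrite normrN; apply: lerD => //.
by apply: le_trans (ler_normD _ _) _; apply: lerD.
Qed.

(* Hadamard's bound makes the n-th Fredholm coefficient O(2^-n). *)
Lemma hadamard_term_le (R : realType) (M V : R) : 0 <= M -> 0 <= V ->
  exists2 B : R, 0 <= B & forall n (m I : R),
    0 <= m -> m ^+ 2 <= (M ^+ 2 *+ n) ^+ n -> `|I| <= V ^+ n * m ->
    n`!%:R^-1 * `|I| <= B * 2^-1 ^+ n.
Proof.
move=> M0 V0.
(* The square of the term is at most C^n n^n / n!^2. By n^n / n! <= e^n this is at most a^n / n!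
   times 4^-n, and a^n / n! <= e^a. *)
pose C := (V * M) ^+ 2; pose a := 4 * C * expR 1.
have C0 : 0 <= C by rewrite sqr_ge0.
have a0 : 0 <= a by rewrite mulr_ge0 ?expR_ge0 // mulr_ge0.
have pow_fact (x : R) n : 0 <= x -> x ^+ n / n`!%:R <= expR x.
  case: n => [|n] x0; last first.
    by apply: le_trans (expR_ge1Dxn n x0); rewrite lerDr.
  by rewrite expr0 divr1; apply: le_trans (expR_ge1Dx x); rewrite lerDl.
exists (Num.sqrt (expR a)) => [|n m I m0 mM Im]; first exact: sqrtr_ge0.
have f0 : 0 < n`!%:R :> R by rewrite ltr0n fact_gt0.
have h0 : 0 <= 2^-1 :> R by rewrite invr_ge0.
rewrite -(@ler_pXn2r _ 2) // ?nnegrE; first last.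
- by rewrite mulr_ge0 ?sqrtr_ge0 ?exprn_ge0.
- by rewrite mulr_ge0 // invr_ge0 ltW.
rewrite [leRHS]exprMn sqr_sqrtr ?expR_ge0 //.
apply: (@le_trans _ _ (a ^+ n / n`!%:R * (2^-1 ^+ n) ^+ 2)); last first.
  by apply: ler_wpM2r; [rewrite sqr_ge0|exact: pow_fact].
have I2 : `|I| ^+ 2 <= C ^+ n * n%:R ^+ n.
  apply: (@le_trans _ _ ((V ^+ n * m) ^+ 2)).
    by rewrite ler_pXn2r // nnegrE // mulr_ge0 // exprn_ge0.
  rewrite exprMn; apply: le_trans (ler_wpM2l (sqr_ge0 _) mM) _.
  rewrite -mulr_natr (exprMn n) mulrA -exprM mulnC exprM -(exprMn n).
  by rewrite -(exprMn 2).
have nn : n%:R ^+ n / n`!%:R <= (expR 1 : R) ^+ n.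
  by rewrite -expRM_natr mul1r; exact: pow_fact.
have -> : a ^+ n / n`!%:R * (2^-1 ^+ n) ^+ 2 = n`!%:R^-1 * (C ^+ n * expR 1 ^+ n).
  rewrite /a !exprMn -!exprM mulnC !exprM.
  have -> : (2^-1 ^+ 2 : R) = 4^-1 by field.
  by rewrite exprVn; field; rewrite gt_eqF //= gt_eqF // exprn_gt0.
rewrite exprMn expr2 -mulrA; apply: ler_wpM2l; first by rewrite invr_ge0 ltW.
apply: (@le_trans _ _ (C ^+ n * (n%:R ^+ n / n`!%:R))).
  by rewrite mulrC [leRHS]mulrA; apply: ler_wpM2r => //; rewrite invr_ge0 ltW.
by apply: ler_wpM2l => //; rewrite exprn_ge0.
Qed.

Section Fredholm.
Context (R : realType) (al be : R) (hab : al <= be).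
Local Notation lip2 := (lip2 al be).
Local Notation disc := (disc al be).
Local Notation xn := (@xn R al be _).

Definition fredholm_coef (T : (R -> R) -> R) (K : R -> R -> R) n : R :=
  (-1) ^+ n / n`!%:R * iterT T n (minor 0 K n).

Definition detn (w : forall N, 'I_N.+1 -> R) (K : R -> R -> R) N : R :=
  \det (1%:M - \matrix_(i, j) (w N i * K (xn i) (xn j))).

(** [T] and its Riemann sums share the norm bound [V], so one Hadamard majorant serves for all of
    them. *)
Lemma fredholm_cvg T V w K : disc T V w -> lip2 K ->
  detn w K @ \oo --> limn (series (fredholm_coef T K)).
Proof.
move=> dT lK; have [M [M0 Mb _]] := lK.
have V0 := disc_ge0 dT; have bT := disc_bfun hab dT.
have [B B0 HB] := hadamard_term_le M0 V0.
pose m n := Num.sqrt ((M ^+ 2 *+ n) ^+ n).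
have m2 n : m n ^+ 2 <= (M ^+ 2 *+ n) ^+ n.
  by rewrite sqr_sqrtr // exprn_ge0 // mulrn_wge0 // sqr_ge0.
have minor_le n s : ldom (boxn al be n) s -> `|minor 0 K n s| <= m n.
  move=> bs; rewrite -sqrtr_sqr; apply: ler_wsqrtr; apply: hadamard => i j.
  rewrite mxE; apply: (Mb (s`_i, s`_j)); split; exact: inbox_nth bs.
have coef_le T' n : bfun al be T' V -> `|fredholm_coef T' K n| <= B * 2^-1 ^+ n.
  move=> bT'; rewrite /fredholm_coef normrM normrM normr_sign mul1r normfV.
  rewrite (@ger0_norm _ (_`!)%:R) ?ler0n //; apply: (HB n (m n)) => //.
    exact: sqrtr_ge0.
  have [_ ile] := bfun_iterTB_le bT' n.
  by apply: ile; [exact: lipn_minor|exact: minor_le].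
apply: (tannery B0 (cN := fun N => fredholm_coef (Tn al be w N) K)).
- by move=> n; exact: coef_le.
- by move=> N n; apply: coef_le; exact: (bfun_Tn hab dT).
- by move=> n; apply: cvgMr; apply: (disc_iterT hab dT); exact: lipn_minor.
move=> N [//|M'] NM'; rewrite /detn.
have -> : - (\matrix_(i < N.+1, j < N.+1) (w N i * K (xn i) (xn j)))
   = \matrix_(i < N.+1, j < N.+1) (w N i * (fun x y => - K x y) (xn i) (xn j)).
  by apply/matrixP => i j; rewrite !mxE mulrN.
have E := det_expansion 0 (fun x y => - K x y) (fun i : 'I_N.+1 => xn i) (w N) NM'.
apply: etrans E _; apply: eq_bigr => n _.
have -> : minor 0 (fun x y => - K x y) n = fun s => (-1) ^+ n * minor 0 K n s.
  by apply/funext => s; rewrite minorN.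
by rewrite iterTZ mulrCA mulrA.
Qed.

End Fredholm.

(** * Resolvents and perturbations *)

(* S is the resolvent kernel K (I - KT)^-1 of the operator f |-> T (K x f). *)
Record resolv (R : realType) (al be : R) (T : (R -> R) -> R) (K S : R -> R -> R) : Prop := {
  resolvK : lip2 al be K;
  resolvS : lip2 al be S;
  resolvl : forall x y, inbox al be x -> inbox al be y ->
    S x y = K x y + T (fun z => K x z * S z y);
  resolvr : forall x y, inbox al be x -> inbox al be y ->
    S x y = K x y + T (fun z => S x z * K z y) }.

Section Multiplicativity.
Context (R : realType) (al be : R) (hab : al <= be).
Local Notation inbox := (inbox al be).
Local Notation lip1 := (lip1 al be).
Local Notation disc := (disc al be).
Local Notation xn := (@xn R al be _).
Local Notation det_series T K := (limn (series (fredholm_coef T K))).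

(* (I - K T') (I + S T) = I - S (T' - T), so that the product of the
   determinants is 1 - (T' - T)(S(x, x)) up to second order. *)
Lemma fredholm_mul T V w T' V' w' K S (h M : R) :
  disc T V w -> disc T' V' w' -> resolv al be T K S ->
  (forall N, \sum_i `|w' N i - w N i| <= h) ->
  (forall x y, inbox x -> inbox y -> `|S x y| <= M) -> M * h < 2^-1 ->
  `|det_series T' K * det_series T (fun x y => - S x y)
     - 1 + (T' (fun x => S x x) - T (fun x => S x x))| <= 2 * (M * h) ^+ 2.
Proof.
move=> dT dT' [lK lS Sl _] wh SM Mh.
have [C [C0 _ Cl]] := lK; have [D [D0 _ Dl]] := lS.
have [CK [CK0 CKb _]] := lK; have [CS [CS0 CSb _]] := lS.
have V0 := disc_ge0 dT; have V0' := disc_ge0 dT'.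
have M0 : 0 <= M by apply: le_trans (SM _ _ (inbox_xn hab (@ord0 0)) (inbox_xn hab (@ord0 0))).
(* V times a Lipschitz constant of z |-> K(x, z) S(z, y): L times the mesh bounds the quadrature
   error in S = K + K T S. *)
pose L := V * (C * CS + CK * D).
have L0 : 0 <= L by rewrite mulr_ge0 // addr_ge0 // mulr_ge0.
pose t N := M * h + L * V' * eta al be N.
pose sd (x : R) := S x x.
have lsd : lip1 sd by apply: lip2_diag.
pose X N := detn al be w' K N * detn al be w (fun x y => - S x y) N
   - 1 + (Tn al be w' N sd - Tn al be w N sd).
have cX : X @ \oo --> det_series T' K * det_series T (fun x y => - S x y)
     - 1 + (T' sd - T sd).
  apply: cvgD; first (apply: cvgB; last exact: cvg_cst).
    apply: cvgM; first exact: fredholm_cvg dT' lK.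
    by apply: (fredholm_cvg hab dT); apply: lipMN.
  by apply: cvgB; [exact: (disc_cvg dT')|exact: (disc_cvg dT)].
have ct : t N @[N --> \oo] --> M * h.
  rewrite -[X in _ --> X]addr0 -(mulr0 (L * V')); apply: cvgD; first exact: cvg_cst.
  by apply: cvgMr; exact: cvg_eta.
have cb : 2 * t N ^+ 2 + L * V' * eta al be N @[N --> \oo] --> 2 * (M * h) ^+ 2.
  rewrite -[X in _ --> X]addr0 -(mulr0 (L * V')); apply: cvgD.
    by apply: cvgMr; rewrite expr2; under eq_fun do rewrite expr2; apply: cvgM.
  by apply: cvgMr; exact: cvg_eta.
apply: (ler_cvg_to (cvg_norm cX) cb).
(* The strict inequality M h < 1/2 leaves room for the quadrature error contained in [t N]. *)
have : \forall N \near \oo, t N <= 2^-1.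
  move/cvgr_lt : ct => /(_ _ Mh); apply: filterS => N; exact: ltW.
apply: filterS => N tN.
pose e (i j : 'I_N.+1) := S (xn i) (xn j) - K (xn i) (xn j)
   - Tn al be w N (fun z => K (xn i) z * S z (xn j)).
have e_le (i j : 'I_N.+1) : `|e i j| <= L * eta al be N.
  have bi := inbox_xn hab i; have bj := inbox_xn hab j.
  rewrite /e Sl // (addrC (K _ _)) addrK; apply: (disc_err dT).
    by rewrite addr_ge0 // mulr_ge0.
  move=> z z' bz bz'.
  have -> : K (xn i) z * S z (xn j) - K (xn i) z' * S z' (xn j) =
    (K (xn i) z - K (xn i) z') * S z (xn j) + K (xn i) z' * (S z (xn j) - S z' (xn j)).
    by ring.
  apply: le_trans (ler_normD _ _) _; rewrite !normrM mulrDl; apply: lerD.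
    rewrite mulrAC; apply: ler_pM => //; last exact: (CSb (z, xn j)).
    apply: le_trans (Cl (xn i, z) (xn i, z') _ _) _ => //=.
    by rewrite subrr normr0 add0r.
  rewrite -mulrA; apply: ler_pM => //; first exact: (CKb (xn i, z')).
  apply: le_trans (Dl (z, xn j) (z', xn j) _ _) _ => //=.
  by rewrite subrr normr0 addr0.
(* The discrete product (I - W' K)(I + W S) is I + E, because K + K W S equals S - e at the
   nodes. *)
pose E : 'M[R]_N.+1 := \matrix_(i, j)
   (- (w' N i - w N i) * S (xn i) (xn j) + w' N i * e i j).
have detE : detn al be w' K N * detn al be w (fun x y => - S x y) N = \det (1%:M + E).
  rewrite /detn -det_mulmx; congr (\det _); apply/matrixP => i j.
  rewrite mulmxBl mul1mx !mxE.
  have -> : \sum_k (\matrix_(i, j) (w' N i * K (xn i) (xn j))) i k *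
     (1%:M - \matrix_(i, j) (w N i * - S (xn i) (xn j))) k j =
     w' N i * (K (xn i) (xn j) + Tn al be w N (fun z => K (xn i) z * S z (xn j))).
    have e1 : \sum_(k < N.+1) w' N i * K (xn i) (xn k) * (k == j)%:R =
        w' N i * K (xn i) (xn j).
      rewrite (bigD1 j) //= eqxx mulr1 big1 ?addr0 // => k /negPf ->.
      by rewrite mulr0.
    rewrite TnE mulrDr mulr_sumr -e1 -big_split; apply: eq_bigr => k _.
    by rewrite !mxE /=; ring.
  by rewrite /e; ring.
pose v (i : 'I_N.+1) := M * `|w' N i - w N i| + L * eta al be N * `|w' N i|.
have Ev i j : `|E i j| <= v i.
  rewrite mxE; apply: le_trans (ler_normD _ _) _; rewrite !normrM normrN.
  rewrite mulrC (mulrC `|w' N i|); apply: lerD; apply: ler_wpM2r => //.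
  by apply: SM; apply: inbox_xn.
have vt : \sum_i v i <= t N.
  rewrite big_split /= -!mulr_sumr; apply: lerD; first by apply: ler_wpM2l => //; exact: wh.
  rewrite mulrAC; apply: ler_wpM2r; first exact: (eta_ge0 hab).
  apply: ler_wpM2l => //; exact: disc_weight dT' N.
have small := det_small_perturbation Ev vt tN.
rewrite /X detE.
have -> : \det (1%:M + E) - 1 + (Tn al be w' N sd - Tn al be w N sd)
  = (\det (1%:M + E) - 1 - \tr E) + \sum_i w' N i * e i i.
  rewrite -[RHS]addrA; congr (_ + _); rewrite /mxtrace !TnE -!sumrB -sumrN -big_split.
  by apply: eq_bigr => i _; rewrite mxE /sd /=; ring.
apply: le_trans (ler_normD _ _) _; apply: lerD => //.
apply: le_trans (ler_norm_sum _ _ _) _.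
apply: (@le_trans _ _ (\sum_i `|w' N i| * (L * eta al be N))).
  by apply: ler_sum => i _; rewrite normrM; apply: ler_wpM2l.
rewrite -mulr_suml mulrC mulrAC; apply: ler_wpM2r; first exact: (eta_ge0 hab).
apply: ler_wpM2l => //; exact: disc_weight dT' N.
Qed.

Lemma fredholm_inv T V w K S : disc T V w -> resolv al be T K S ->
  det_series T K * det_series T (fun x y => - S x y) = 1.
Proof.
move=> dT rS; have [M [M0 Mb _]] := resolvS rS.
have := @fredholm_mul T V w T V w K S 0 M dT dT rS.
rewrite mulr0 invr_gt0 expr0n mulr0 subrr addr0 => H.
apply/eqP; rewrite -subr_eq0 -normr_le0; apply: H => // [N|x y bx b_y].
  by rewrite big1 // => i _; rewrite subrr normr0.
exact: (Mb (x, y)).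
Qed.

End Multiplicativity.

(** * Lipschitz solutions and the perturbed equation *)

Section Solutions.
Context (R : realType) (al be : R) (hab : al <= be).
Local Notation inbox := (inbox al be).
Local Notation lip1 := (lip1 al be).
Local Notation lip2 := (lip2 al be).
Local Notation disc := (disc al be).
Local Notation bfun := (bfun al be).

(** The equation is imposed at every point of the box: for [T] the integral over J, the values
    outside J are thereby determined by those on J. *)
Definition solf (T : (R -> R) -> R) (K : R -> R -> R) (f g : R -> R) :=
  forall x, inbox x -> g x = f x + T (fun z => K x z * g z).

(* (I - K T)^-1 f when S is the resolvent kernel of K. *)
Definition resf (T : (R -> R) -> R) (S : R -> R -> R) (f : R -> R) : R -> R :=
  fun x => f x + T (fun z => S x z * f z).

Context T V w (dT : disc T V w) K S (rS : resolv al be T K S).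

Let bT : bfun T V. Proof. exact: disc_bfun dT. Qed.
Let lK : lip2 K. Proof. exact: resolvK rS. Qed.
Let lS : lip2 S. Proof. exact: resolvS rS. Qed.

Lemma lip1_kernel U VU k f : bfun U VU -> lip2 k -> lip1 f ->
  lip1 (fun x => U (fun z => k x z * f z)).
Proof.
move=> bU lk lf; apply: (lip1_bfun bU (k := fun x z => k x z * f z)).
by apply: lipMM => //; exact: (lip2_snd lf).
Qed.

Lemma lip1_resf U VU k f : bfun U VU -> lip2 k -> lip1 f -> lip1 (resf U k f).
Proof. by move=> bU lk lf; apply: lipMD => //; exact: lip1_kernel bU lk lf. Qed.

Lemma resolv_fubini U VU k l f x : bfun U VU -> lip2 k -> lip2 l -> lip1 f -> inbox x ->
  T (fun z => k x z * U (fun t => l z t * f t)) =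
  U (fun t => T (fun z => k x z * l z t) * f t).
Proof.
move=> bU lk ll lf bx.
have lF : lip2 (fun z t => k x z * (l z t * f t)).
  apply: lipMM; first exact: (lip2_fst (lip2_row lk bx)).
  by apply: lipMM => //; exact: (lip2_snd lf).
transitivity (T (fun z => U (fun t => k x z * (l z t * f t)))).
  apply: (eq_bfun bT) => [|z bz].
    by apply: lipMM; [exact: lip2_row|exact: lip1_kernel bU ll lf].
  by rewrite (bfunZ bU) //; apply: lipMM => //; exact: lip2_row.
rewrite (disc_fubini hab dT bU lF); apply: (eq_bfun bU) => [|t bt].
  exact: (lip1_bfun bT (lip2_swap lF)).
rewrite mulrC -(bfunZ bT); last by apply: lipMM; [exact: lip2_row|exact: lip2_col].
by congr T; apply/funext => z; ring.
Qed.

Lemma resf_solf f : lip1 f -> solf T K f (resf T S f).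
Proof.
move=> lf x bx; rewrite /resf; congr (_ + _).
transitivity (T (fun z => K x z * f z) + T (fun z => K x z * T (fun t => S z t * f t))).
  rewrite (resolv_fubini bT) // -(bfunD bT); last first.
  - apply: lipMM => //; apply: (lip1_bfun bT (k := fun t z => K x z * S z t)).
    by apply: lipMM; [exact: (lip2_snd (lip2_row lK bx))|exact: lip2_swap].
  - by apply: lipMM => //; exact: lip2_row.
  apply: (eq_bfun bT) => [|t bt]; first by apply: lipMM => //; exact: lip2_row.
  by rewrite (resolvl rS) // mulrDl.
have lST := lip1_kernel bT lS lf; have lKx := lip2_row lK bx.
rewrite -(bfunD bT); try exact: lipMM.
by congr T; apply/funext => z; rewrite mulrDr.
Qed.

(** Uniqueness rests on S = K + S T K, as existence rests on S = K + K T S. *)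
Lemma solf_resf f g : lip1 f -> lip1 g -> solf T K f g ->
  forall x, inbox x -> g x = resf T S f x.
Proof.
move=> lf lg sg x bx; rewrite sg // /resf; congr (_ + _).
have lSx := lip2_row lS bx; have lKx := lip2_row lK bx.
have lKg := lip1_kernel bT lK lg.
transitivity (T (fun z => S x z * g z) - T (fun z => S x z * T (fun t => K z t * g t))).
  rewrite (resolv_fubini bT) // -(bfunB bT); first last.
  - apply: lipMM => //; apply: (lip1_bfun bT (k := fun t z => S x z * K z t)).
    by apply: lipMM; [exact: (lip2_snd lSx)|exact: lip2_swap].
  - exact: lipMM.
  apply: (eq_bfun bT) => [|t bt]; first exact: lipMM.
  by rewrite (resolvr rS) // mulrDl addrK.
rewrite -(bfunB bT); try exact: lipMM.
apply: (eq_bfun bT) => [|z bz]; first by apply: lipMB; exact: lipMM.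
by rewrite -mulrBr sg // addrK.
Qed.

(* The solutions for T' are the fixed points of g = (I + ST) f + S (T' - T) g. *)
Lemma solf_perturb T' U VU f g : bfun U VU ->
  (forall k, lip1 k -> T' k = T k + U k) -> lip1 f -> lip1 g ->
  solf T' K f g <-> (forall x, inbox x -> g x = resf T S f x + U (fun z => S x z * g z)).
Proof.
move=> bU T'E lf lg; have lKg := lip1_kernel bU lK lg.
(* The forward direction needs S = K + S T K, in the form [US]; the converse needs S = K + K T S, in
   the form [US']. *)
have US x : inbox x -> U (fun z => S x z * g z) = U (fun z => K x z * g z) +
    T (fun z => S x z * U (fun t => K z t * g t)).
  move=> bx; have lSx := lip2_row lS bx; have lKx := lip2_row lK bx.
  rewrite (resolv_fubini bU) // -(bfunD bU); first last.
  - apply: lipMM => //; apply: (lip1_bfun bT (k := fun t z => S x z * K z t)).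
    by apply: lipMM; [exact: (lip2_snd lSx)|exact: lip2_swap].
  - exact: lipMM.
  apply: (eq_bfun bU) => [|t bt]; first exact: lipMM.
  by rewrite (resolvr rS) // mulrDl.
have US' x : inbox x -> U (fun z => S x z * g z) = U (fun z => K x z * g z) +
    T (fun z => K x z * U (fun t => S z t * g t)).
  move=> bx; have lSx := lip2_row lS bx; have lKx := lip2_row lK bx.
  rewrite (resolv_fubini bU) // -(bfunD bU); first last.
  - apply: lipMM => //; apply: (lip1_bfun bT (k := fun t z => K x z * S z t)).
    by apply: lipMM; [exact: (lip2_snd lKx)|exact: lip2_swap].
  - exact: lipMM.
  apply: (eq_bfun bU) => [|t bt]; first exact: lipMM.
  by rewrite (resolvl rS) // mulrDl.
split=> [sg x bx|gE x bx].
  have lSx := lip2_row lS bx.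
  have lf1 : lip1 (fun x => f x + U (fun z => K x z * g z)) by exact: lipMD.
  rewrite (solf_resf lf1 lg) // => [|y b_y]; last first.
    rewrite sg // T'E; last by apply: lipMM => //; exact: lip2_row.
    by rewrite addrA addrAC.
  rewrite US // /resf addrACA; congr (_ + _).
  rewrite -(bfunD bT); try exact: lipMM.
  by congr T; apply/funext => z; rewrite mulrDr.
have lKx := lip2_row lK bx; have lQ := lip1_resf bT lS lf.
have lSg := lip1_kernel bU lS lg.
rewrite T'E; last exact: lipMM.
have -> : T (fun z => K x z * g z) =
    T (fun z => K x z * resf T S f z) + T (fun z => K x z * U (fun t => S z t * g t)).
  rewrite -(bfunD bT); try exact: lipMM.
  by apply: (eq_bfun bT) => [|z bz]; [exact: lipMM|rewrite gE // mulrDr].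
rewrite gE // (resf_solf lf) // US' //; ring.
Qed.

End Solutions.

(** * Picard iteration for a small change of the functional *)

Section Picard.
Context (R : realType) (al be : R) (hab : al <= be).
Local Notation inbox := (inbox al be).
Local Notation lip1 := (lip1 al be).
Local Notation lip2 := (lip2 al be).
Local Notation bfun := (bfun al be).
Context (U : (R -> R) -> R) (h M : R) (S : R -> R -> R).
Hypotheses (bU : bfun U h) (lS : lip2 S).
Hypotheses (SM : forall x y, inbox x -> inbox y -> `|S x y| <= M) (hM : h * M <= 2^-1).

Let al_box : inbox al. Proof. by rewrite /inbox lexx. Qed.
Let M0 : 0 <= M. Proof. exact: le_trans (SM al_box al_box). Qed.
Let h0 : 0 <= h. Proof. exact: bfun_ge0 bU. Qed.

Lemma picard_step g B x : lip1 g -> (forall x, inbox x -> `|g x| <= B) -> inbox x ->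
  `|U (fun z => S x z * g z)| <= h * M * B.
Proof.
move=> lg gB bx; rewrite -mulrA; apply: (bfun_le bU).
  by apply: lipMM => //; exact: lip2_row.
by move=> z bz; rewrite normrM; apply: ler_pM => //; [exact: SM|exact: gB].
Qed.

(** The equation turns a bound E for g into B + E/2, which halves the excess over 2 B; the iteration
    starts from the bound contained in [lip1 g]. *)
Lemma picard_bound Q g B : lip1 g -> (forall x, inbox x -> `|Q x| <= B) ->
  (forall x, inbox x -> g x = Q x + U (fun z => S x z * g z)) ->
  forall x, inbox x -> `|g x| <= 2 * B.
Proof.
move=> lg QB gE.
have [C [C0 Cb _]] := lg.
have B0 : 0 <= B by apply: le_trans (QB _ al_box).
have iter n : forall x, inbox x -> `|g x| <= 2 * B + 2 * C * 2^-1 ^+ n.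
  elim: n => [|n IHn] x bx.
    rewrite expr0 mulr1 -mulrDr; apply: le_trans (Cb x bx) _; lra.
  rewrite gE //; apply: le_trans (ler_normD _ _) _.
  have := picard_step lg IHn bx.
  have E0 : 0 <= 2 * B + 2 * C * 2^-1 ^+ n.
    by rewrite addr_ge0 ?mulr_ge0 // exprn_ge0 // invr_ge0.
  have := ler_wpM2r E0 hM; have := QB x bx; rewrite exprS.
  set p := 2^-1 ^+ n; lra.
move=> x bx; have c0 := cvg_half_tail C.
have c1 : 2 * B + 2 * C * 2^-1 ^+ n @[n --> \oo] --> 2 * B.
  by rewrite -[X in _ --> X]addr0; apply: cvgD => //; exact: cvg_cst.
by apply: (cvgr_to_ge c1); apply: nearW => n; exact: iter.
Qed.

Lemma picard_unique Q g g' : lip1 g -> lip1 g' ->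
  (forall x, inbox x -> g x = Q x + U (fun z => S x z * g z)) ->
  (forall x, inbox x -> g' x = Q x + U (fun z => S x z * g' z)) ->
  forall x, inbox x -> g x = g' x.
Proof.
move=> lg lg' gE gE' x bx.
have ld : lip1 (fun x => g x - g' x) by exact: lipMB.
have Z0 (y : R) : inbox y -> `|0 : R| <= 0 by rewrite normr0.
have := picard_bound (Q := fun=> 0) ld Z0.
rewrite mulr0 => H; apply/eqP; rewrite -subr_eq0 -normr_le0.
apply: H => // y b_y; rewrite gE // gE' // add0r opprD addrACA subrr add0r.
have lSy := lip2_row lS b_y; rewrite -(bfunB bU); try exact: lipMM.
by congr U; apply/funext => z; rewrite mulrBr.
Qed.

(** Neumann series. The Lipschitz constants of its terms decay geometrically too, because [d n.+1]
    depends on x only through [S]; hence the sum is Lipschitz. *)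
Lemma picard_exists Q : lip1 Q -> exists2 g, lip1 g &
  forall x, inbox x -> g x = Q x + U (fun z => S x z * g z).
Proof.
move=> lQ; have [q [q0 Qb Ql]] := lQ; have [D [D0 _ Dl]] := lS.
pose d := fix d n := if n is n'.+1 then fun x => U (fun z => S x z * d n' z) else Q.
have ld n : lip1 (d n).
  by elim: n => [//|n IHn]; exact: lip1_kernel bU lS IHn.
have db n : forall x, inbox x -> `|d n x| <= q * 2^-1 ^+ n.
  elim: n => [|n IHn] x bx; first by rewrite expr0 mulr1; exact: Qb.
  apply: le_trans (picard_step (ld n) IHn bx) _.
  rewrite exprS [leRHS]mulrCA; apply: ler_wpM2r => //.
  by rewrite mulr_ge0 // exprn_ge0 // invr_ge0.
(* The summand [q] covers [n = 0]; in the other one the factor 2 makes up for the index shift from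
   [d n] to [d n.+1]. *)
have dl n x x' : inbox x -> inbox x' ->
    `|d n x - d n x'| <= (q + 2 * (h * D * q)) * `|x - x'| * 2^-1 ^+ n.
  move=> bx bx'; have hDq : 0 <= h * D * q by rewrite !mulr_ge0.
  have r0 := normr_ge0 (x - x').
  case: n => [|n] /=.
    rewrite expr0 mulr1; apply: le_trans (Ql x x' bx bx') _.
    by apply: ler_wpM2r => //; rewrite lerDl mulr_ge0.
  have ldn := ld n; have Sx := lip2_row lS bx; have Sx' := lip2_row lS bx'.
  apply: (@le_trans _ _ (h * (D * `|x - x'| * (q * 2^-1 ^+ n)))).
    apply: (bfun_dist bU); try exact: lipMM.
    move=> z bz; rewrite -mulrBl normrM; apply: ler_pM => //; last exact: db.
    apply: le_trans (Dl (x, z) (x', z) _ _) _ => //=.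
    by rewrite subrr normr0 addr0.
  have p0 : 0 <= 2^-1 ^+ n :> R by rewrite exprn_ge0 // invr_ge0.
  have -> : (q + 2 * (h * D * q)) * `|x - x'| * 2^-1 ^+ n.+1 =
     h * (D * `|x - x'| * (q * 2^-1 ^+ n)) + 2^-1 * (q * `|x - x'| * 2^-1 ^+ n).
    by rewrite exprS; field.
  by rewrite lerDl !mulr_ge0.
pose g x := limn (series (fun n => d n x)).
have gd n x : inbox x -> `|g x - \sum_(i < n) d i x| <= 2 * q * 2^-1 ^+ n.
  by move=> bx; apply: series_half_dist => // i; exact: db.
have lg : lip1 g.
  exists (2 * (q + 2 * (h * D * q))); split=> [|x bx|x x' bx bx'].
  - by rewrite mulr_ge0 // addr_ge0 // !mulr_ge0.
  - have := gd 0 x bx; rewrite big_ord0 subr0 expr0 mulr1 => /le_trans; apply.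
    by apply: ler_wpM2l => //; rewrite lerDl !mulr_ge0.
  have E n y : series (fun n => d n y) n = \sum_(i < n) d i y by rewrite /series /= big_mkord.
  have cvs y : inbox y -> cvgn (series (fun n => d n y)).
    by move=> b_y; apply: (is_cvg_series_half q0) => n; exact: db.
  have cv : series (fun n => d n x) n - series (fun n => d n x') n @[n --> \oo] --> g x - g x'.
    by apply: cvgB; exact: cvs.
  apply: (cvgr_to_le (cvg_norm cv)); apply: nearW => n.
  rewrite !E -sumrB; apply: le_trans (ler_norm_sum _ _ _) _.
  apply: (@le_trans _ _ (\sum_(i < n) ((q + 2 * (h * D * q)) * `|x - x'|) * 2^-1 ^+ (0 + i))).
    by apply: ler_sum => i _; exact: dl.
  rewrite -mulr_sumr; have hh : 0 <= 2^-1 :> R by rewrite invr_ge0.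
  have A0 : 0 <= (q + 2 * (h * D * q)) * `|x - x'|.
    by rewrite mulr_ge0 // addr_ge0 // !mulr_ge0.
  apply: le_trans (ler_wpM2l A0 (sum_geo_le 0 n hh (lexx _))) _.
  by rewrite expr0 mulr1 le_eqVlt; apply/orP; left; apply/eqP; rewrite /=; ring.
exists g => // x bx.
have Sx := lip2_row lS bx.
apply/eqP; rewrite -subr_eq0 -normr_le0.
have c0 := cvg_half_tail (2 * q).
apply: (cvgr_to_ge c0); apply: nearW => n.
pose s y := \sum_(i < n) d i y.
have ls : lip1 s by apply: lipM_sum => i; exact: ld.
have Us : U (fun z => S x z * s z) = \sum_(i < n) d i.+1 x.
  rewrite -(bfun_sum bU); last by move=> i; apply: lipMM => //; exact: ld.
  by congr U; apply/funext => z; rewrite mulr_sumr.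
have -> : g x - (Q x + U (fun z => S x z * g z)) =
   (g x - \sum_(i < n.+1) d i x) - (U (fun z => S x z * g z) - U (fun z => S x z * s z)).
  by rewrite Us big_ord_recl /=; ring.
apply: le_trans (ler_normB _ _) _.
have h1 := gd n.+1 x bx.
have h2 : `|U (fun z => S x z * g z) - U (fun z => S x z * s z)| <= h * (M * (2 * q * 2^-1 ^+ n)).
  apply: (bfun_dist bU); try exact: lipMM.
  by move=> z bz; rewrite -mulrBr normrM; apply: ler_pM => //; [exact: SM|exact: gd].
have p0 : 0 <= 2 * q * 2^-1 ^+ n by rewrite !mulr_ge0 // exprn_ge0 // invr_ge0.
have := ler_wpM2r p0 hM; rewrite exprS in h1 *.
move: h1 h2; rewrite mulrA; lra.
Qed.

End Picard.

(** * The integral over J as a function of the endpoints *)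

Section Primitive.
Context (R : realType) (al be : R) (hab : al <= be).
Local Notation mu := (@lebesgue_measure R).
Local Notation inbox := (inbox al be).
Local Notation lip1 := (lip1 al be).
Implicit Types (f : R -> R).

Lemma Lip_lip1 f L : 0 <= L ->
  (forall x x', inbox x -> inbox x' -> `|f x - f x'| <= L * `|x - x'|) -> lip1 f.
Proof.
move=> L0 fL; exists (L + (`|f al| + L * (be - al))).
have bal : 0 <= be - al by rewrite subr_ge0.
have C0 : 0 <= `|f al| + L * (be - al) by rewrite addr_ge0 // mulr_ge0.
split=> [|x bx|x x' bx bx']; first exact: addr_ge0.
  apply: (@le_trans _ _ (`|f al| + L * (be - al))); last by rewrite lerDr.
  rewrite -[X in `|X|](subrK (f al)) addrC; apply: le_trans (ler_normD _ _) _.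
  rewrite lerD2l; apply: le_trans (fL x al bx _) _; first by rewrite /inbox lexx.
  apply: ler_wpM2l => //; move: bx => /andP[h1 h2].
  by rewrite ger0_norm ?subr_ge0 // lerD2r.
by apply: le_trans (fL _ _ bx bx') _; apply: ler_wpM2r => //; rewrite lerDl.
Qed.

Lemma lip1_continuous f : lip1 f -> {within `[al, be], continuous f}.
Proof.
move=> [C [C0 _ Cl]]; apply/subspace_continuousP => x /= xab.
apply/cvgrPdist_le => e e0.
have C1 : 0 < C + 1 by rewrite ltr_wpDl.
have : \forall y \near x, `|x - y| <= e / (C + 1).
  apply/nbhs_ballP; exists (e / (C + 1)) => /=; first by rewrite divr_gt0.
  by move=> y; exact: ltW.
rewrite near_withinE; apply: filterS => y xy yab.
apply: le_trans (Cl x y _ _) _; rewrite ?/ldom /=; try by move: xab yab; rewrite /= !in_itv.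
apply: le_trans (ler_wpM2l C0 xy) _; rewrite mulrCA; apply: ler_piMr; first exact: ltW.
by rewrite ler_pdivrMr // mul1r lerDl.
Qed.

Lemma lip1_integrable f (D : set R) : lip1 f -> measurable D ->
  (forall x, D x -> inbox x) -> mu.-integrable D (EFin \o f).
Proof.
move=> lf mD Db; have sub : D `<=` `[al, be] by move=> x /Db bx; rewrite /= in_itv.
apply: (@integrableS _ _ _ mu _ _ (EFin \o f) (measurable_itv `[al, be]) mD sub).
by apply: continuous_compact_integrable; [exact: segment_compact|exact: lip1_continuous].
Qed.

Definition prim f c : R := \int[mu]_(x in `[al, c]) f x.

Lemma prim_incr f c d : lip1 f -> al <= c -> c <= d -> d <= be ->
  prim f d - prim f c = \int[mu]_(x in `]c, d]) f x.
Proof.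
move=> lf ac cd db; rewrite /prim Rintegral_itvB //.
  apply: lip1_integrable => // x /=; rewrite in_itv /= => /andP[h1 h2].
  by rewrite /inbox h1 (le_trans h2).
Qed.

Lemma fine_lebesgue_oc (c d : R) : c <= d -> fine (mu `]c, d]%classic) = d - c.
Proof.
move=> cd; rewrite lebesgue_measure_itv /= lte_fin.
case: ltP => // dc; have -> : c = d by apply/eqP; rewrite eq_le cd.
by rewrite subrr.
Qed.

Lemma prim_est f c d k B : lip1 f -> al <= c -> c <= d -> d <= be ->
  (forall x, c <= x -> x <= d -> `|f x - k| <= B) ->
  `|prim f d - prim f c - k * (d - c)| <= B * (d - c).
Proof.
move=> lf ac cd db fB; rewrite prim_incr //.
have int_f : mu.-integrable `]c, d] (EFin \o f).
  apply: lip1_integrable => // x /=; rewrite in_itv /= => /andP[h1 h2].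
  by rewrite /inbox (le_trans h2) // (le_trans ac) // ltW.
have int_c r : mu.-integrable `]c, d] (EFin \o (fun=> r : R)).
  apply: lip1_integrable => [||x /=]; [exact: lipM_cst|by []|].
  by rewrite in_itv /= => /andP[h1 h2]; rewrite /inbox (le_trans h2) // (le_trans ac) // ltW.
have up : \int[mu]_(x in `]c, d]) f x <= \int[mu]_(x in `]c, d]) (k + B).
  apply: le_Rintegral => // x /=; rewrite in_itv /= => /andP[h1 h2].
  by have := fB x (ltW h1) h2; rewrite ler_norml; lra.
have dn : \int[mu]_(x in `]c, d]) (k - B) <= \int[mu]_(x in `]c, d]) f x.
  apply: le_Rintegral => // x /=; rewrite in_itv /= => /andP[h1 h2].
  by have := fB x (ltW h1) h2; rewrite ler_norml; lra.
move: up dn; rewrite !Rintegral_cst // !fine_lebesgue_oc // ler_norml.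
set I := \int[mu]_(x in _) _ => up dn; apply/andP; split; lra.
Qed.

Definition cut (c x : R) : R := Num.min c x.
Definition ndp N i : R := al + i%:R * eta al be N.
(* The length of the part of the i-th cell lying to the left of c. *)
Definition wprim (c : R) N (i : 'I_N.+1) : R := cut c (ndp N i.+1) - cut c (ndp N i).

Lemma ndp_le N i : ndp N i <= ndp N i.+1.
Proof. by rewrite lerD2l -natr1 mulrDl mul1r lerDl; exact: (eta_ge0 hab). Qed.

Lemma ndp_last N : ndp N N.+1 = be.
Proof. by rewrite /ndp /eta mulrC divfK ?pnatr_eq0 // addrC subrK. Qed.

Lemma ndp0 N : ndp N 0 = al.
Proof. by rewrite /ndp mul0r addr0. Qed.

Lemma wprim_ge0 c N i : 0 <= wprim c (N:=N) i.
Proof.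
rewrite subr_ge0 /cut; have := ndp_le N i.
by rewrite !minEle; case: ifP; case: ifP => //; lra.
Qed.

Lemma sum_wprim c N : inbox c -> \sum_(i < N.+1) wprim c i = c - al.
Proof.
move=> /andP[ac cb]; rewrite -(big_mkord predT (fun i => cut c (ndp N i.+1) - cut c (ndp N i))).
rewrite telescope_sumr // ndp_last ndp0 /cut.
by rewrite (min_idPl cb) (min_idPr ac).
Qed.

Lemma inbox_cut c x : inbox c -> inbox x -> inbox (cut c x).
Proof. by move=> bc bx; rewrite /cut minEle; case: ifP. Qed.

Lemma inbox_ndp N i : (i <= N.+1)%N -> inbox (ndp N i).
Proof.
move=> iN; rewrite /inbox /ndp lerDl mulr_ge0 ?(eta_ge0 hab) //=.
rewrite -lerBrDl /eta mulrCA ler_piMr ?subr_ge0 // ler_pdivrMr ?ltr0n //.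
by rewrite mul1r ler_nat.
Qed.

Lemma prim_al f : prim f al = 0.
Proof. by rewrite /prim set_itv1 Rintegral_set1. Qed.

(** The nodes do not depend on [c]: a cell cut by [c] keeps its left node and only loses weight.
    This is what lets discretisations for different endpoints be multiplied as matrices. *)
Lemma disc_prim c : inbox c -> disc al be (prim ^~ c) (be - al) (@wprim c).
Proof.
move=> bc; have /andP[ac cb] := bc; split=> [N|N f L L0 fL].
  under eq_bigr do rewrite ger0_norm ?wprim_ge0 //.
  by rewrite sum_wprim // lerD2r.
have lf := Lip_lip1 L0 fL.
have -> : prim f c = \sum_(i < N.+1)
    (prim f (cut c (ndp N i.+1)) - prim f (cut c (ndp N i))).
  rewrite -(big_mkord predT (fun i => prim f (cut c (ndp N i.+1)) - prim f (cut c (ndp N i)))).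
  rewrite telescope_sumr // ndp_last ndp0 /cut (min_idPl cb) (min_idPr ac).
  by rewrite prim_al subr0.
rewrite TnE -sumrB; apply: le_trans (ler_norm_sum _ _ _) _.
apply: (@le_trans _ _ (\sum_(i < N.+1) L * eta al be N * wprim c i)); last first.
  rewrite -mulr_sumr sum_wprim // mulrC mulrA; apply: ler_wpM2r; first exact: (eta_ge0 hab).
  by apply: ler_wpM2r => //; rewrite lerD2r.
apply: ler_sum => i _; rewrite (mulrC (wprim c i)) -[xn _ _ _]/(ndp N i).
set y := cut c (ndp N i); set y' := cut c (ndp N i.+1).
have iN : (i <= N.+1)%N by rewrite ltnW.
have /andP[y1 y2] : inbox y by apply: inbox_cut => //; exact: inbox_ndp.
have /andP[y1' y2'] : inbox y' by apply: inbox_cut => //; exact: inbox_ndp.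
have yy' : y <= y' by rewrite -subr_ge0; exact: wprim_ge0.
(* A cell to the right of [c] has weight 0; in any other cell the left node is not affected by the
   cut and serves as sample point. *)
rewrite /wprim -/y -/y'; have [cle|clt] := leP c (ndp N i).
  have -> : y' = y.
    rewrite /y /y' /cut (min_idPl cle) (min_idPl _) //.
    exact: le_trans (ndp_le N i).
  by rewrite !subrr !mulr0 subr0 normr0.
have ey : y = ndp N i by rewrite /y /cut (min_idPr (ltW clt)).
apply: prim_est => // x yx xy'.
have bx : inbox x by rewrite /inbox (le_trans y1 yx) (le_trans xy').
apply: le_trans (fL _ _ bx (inbox_ndp iN)) _.
apply: ler_wpM2l => //; rewrite ger0_norm; last by rewrite subr_ge0 -ey.
have : x <= ndp N i.+1 by apply: le_trans xy' _; rewrite /y' /cut ge_min lexx orbT.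
by rewrite /ndp -natr1 mulrDl mul1r; lra.
Qed.

Lemma prim_lip f c d B : lip1 f -> inbox c -> inbox d ->
  (forall x, inbox x -> `|f x| <= B) -> `|prim f d - prim f c| <= `|d - c| * B.
Proof.
move=> lf; wlog cd : c d / c <= d => [hw bc bd fB|].
  have [cd|dc] := leP c d; first exact: hw.
  by rewrite distrC (distrC d); apply: hw => //; exact: ltW.
move=> /andP[ac cb] /andP[ad db] fB.
have := @prim_est f c d 0 B lf ac cd db; rewrite mul0r subr0 => H.
rewrite [`|d - c|]ger0_norm ?subr_ge0 // mulrC; apply: H => x cx xd.
by rewrite subr0; apply: fB; rewrite /inbox (le_trans ac) // (le_trans xd).
Qed.

(** The fundamental theorem of calculus with an explicit second-order error, for [d] on either side
    of [c]. *)
Lemma prim_quad f c d L : lip1 f -> inbox c -> inbox d -> 0 <= L ->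
  (forall x x', inbox x -> inbox x' -> `|f x - f x'| <= L * `|x - x'|) ->
  `|prim f d - prim f c - (d - c) * f c| <= L * (d - c) ^+ 2.
Proof.
move=> lf bc bd L0 fL; have /andP[ac cb] := bc; have /andP[ad db] := bd.
have est c' d' : inbox c' -> inbox d' -> c' <= d' -> forall y, inbox y -> c' <= y -> y <= d' ->
   `|prim f d' - prim f c' - f y * (d' - c')| <= L * (d' - c') * (d' - c').
  move=> /andP[h1 h2] /andP[h3 h4] cd' y b_y h5 h6; apply: prim_est => // x cx xd.
  have bx : inbox x by rewrite /inbox (le_trans h1) // (le_trans xd).
  apply: le_trans (fL _ _ bx b_y) _; apply: ler_wpM2l => //.
  by rewrite ler_norml; apply/andP; split; lra.
rewrite expr2 mulrA (mulrC _ (f c)); have [cd|dc] := leP c d; first exact: est.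
have := est d c bd bc (ltW dc) c bc (ltW dc) (lexx _).
rewrite -normrN; have -> : - (prim f c - prim f d - f c * (c - d)) =
  prim f d - prim f c - f c * (d - c) by ring.
by have -> : L * (c - d) * (c - d) = L * (d - c) * (d - c) by ring.
Qed.

End Primitive.

(** Extending [F] by 0 to all natural numbers frees the index type from [m], so that induction can
    peel off two terms at a time. *)
Lemma sum_double (V : nmodType) m (F : 'I_(m.*2) -> V) :
  \sum_k F k = \sum_(i < m) (F (Ordinal (left_subproof i)) + F (Ordinal (right_subproof i))).
Proof.
pose G n := if insub n is Some k then F k else 0.
have GF (k : 'I_(m.*2)) : F k = G k by rewrite /G valK.
under eq_bigr do rewrite GF.
under [RHS]eq_bigr do rewrite !GF.
rewrite /=; elim: (m) => [|n IHn]; first by rewrite !big_ord0.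
by rewrite doubleS !big_ord_recr /= IHn addrA.
Qed.

Section Intervals.
Context (R : realType) (al be : R) (hab : al <= be) (m : nat).
Local Notation mu := (@lebesgue_measure R).
Local Notation inbox := (inbox al be).
Local Notation lip1 := (lip1 al be).
Local Notation prim := (prim al).
Implicit Types (a : 'rV[R]_(m.*2)).

(** As indices start at 0, this is (-1)^j at the j-th endpoint: -1 at left endpoints, +1 at right
    ones. *)
Definition sgn n (k : 'I_n) : R := (-1) ^+ k.+1.

Definition Tint a (f : R -> R) : R := \int[mu]_(x in intervals a) f x.

Definition sorted_in a :=
  (forall i j : 'I_(m.*2), (i < j)%N -> a 0 i < a 0 j) /\ forall k, inbox (a 0 k).

Definition itvJ a (i : 'I_m) : set R :=
  `]a 0 (Ordinal (left_subproof i)), a 0 (Ordinal (right_subproof i))[%classic.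

Lemma intervalsE a : intervals a = \big[setU/set0]_(i <- enum 'I_m) itvJ a i.
Proof.
rewrite -bigcup_seq; congr bigcup; apply/seteqP; split=> i //= _.
by rewrite mem_enum.
Qed.

Lemma measurable_intervals a : measurable (intervals a).
Proof. by rewrite intervalsE; apply: bigsetU_measurable => i _; exact: measurable_itv. Qed.

Lemma intervals_inbox a x : sorted_in a -> intervals a x -> inbox x.
Proof.
move=> [_ ba] [i _] /=; rewrite in_itv /= => /andP[h1 h2].
have /andP[h3 _] := ba (Ordinal (left_subproof i)).
have /andP[_ h4] := ba (Ordinal (right_subproof i)).
by rewrite /inbox (le_trans h3) ?(le_trans (ltW h2)) // ltW.
Qed.

Lemma open_intervals a : open (intervals a).
Proof. by apply: bigcup_open => i _; exact: interval_open. Qed.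

Lemma Rintegral_bigsetU (I : eqType) (F : I -> set R) (f : R -> R) (s : seq I) :
  (forall i, measurable (F i)) -> uniq s -> trivIset [set` s] F ->
  (forall i, mu.-integrable (F i) (EFin \o f)) ->
  mu.-integrable (\big[setU/set0]_(i <- s) F i) (EFin \o f) ->
  \int[mu]_(x in \big[setU/set0]_(i <- s) F i) f x = \sum_(i <- s) \int[mu]_(x in F i) f x.
Proof.
move=> mF us tF iF iU; rewrite /Rintegral integral_bigsetU_EFin //; last first.
  exact: (measurable_int mu iU).
have E i : (\int[mu]_(x in F i) (EFin \o f) x)%E = (fine (\int[mu]_(x in F i) (f x)%:E))%:E.
  apply/esym/fineK; have Z := integrable_fin_num _ (iF i).
  by apply: Z; exact: mF.
by rewrite (eq_bigr _ (fun i _ => E i)) sumEFin.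
Qed.

Lemma trivIset_itvJ a : sorted_in a -> trivIset [set` enum 'I_m] (itvJ a).
Proof.
move=> [sa _]; have lt_absurd (i j : 'I_m) x : (i < j)%N -> itvJ a i x -> itvJ a j x -> False.
  move=> ij; rewrite /itvJ /= !in_itv /= => /andP[_ h1] /andP[h2 _].
  have : a 0 (Ordinal (right_subproof i)) < a 0 (Ordinal (left_subproof j)).
    by apply: sa; rewrite /=; lia.
  by move=> h3; have := lt_trans (lt_trans h1 h3) h2; rewrite ltxx.
move=> i j _ _ [x [xi xj]]; apply: val_inj => /=.
by case: (ltngtP i j) => // ij; [case: (lt_absurd i j x)|case: (lt_absurd j i x)].
Qed.

(** In this form each endpoint enters through a single term, so moving it leaves the others
    unchanged. *)
Lemma Tint_prim a f : sorted_in a -> lip1 f ->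
  Tint a f = \sum_k sgn k * prim f (a 0 k).
Proof.
move=> ga lf; have [sa ba] := ga.
have itvb i x : itvJ a i x -> inbox x by move=> xi; apply: (intervals_inbox ga); exists i.
have iF i : mu.-integrable (itvJ a i) (EFin \o f).
  by apply: (lip1_integrable lf) => [|x]; [exact: measurable_itv|exact: itvb].
have mJ i : measurable (itvJ a i) by exact: measurable_itv.
have iU : mu.-integrable (\big[setU/set0]_(i <- enum 'I_m) itvJ a i) (EFin \o f).
  rewrite -intervalsE; apply: (lip1_integrable lf); first exact: measurable_intervals.
  by move=> x; exact: intervals_inbox.
rewrite /Tint intervalsE (Rintegral_bigsetU mJ (enum_uniq _) (trivIset_itvJ ga) iF iU).
rewrite sum_double big_enum /=; apply: eq_bigr => i _.
set l := Ordinal (left_subproof i); set r := Ordinal (right_subproof i).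
have /andP[l1 l2] := ba l; have /andP[r1 r2] := ba r.
have lr : a 0 l <= a 0 r by apply/ltW/sa; rewrite /=.
rewrite Rintegral_itv_bndo_bndc; last exact: iF.
rewrite -(prim_incr lf) // /sgn /l /r /= exprS -signr_odd odd_double expr0.
by rewrite exprS -signr_odd /= odd_double expr1 mulr1 mulN1r opprK mul1r addrC mulN1r.
Qed.

(** Left and right endpoints pair up; primitives that differ by a constant hence have the same
    signed sum. *)
Lemma sum_sgn0 : \sum_(k < m.*2) sgn k = 0.
Proof.
rewrite sum_double big1 // => i _; rewrite /sgn /=.
by rewrite [in X in _ + X]exprS mulN1r subrr.
Qed.

Definition wJ a N (i : 'I_N.+1) : R := \sum_k sgn k * wprim al be (a 0 k) i.
Definition Vbox : R := \sum_(k < m.*2) (be - al).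

Lemma normr_sgn n (k : 'I_n) : `|sgn k| = 1.
Proof. by rewrite /sgn normrX normrN1 expr1n. Qed.

Lemma disc_Tint a : sorted_in a -> disc al be (Tint a) Vbox (@wJ a).
Proof.
move=> ga; have [sa ba] := ga; split=> [N|N f L L0 fL].
  apply: (@le_trans _ _ (\sum_(i < N.+1) \sum_k wprim al be (a 0 k) i)).
    apply: ler_sum => i _; apply: le_trans (ler_norm_sum _ _ _) _.
    apply: ler_sum => k _; rewrite normrM normr_sgn mul1r.
    by rewrite ger0_norm // wprim_ge0.
  rewrite exchange_big /=; apply: ler_sum => k _.
  by rewrite sum_wprim // lerD2r; case/andP: (ba k).
have lf := Lip_lip1 hab L0 fL.
rewrite Tint_prim // TnE.
have -> : \sum_(i < N.+1) wJ a i * f (xn al be i) =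
    \sum_k sgn k * Tn al be (@wprim _ al be (a 0 k)) N f.
  under eq_bigr do rewrite /wJ mulr_suml.
  rewrite exchange_big /=; apply: eq_bigr => k _.
  by rewrite TnE mulr_sumr; apply: eq_bigr => i _; rewrite mulrA.
rewrite -sumrB; apply: le_trans (ler_norm_sum _ _ _) _.
rewrite /Vbox !mulr_suml; apply: ler_sum => k _.
rewrite -mulrBr normrM normr_sgn mul1r.
exact: (disc_err (disc_prim hab (ba k))).
Qed.

(** The order of the summands is that of the difference quotient in the definition of the
    derivative. *)
Definition shiftJ a (k : 'I_(m.*2)) (t : R) : 'rV[R]_(m.*2) := t *: delta_mx 0 k + a.

Lemma shiftJE a k t l : shiftJ a k t 0 l = a 0 l + (if l == k then t else 0).
Proof.
by rewrite !mxE eqxx /=; case: ifP; rewrite ?mulr1 ?mulr0 addrC.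
Qed.

(** The clipped lengths increase with the clipping point, so the absolute values drop and the sum is
    the difference of the total lengths. *)
Lemma wprim_sum_dist c d N : inbox c -> inbox d ->
  \sum_(i < N.+1) `|wprim al be d i - wprim al be c i| <= `|d - c|.
Proof.
wlog cd : c d / c <= d => [hw bc bd|bc bd].
  have [cd|dc] := leP c d; first exact: hw.
  rewrite distrC; under eq_bigr do rewrite distrC.
  by apply: hw => //; exact: ltW.
rewrite ger0_norm ?subr_ge0 //.
apply: (@le_trans _ _ (\sum_(i < N.+1) (wprim al be d i - wprim al be c i))).
  apply: ler_sum => i _; rewrite ger0_norm // subr_ge0 /wprim /cut.
  have := ndp_le hab N i; rewrite !minEle; move: (ndp al be N i) (ndp al be N i.+1) => x x' xx'.
  by case: (leP d x'); case: (leP d x); case: (leP c x'); case: (leP c x); lra.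
rewrite sumrB !sum_wprim //; lra.
Qed.

Section Shift.
Context (a : 'rV[R]_(m.*2)) (k : 'I_(m.*2)) (t : R).
Hypotheses (ga : sorted_in a) (ga' : sorted_in (shiftJ a k t)).

Let bk : inbox (a 0 k). Proof. exact: ga.2. Qed.
Let bk' : inbox (a 0 k + t). Proof. by have := ga'.2 k; rewrite shiftJE eqxx. Qed.

Lemma wJ_shift N : \sum_i `|wJ (shiftJ a k t) i - @wJ a N i| <= `|t|.
Proof.
have := wprim_sum_dist N bk bk'; rewrite (addrAC _ t) subrr add0r.
apply: le_trans; apply: ler_sum => i _.
rewrite /wJ -sumrB (bigD1 k) //= big1 ?addr0 => [|l lk].
  by rewrite shiftJE eqxx -mulrBr normrM normr_sgn mul1r.
by rewrite shiftJE (negPf lk) addr0 subrr.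
Qed.

(** This is T' - T for one moved endpoint; its norm |t| is the small parameter of the perturbation
    estimates. *)
Definition Ushift (f : R -> R) : R := sgn k * (prim f (a 0 k + t) - prim f (a 0 k)).

Lemma bfun_Ushift : bfun al be Ushift `|t|.
Proof.
have b1 := disc_bfun hab (disc_prim hab bk).
have b2 := disc_bfun hab (disc_prim hab bk').
split=> [//|f g lf lg|c f lf|f B lf fB].
- by rewrite /Ushift (bfunD b1) // (bfunD b2) //; ring.
- by rewrite /Ushift (bfunZ b1) // (bfunZ b2) //; ring.
- rewrite normrM normr_sgn mul1r; apply: le_trans (prim_lip lf bk bk' fB) _.
  by rewrite (addrAC _ t) subrr add0r.
Qed.

Lemma Tint_shift f : lip1 f -> Tint (shiftJ a k t) f = Tint a f + Ushift f.
Proof.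
move=> lf; rewrite !Tint_prim // (bigD1 k) //= [X in _ = X + _](bigD1 k) //=.
rewrite shiftJE eqxx /Ushift.
have -> : \sum_(i < m.*2 | i != k) sgn i * prim f (shiftJ a k t 0 i) =
  \sum_(i < m.*2 | i != k) sgn i * prim f (a 0 i).
  by apply: eq_bigr => i /negPf ik; rewrite shiftJE ik addr0.
ring.
Qed.

Lemma Ushift_quad f L : lip1 f -> 0 <= L ->
  (forall x x', inbox x -> inbox x' -> `|f x - f x'| <= L * `|x - x'|) ->
  `|Ushift f - sgn k * (t * f (a 0 k))| <= L * t ^+ 2.
Proof.
move=> lf L0 fL; rewrite -mulrBr normrM normr_sgn mul1r.
have := prim_quad lf bk bk' L0 fL.
by rewrite (addrAC _ t) subrr add0r.
Qed.

End Shift.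

End Intervals.

(** * Solutions in L^2(J) *)

Section L2.
Context (R : realType) (al be : R) (hab : al <= be) (J : set R).
Local Notation mu := (@lebesgue_measure R).
Local Notation inbox := (inbox al be).
Local Notation lip1 := (lip1 al be).
Hypotheses (mJ : measurable J) (Jb : forall x, J x -> inbox x).
Implicit Types (f g : R -> R).

Let muJ : (mu J <= (be - al)%:E)%E.
Proof.
have mI : measurable (`[al, be]%classic : set R) by exact: measurable_itv.
have : (mu J <= mu `[al, be]%classic)%E.
  by apply: le_measure; rewrite ?inE // => x /Jb bx; rewrite /= in_itv.
rewrite lebesgue_measure_itv /= lte_fin; case: ltP => [_|ba]; first by [].
move=> /le_trans; apply; by rewrite lee_fin subr_ge0.
Qed.

(** An upper bound for the L^2 norm of the constant 1 on J. *)
Definition kap : R := Num.sqrt (be - al).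

Lemma measurable_extend f : measurable_fun J f -> measurable_fun setT (f \_ J).
Proof. by move=> mf; apply/(measurable_restrict _ mJ measurableT); rewrite setTI. Qed.

Lemma norm2on_le f B : 0 <= B -> measurable_fun J f ->
  (forall x, J x -> `|f x| <= B) -> (norm2on J f <= (B * kap)%:E)%E.
Proof.
move=> B0 mf fB; rewrite /norm2on unlock /Lnorm.
have -> : (B * kap)%:E = (((B ^+ 2 * (be - al))%:E) `^ 2^-1)%E.
  rewrite poweR_EFin powR12_sqrt; last by rewrite mulr_ge0 ?sqr_ge0 ?subr_ge0.
  by rewrite sqrtrM ?sqr_ge0 // sqrtr_sqr ger0_norm.
have le1 : (\int[mu]_x `|(EFin \o f \_ J) x| `^ 2 <= (B ^+ 2 * (be - al))%:E)%E.
  have -> : (\int[mu]_x `|(EFin \o f \_ J) x| `^ 2 = \int[mu]_(x in J) (`|f x| ^+ 2)%:E)%E.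
    rewrite [RHS]integral_mkcond; apply: eq_integral => x _ /=.
    rewrite powR_mulrn // !patchE.
    by case: ifPn => //; rewrite normr0 expr0n.
  apply: (@le_trans _ _ (\int[mu]_(x in J) (B ^+ 2)%:E)%E).
    apply: ge0_le_integral => //.
    + apply/measurable_EFinP; apply: measurable_funX.
      exact: measurableT_comp.
    + by move=> x Jx; rewrite lee_fin lerXn2r ?nnegrE // fB.
  rewrite integral_cst // (EFinM (B ^+ 2)); apply: lee_wpmul2l; last exact: muJ.
  by rewrite lee_fin sqr_ge0.
apply: gt0_ler_poweR => //.
  by rewrite in_itv /= leey integral_ge0 // => x _; exact: poweR_ge0.
by rewrite in_itv /= leey lee_fin mulr_ge0 ?sqr_ge0 // subr_ge0.
Qed.

Lemma L2on_bounded f B : 0 <= B -> measurable_fun J f ->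
  (forall x, J x -> `|f x| <= B) -> L2on J f.
Proof.
move=> B0 mf fB; rewrite /L2on inE; apply/andP; split; rewrite inE /=.
  exact: measurable_extend.
by rewrite /finite_norm; apply: le_lt_trans (norm2on_le B0 mf fB) _; rewrite ltry.
Qed.

Lemma lip1_measurable f : lip1 f -> measurable_fun J f.
Proof.
move=> lf; apply/measurable_EFinP.
exact: (measurable_int mu (lip1_integrable lf mJ Jb)).
Qed.

Lemma L2on_lip f : lip1 f -> L2on J f.
Proof.
move=> lf; have mf := lip1_measurable lf; have [C [C0 Cb _]] := lf.
by apply: (L2on_bounded C0 mf) => x /Jb; exact: Cb.
Qed.

Lemma norm2on_lip f B : lip1 f -> 0 <= B -> (forall x, inbox x -> `|f x| <= B) ->
  (norm2on J f <= (B * kap)%:E)%E.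
Proof.
by move=> lf B0 fB; apply: norm2on_le => // [|x /Jb]; [exact: lip1_measurable|exact: fB].
Qed.

Lemma L2on_mul_integrable f g : L2on J f -> L2on J g ->
  mu.-integrable J (EFin \o (fun x => f x * g x)).
Proof.
move=> lf lg; have /Lfun1_integrable := Lfun2_mul_Lfun1 lf lg.
rewrite [X in integrable _ _ X -> _](_ : _ = (EFin \o (fun x => f x * g x)) \_ J).
  by move=> ?; apply/integrable_mkcond.
apply/funext => x; rewrite /= !patchE.
by case: ifPn => // _; rewrite mulr0.
Qed.

Lemma L2on_integrable g : L2on J g -> mu.-integrable J (EFin \o g).
Proof.
move=> lg; have := L2on_mul_integrable (L2on_lip (lipM_cst _ 1)) lg.
by under eq_fun do rewrite mul1r.
Qed.

Definition norm1on g : R := \int[mu]_(x in J) `|g x|.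

(** For [g] merely in L^2, integration against [g] is still a bounded functional, so K g is
    Lipschitz on the box. *)
Lemma L2on_bfun g : L2on J g ->
  bfun al be (fun f => \int[mu]_(x in J) (f x * g x)) (norm1on g).
Proof.
move=> lg; have ig f : lip1 f -> mu.-integrable J (EFin \o (fun x => f x * g x)).
  by move=> lf; apply: L2on_mul_integrable => //; exact: L2on_lip.
have ing : mu.-integrable J (EFin \o (fun x => `|g x|)).
  by have := integrable_norm (L2on_integrable lg).
split=> [|f1 f2 lf1 lf2|c f lf|f B lf fB].
- by apply: Rintegral_ge0 => x _; exact: normr_ge0.
- rewrite -RintegralD //; try exact: ig.
  by apply: eq_Rintegral => x _; rewrite mulrDl.
- rewrite -RintegralZl //; last exact: ig.
  by apply: eq_Rintegral => x _; rewrite mulrA.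
- apply: le_trans (@le_normr_Rintegral _ _ _ mu J _ mJ (ig _ lf)) _.
  rewrite -RintegralZr //; apply: le_Rintegral => //.
  + by have := integrable_norm (ig _ lf).
  + exact: (@integrableZr _ _ _ mu J mJ B _ ing).
  move=> x Jx; rewrite normrM mulrC; apply: ler_wpM2l => //.
  by apply: fB; exact: Jb.
Qed.

(** The Cauchy-Schwarz inequality against the constant 1. *)
Lemma norm1on_le g n : L2on J g -> (norm2on J g <= n%:E)%E -> norm1on g <= n * kap.
Proof.
move=> lg gn; pose one : R -> R := fun=> 1.
have l1 : L2on J one := L2on_lip (lipM_cst _ 1).
have := lg; rewrite /L2on inE => /andP[]; rewrite inE /= => mg _.
have := l1; rewrite /L2on inE => /andP[]; rewrite inE /= => m1 _.
have H : ('N[mu]_1[EFin \o (g \_ J \* one \_ J)%R] <=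
  'N[mu]_2%:E[EFin \o g \_ J] * 'N[mu]_2%:E[EFin \o one \_ J])%E.
  by apply: hoelder => //; rewrite [RHS]splitr !div1r.
have N1 : (norm2on J one <= kap%:E)%E.
  rewrite -[kap]mul1r; apply: norm2on_lip => //; first exact: lipM_cst.
  by move=> x _; rewrite normr1.
have ing : mu.-integrable J (EFin \o (fun x => `|g x|)).
  by have := integrable_norm (L2on_integrable lg).
have n0 : (0 <= n%:E)%E by apply: le_trans gn; exact: Lnorm_ge0.
rewrite -lee_fin EFinM; apply: le_trans (lee_pmul _ _ gn N1); try exact: Lnorm_ge0.
apply: le_trans H; rewrite Lnorm1.
rewrite /norm1on /Rintegral fineK; last exact: (@integrable_fin_num _ _ _ mu J mJ _ ing).
rewrite integral_mkcond; apply: ge0_le_integral => //.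
- by move=> x _; rewrite patchE; case: ifP => // _; rewrite lee_fin.
- have := measurable_int mu ing => mi.
  by apply/(measurable_restrict _ mJ measurableT); rewrite setTI.
- apply/measurable_EFinP; apply: measurableT_comp => //.
  exact: measurable_funM.
- move=> x _ /=; rewrite !patchE; case: ifP => _; first by rewrite mulr1.
  by rewrite -[point]/(0%:E) lee_fin.
Qed.

End L2.

Lemma ae_imply (R : realType) (P Q : R -> Prop) : (forall x, P x -> Q x) ->
  {ae @lebesgue_measure R, forall x, P x} -> {ae @lebesgue_measure R, forall x, Q x}.
Proof.
move=> PQ; have F := ae_filter_ringOfSetsType (@lebesgue_measure R).
by apply: (@filterS _ _ F) => x; exact: PQ.
Qed.

Lemma ae_imply2 (R : realType) (P P' Q : R -> Prop) : (forall x, P x -> P' x -> Q x) ->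
  {ae @lebesgue_measure R, forall x, P x} -> {ae @lebesgue_measure R, forall x, P' x} ->
  {ae @lebesgue_measure R, forall x, Q x}.
Proof.
move=> PQ; have F := ae_filter_ringOfSetsType (@lebesgue_measure R).
by apply: (@filterS2 _ _ F) => x; exact: PQ.
Qed.

(** * Construction of the resolvent kernel *)

Section Resolvent.
Context (R : realType) (al be : R) (hab : al <= be) (J : set R).
Local Notation mu := (@lebesgue_measure R).
Local Notation inbox := (inbox al be).
Local Notation lip1 := (lip1 al be).
Local Notation lip2 := (lip2 al be).
Hypotheses (mJ : measurable J) (Jb : forall x, J x -> inbox x).
Context (K : R -> R -> R) (lK : lip2 K).
Implicit Types (f g : R -> R).
Local Notation TJ := (fun f => \int[mu]_(x in J) f x).

Lemma int_op_ae k g g' x : lip1 (k x) -> L2on J g -> L2on J g' ->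
  ae_eq_on J g g' -> int_op J k g x = int_op J k g' x.
Proof.
move=> lk lg lg' gg'; congr fine.
have mi h : L2on J h -> measurable_fun J (EFin \o (fun y => k x y * h y)).
  move=> lh; apply: (measurable_int mu).
  by apply: (L2on_mul_integrable mJ) => //; exact: (L2on_lip hab mJ Jb lk).
apply: (@ae_eq_integral _ _ _ mu J _ _ mJ (mi _ lg) (mi _ lg')).
by apply: ae_imply gg' => y gg' Jy /=; rewrite gg'.
Qed.

Lemma int_opB k g g' x : lip1 (k x) -> L2on J g -> L2on J g' ->
  int_op J k (fun y => g y - g' y) x = int_op J k g x - int_op J k g' x.
Proof.
move=> lk lg lg'.
have ii h : L2on J h -> mu.-integrable J (EFin \o (fun y => k x y * h y)).
  by move=> lh; apply: (L2on_mul_integrable mJ) => //; exact: (L2on_lip hab mJ Jb lk).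
rewrite /int_op -(@RintegralB _ _ _ mu J _ _ mJ (ii _ lg) (ii _ lg')).
by apply: eq_Rintegral => y _; rewrite mulrBr.
Qed.

Lemma L2onB g g' : L2on J g -> L2on J g' -> L2on J (fun x => g x - g' x).
Proof.
move=> lg lg'; rewrite /L2on.
have -> : (fun x => g x - g' x) \_ J = g \_ J - g' \_ J.
  apply/funext => x; rewrite patchE /= /GRing.add /= /GRing.opp /= !patchE.
  by case: ifP => // _; rewrite subrr.
have l12 : (1 <= 2%:E :> \bar R)%E by rewrite lee_fin ler1n.
exact: (@rpredB _ (Lfun mu 2%:E)).
Qed.

Lemma solvesB f f' g g' : solves J K f g -> solves J K f' g' ->
  solves J K (fun x => f x - f' x) (fun x => g x - g' x).
Proof.
move=> [lg ag] [lg' ag']; split; first exact: L2onB.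
apply: ae_imply2 ag ag' => x ag ag' Jx.
rewrite int_opB //; last by apply: lip2_row => //; exact: Jb.
by rewrite -ag // -ag' //; ring.
Qed.

(* The bound on (I - K)^-1 makes the resolvent kernel Lipschitz in its second
   variable; the first variable is taken care of by S = K + K S. *)
Lemma resolvent_exists V w : disc al be TJ V w ->
  (forall x y, inbox x -> inbox y -> K x y = K y x) ->
  invertible_ImK J K -> exists2 S, resolv al be TJ K S &
    forall x y, inbox x -> inbox y -> S x y = S y x.
Proof.
move=> dT Ksym [ex _ [C0 HC0]].
(* Nothing prevents the given bound from being negative, and inequalities are multiplied by it
   below. *)
pose C := Num.max C0 0.
have C_ge0 : 0 <= C by rewrite /C le_max lexx orbT.
have bT := disc_bfun hab dT.
have HC f g : L2on J f -> solves J K f g -> (norm2on J g <= C%:E * norm2on J f)%E.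
  move=> lf sg; apply: le_trans (HC0 f g lf sg) _.
  by apply: lee_wpmul2r; [exact: Lnorm_ge0|rewrite lee_fin le_max lexx].
have [M [M0 KM KL]] := lK.
have KL1 x x' y : inbox x -> inbox x' -> inbox y -> `|K x y - K x' y| <= M * `|x - x'|.
  move=> bx bx' b_y; apply: le_trans (KL (x, y) (x', y) _ _) _ => //=.
  by rewrite subrr normr0 addr0.
have KL2 x y y' : inbox x -> inbox y -> inbox y' -> `|K x y - K x y'| <= M * `|y - y'|.
  move=> bx b_y b_y'; apply: le_trans (KL (x, y) (x, y') _ _) _ => //=.
  by rewrite subrr normr0 add0r.
have Kcol y : inbox y -> lip1 (K ^~ y) by move=> b_y; exact: lip2_col.
have /choice[gs gsP] : forall y, exists g, inbox y -> solves J K (K ^~ y) g.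
  move=> y; have [b_y|nb] := pselect (inbox y); last by exists (fun=> 0).
  have [g sg] := ex _ (L2on_lip hab mJ Jb (Kcol y b_y)).
  by exists g.
have norm1_le f g B : lip1 f -> 0 <= B -> (forall x, inbox x -> `|f x| <= B) ->
    solves J K f g -> norm1on J g <= C * B * (be - al).
  move=> lf B0 fB sg; have lf2 := L2on_lip hab mJ Jb lf.
  have n2 : (norm2on J g <= (C * (B * kap al be))%:E)%E.
    apply: le_trans (HC f g lf2 sg) _; rewrite (EFinM C); apply: lee_wpmul2l.
      by rewrite lee_fin.
    exact: (norm2on_lip hab mJ Jb).
  have := norm1on_le hab mJ Jb sg.1 n2.
  by rewrite -!mulrA -expr2 sqr_sqrtr // subr_ge0.
(* [gs y] is determined only almost everywhere; this expression agrees with it almost everywhere on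
   J and is meaningful at every point of the box. *)
pose S x y := K x y + int_op J K (gs y) x.
pose N := C * M * (be - al).
have N0 : 0 <= N by rewrite !mulr_ge0 // subr_ge0.
have gN y : inbox y -> norm1on J (gs y) <= N.
  move=> b_y; apply: (norm1_le (K ^~ y)) (gsP y b_y) => //; first exact: Kcol.
  by move=> x bx; apply: (KM (x, y)).
have bU y (b_y : inbox y) := L2on_bfun hab mJ Jb (gsP y b_y).1.
have Krow x : inbox x -> lip1 (K x) by move=> bx; exact: lip2_row.
have lS : lip2 S.
  apply: lipMD => //; exists (M * N); split=> [|[x y] [/= bx b_y]|[x y] [x' y'] [/= bx b_y] [/= bx' b_y']].
  - by rewrite mulr_ge0.
  - apply: le_trans (bfun_le (bU y b_y) (Krow x bx) _) _.
      by move=> z bz; apply: (KM (x, z)).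
    by rewrite mulrC; apply: ler_wpM2l => //; exact: gN.
  have -> : int_op J K (gs y) x - int_op J K (gs y') x' =
     (int_op J K (gs y) x - int_op J K (gs y) x') +
     int_op J K (fun z => gs y z - gs y' z) x'.
    rewrite int_opB; [ring|exact: Krow| |]; exact: (gsP _ _).1.
  rewrite mulrDr; apply: le_trans (ler_normD _ _) _; apply: lerD.
    apply: le_trans (bfun_dist (bU y b_y) (Krow x bx) (Krow x' bx') (B := M * `|x - x'|) _) _.
      by move=> z bz; exact: KL1.
    rewrite mulrCA -[leRHS]mulrA; apply: ler_wpM2l => //.
    by apply: ler_wpM2r => //; exact: gN.
  have sd := solvesB (gsP y b_y) (gsP y' b_y').
  have ld : lip1 (fun x => K x y - K x y') by apply: lipMB; exact: Kcol.
  have r0 : 0 <= M * `|y - y'| by rewrite mulr_ge0.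
  have nd := norm1_le _ _ _ ld r0 (fun x bx => KL2 x y y' bx b_y b_y') sd.
  apply: le_trans (bfun_le (L2on_bfun hab mJ Jb sd.1) (Krow x' bx') (B := M) _) _.
    by move=> z bz; apply: (KM (x', z)).
  rewrite mulrC -mulrA; apply: ler_wpM2l => //; apply: le_trans nd _.
  by rewrite /N le_eqVlt; apply/orP; left; apply/eqP; ring.
have Sl x y : inbox x -> inbox y -> S x y = K x y + TJ (fun z => K x z * S z y).
  move=> bx b_y; rewrite {1}/S; congr (_ + _).
  have lSy : lip1 (S ^~ y) by exact: lip2_col.
  apply: int_op_ae; [exact: Krow|exact: (gsP y b_y).1|exact: (L2on_lip hab mJ Jb)|].
  have [_] := gsP y b_y; apply: ae_imply => z sz Jz.
  by rewrite /S -(sz Jz) subrK.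
clearbody S.
(* Replacing K(s, z) by S(z, s) - (K T S)(z, s) writes T(K S) as a difference of two expressions
   symmetric in s and t, the first visibly and the second by Fubini. *)
have Ssym x y : inbox x -> inbox y -> S x y = S y x.
  move=> bx b_y; rewrite (Sl x y) // (Sl y x) // (Ksym x y) //; congr (_ + _).
  have lSx : lip1 (S ^~ x) by exact: lip2_col.
  have lSy : lip1 (S ^~ y) by exact: lip2_col.
  have E s t : inbox s -> inbox t -> TJ (fun z => K s z * S z t) =
     TJ (fun z => S z s * S z t) - TJ (fun z => S z t * TJ (fun r => K z r * S r s)).
    move=> bs bt.
    have lSs : lip1 (S ^~ s) by exact: lip2_col.
    have lSt : lip1 (S ^~ t) by exact: lip2_col.
    have lKS := lip1_kernel bT lK lSs; have lKs := Krow s bs.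
    rewrite -(bfunB bT); try exact: lipMM.
    apply: (eq_bfun bT) => [|z bz]; first exact: lipMM.
    by rewrite (Sl z s) // (Ksym s z) //; ring.
  rewrite (E x y bx b_y) (E y x b_y bx); congr (_ - _).
    by congr (TJ _); apply/funext => z; rewrite mulrC.
  have lF : lip2 (fun z r => S z y * (K z r * S r x)).
    apply: lipMM; first exact: (lip2_fst lSy).
    by apply: lipMM => //; exact: (lip2_snd lSx).
  transitivity (TJ (fun z => TJ (fun r => S z y * (K z r * S r x)))).
    apply: (eq_bfun bT) => [|z bz].
      by apply: lipMM => //; exact: (lip1_kernel bT lK lSx).
    by have lKz := Krow z bz; rewrite (bfunZ bT) //; exact: lipMM.
  rewrite (disc_fubini hab dT bT lF).
  apply: (eq_bfun bT) => [|r br]; first exact: (lip1_bfun bT (lip2_swap lF)).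
  have lKr := Krow r br.
  rewrite -(bfunZ bT); last exact: lipMM.
  have lKr' := Kcol r br.
  apply: (eq_bfun bT) => [|z bz]; last by rewrite (Ksym z r) //; ring.
  by apply: lipMM => //; apply: lipMM => //; exact: lipM_cst.
exists S => //; split=> // x y bx b_y.
rewrite (Ssym x y) // (Sl y x) // (Ksym y x) //; congr (_ + _).
have lKy := Krow y b_y; have lSx : lip1 (S ^~ x) by exact: lip2_col.
apply: (eq_bfun bT) => [|z bz]; first exact: lipMM.
by rewrite (Ksym z y) // (Ssym x z) // mulrC.
Qed.

End Resolvent.

(** * Representatives continuous up to the boundary *)

Section Representatives.
Context (R : realType) (al be : R) (hab : al <= be) (J : set R).
Local Notation mu := (@lebesgue_measure R).
Local Notation inbox := (inbox al be).
Local Notation lip1 := (lip1 al be).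
Local Notation lip2 := (lip2 al be).
Hypotheses (mJ : measurable J) (oJ : open J) (Jb : forall x, J x -> inbox x).
Implicit Types (f g : R -> R).
Local Notation TJ := (fun f => \int[mu]_(x in J) f x).

Lemma closure_inbox x : closure J x -> inbox x.
Proof.
have sub : J `<=` `[al, be]%classic by move=> y /Jb b_y; rewrite /= in_itv.
move=> /(closure_subset sub); rewrite -(closure_id _).1; last exact: interval_closed.
by rewrite /= in_itv.
Qed.

Lemma closure_ball x0 e : closure J x0 -> 0 < e ->
  exists x1 r, [/\ 0 < r & forall y, `|x1 - y| < r -> J y /\ `|x0 - y| < e].
Proof.
move=> cx e0.
have oU : open (J `&` ball x0 e) by apply: openI => //; exact: ball_open.
have [x1 Ux1] := cx _ (nbhsx_ballx x0 e e0).
have : nbhs x1 (J `&` ball x0 e) by apply: open_nbhs_nbhs; split.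
by move=> /nbhs_ballP[r /= r0 rU]; exists x1, r; split=> // y /rU [].
Qed.

(** A null set contains no ball, and since J is open, balls inside J come arbitrarily close to any
    point of its closure. *)
Lemma ae_dense (P : R -> Prop) x0 e : {ae mu, forall x, J x -> P x} ->
  closure J x0 -> 0 < e -> exists x, [/\ J x, `|x0 - x| < e & P x].
Proof.
move=> [A [mA A0 PA]] cx e0; have [x1 [r [r0 rU]]] := closure_ball cx e0.
apply: contrapT => nex.
have sub : ball x1 r `<=` A.
  move=> y yr; have [Jy xy] := rU y yr; apply: PA => /= /(_ Jy) Py.
  by apply: nex; exists y.
have mB : measurable (ball x1 r) by exact: measurable_ball.
have : (mu (ball x1 r) <= mu A)%E by apply: le_measure; rewrite ?inE.
rewrite A0 lebesgue_measure_ball; last exact: ltW.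
by rewrite lee_fin leNgt mulrn_wgt0.
Qed.

Lemma lip1_continuous_closure f : lip1 f -> {within closure J, continuous f}.
Proof.
move=> lf; apply: (@continuous_subspaceW _ _ _ `[al, be]%classic); last exact: lip1_continuous.
by move=> x /closure_inbox bx; rewrite /= in_itv.
Qed.

Lemma within_continuous_near f x0 e : {within closure J, continuous f} -> closure J x0 ->
  0 < e -> exists2 d, 0 < d & forall y, closure J y -> `|x0 - y| < d -> `|f x0 - f y| < e.
Proof.
move=> /subspace_continuousP cf cx e0.
have /cvgrPdist_lt/(_ _ e0) := cf x0 cx.
rewrite near_withinE => /nbhs_ballP[d /= d0 dP]; exists d => // y cy xy.
exact: dP.
Qed.

Lemma eq_on_closure f g : {within closure J, continuous f} -> {within closure J, continuous g} ->
  ae_eq_on J f g -> forall x, closure J x -> f x = g x.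
Proof.
move=> cf cg fg x0 cx; apply/eqP/negPn/negP => ne.
have e0 : 0 < `|f x0 - g x0| / 2 by rewrite divr_gt0 // normr_gt0 subr_eq0.
have [d d0 df] := within_continuous_near cf cx e0.
have [d' d0' dg] := within_continuous_near cg cx e0.
have dd : 0 < Num.min d d' by rewrite lt_min d0.
have [x [Jx]] := ae_dense fg cx dd; rewrite lt_min => /andP[xd xd'] fgx.
have cJ : closure J x by exact: subset_closure.
have := df x cJ xd; have := dg x cJ xd'; rewrite fgx.
have := ler_distD (g x) (f x0) (g x0); rewrite (distrC (g x) (g x0)); lra.
Qed.

Context (K : R -> R -> R) (lK : lip2 K).
Context (V : R) (w : forall N, 'I_N.+1 -> R) (dT : disc al be TJ V w).
Let bT := disc_bfun hab dT.

Lemma solf_solves f g : lip1 g -> solf al be TJ K f g -> solves J K f g.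
Proof.
move=> lg sg; split; first exact: (L2on_lip hab mJ Jb).
have F := ae_filter_ringOfSetsType mu.
apply: (@filterE _ _ F) => x Jx; rewrite sg; last exact: Jb.
by rewrite addrK.
Qed.

(** [get] returns an unspecified continuous solution h. The function f + K h agrees with h almost
    everywhere on J, is Lipschitz and solves the equation on the whole box. So uniqueness among
    Lipschitz solutions is enough, and this is what the contraction provides for moved endpoints. *)
Lemma inv_ImK_unique f g : lip1 f -> lip1 g -> solf al be TJ K f g ->
  (forall h, lip1 h -> solf al be TJ K f h -> forall x, inbox x -> h x = g x) ->
  forall x, closure J x -> inv_ImK J K f x = g x.
Proof.
move=> lf lg sg uniq.
have Pg : [set g : R -> R | {within closure J, continuous g} /\ solves J K f g] g.
  by split; [exact: lip1_continuous_closure|exact: solf_solves].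
have := @getI _ _ _ Pg; rewrite -/(inv_ImK J K f) => -[ch [lh ah]].
set h := inv_ImK J K f in ch lh ah *.
pose k x := f x + int_op J K h x.
have bh := L2on_bfun hab mJ Jb lh.
have lk : lip1 k by apply: lipMD => //; exact: (lip1_bfun bh lK).
have hk : ae_eq_on J h k.
  by apply: ae_imply ah => x ahx Jx; rewrite /k -(ahx Jx) subrK.
have sk : solf al be TJ K f k.
  move=> x bx; rewrite {1}/k; congr (_ + _).
  apply: (int_op_ae hab mJ Jb) => //; first exact: lip2_row.
  exact: (L2on_lip hab mJ Jb).
have ck := lip1_continuous_closure lk.
by move=> x cx; rewrite (eq_on_closure ch ck hk cx) (uniq k) //; exact: closure_inbox.
Qed.

Context (S : R -> R -> R) (rS : resolv al be TJ K S).
Let lS := resolvS rS.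

(** Insert f = g - K g into S f; by Fubini and S = K + S T K the terms containing S cancel. *)
Lemma int_op_resolvent f g x : inbox x -> L2on J f -> solves J K f g ->
  int_op J K g x = int_op J S f x.
Proof.
move=> bx lf [lg ag].
have bU := L2on_bfun hab mJ Jb lg.
have lSx := lip2_row lS bx; have lKx := lip2_row lK bx.
have lKg : lip1 (int_op J K g) by exact: (lip1_bfun bU lK).
have lKg2 := L2on_lip hab mJ Jb lKg.
have fE : ae_eq_on J f (fun z => g z - int_op J K g z).
  by apply: ae_imply ag => z agz Jz; rewrite agz.
rewrite (int_op_ae hab mJ Jb lSx lf (L2onB lg lKg2) fE).
rewrite (int_opB hab mJ Jb lSx lg lKg2).
have lF : lip2 (fun z t => S x z * K z t) by apply: lipMM => //; exact: (lip2_fst lSx).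
have -> : int_op J S (int_op J K g) x =
   TJ (fun z => \int[mu]_(t in J) (S x z * K z t * g t)).
  apply: (eq_bfun bT) => [|z bz]; first exact: lipMM.
  have lKz := lip2_row lK bz.
  by rewrite -(bfunZ bU).
rewrite (disc_fubini hab dT bU lF).
have -> : \int[mu]_(t in J) (TJ (fun z => S x z * K z t) * g t) =
  \int[mu]_(t in J) ((S x t - K x t) * g t).
  apply: (eq_bfun bU) => [|t bt]; first exact: (lip1_bfun bT (lip2_swap lF)).
  by rewrite (resolvr rS) // addrC addKr.
by rewrite (bfunB bU) // opprB addrC subrK.
Qed.

Lemma resolvent_is_kernel : is_resolvent_kernel J K S.
Proof.
split; last first.
  move=> f g lf sg; have F := ae_filter_ringOfSetsType mu.
  apply: (@filterE _ _ F) => x Jx; apply: int_op_resolvent => //; exact: Jb.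
have [C [C0 _ Cl]] := lS.
apply/subspace_continuousP => -[x y] /= [/closure_inbox bx /closure_inbox b_y].
apply/cvgrPdist_lt => e e0; rewrite near_withinE.
have d0 : 0 < e / (2 * (C + 1)) by rewrite divr_gt0 // mulr_gt0 // ltr_wpDl.
apply/nbhs_ballP; exists (e / (2 * (C + 1))) => // -[x' y'] [/= xx' yy'] [/closure_inbox bx' /closure_inbox b_y'].
apply: le_lt_trans (Cl (x, y) (x', y') _ _) _ => //=.
have : `|x - x'| + `|y - y'| < e / (C + 1).
  have -> : e / (C + 1) = e / (2 * (C + 1)) + e / (2 * (C + 1)).
    by field; rewrite gt_eqF // ltr_wpDl.
  exact: ltrD.
have C1 : 0 < C + 1 by rewrite ltr_wpDl.
rewrite ltr_pdivlMr // mulrC; apply: le_lt_trans.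
by apply: ler_wpM2r; [exact: addr_ge0|rewrite lerDl].
Qed.

Hypothesis existsL2 : forall f, L2on J f -> exists g, solves J K f g.

Lemma resolvent_kernel_row S1 x : is_resolvent_kernel J K S1 -> closure J x ->
  {within closure J, continuous (S1 x)}.
Proof.
move=> [/subspace_continuousP cS _] cx; apply/subspace_continuousP => y cy.
apply/cvgrPdist_lt => e e0; rewrite near_withinE.
have /cvgrPdist_lt/(_ _ e0) := cS (x, y) (conj cx cy).
rewrite near_withinE => /nbhs_ballP[d /= d0 dP].
apply/nbhs_ballP; exists d => // y' yy' cy'.
by apply: (dP (x, y')) => //; split=> //=; exact: ballxx.
Qed.

Lemma resolvent_kernel_near S1 x y e : is_resolvent_kernel J K S1 ->
  closure J x -> closure J y -> 0 < e -> exists2 d, 0 < d &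
  forall x' y', closure J x' -> closure J y' -> `|x - x'| < d -> `|y - y'| < d ->
    `|S1 x y - S1 x' y'| < e.
Proof.
move=> [/subspace_continuousP cS _] cx cy e0.
have /cvgrPdist_lt/(_ _ e0) := cS (x, y) (conj cx cy).
rewrite near_withinE => /nbhs_ballP[d /= d0 dP]; exists d => // x' y' cx' cy' xx' yy'.
exact: (dP (x', y')).
Qed.

Lemma int_op_indic S1 c d x : c <= d -> `[c, d]%classic `<=` J ->
  int_op J S1 (\1_(`[c, d]%classic)) x = \int[mu]_(z in `[c, d]) S1 x z.
Proof.
move=> cd sub.
have e : J `&` `[c, d]%classic = `[c, d]%classic by apply: setIidr.
rewrite -[in RHS]e Rintegral_mkcondr; apply: eq_Rintegral => z _.
rewrite patchE indicE; case: ifPn => _; by rewrite ?mulr1 ?mulr0.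
Qed.

(** Both kernels are tested on the indicator function of a short interval near y. If they differed
    at (x, y), their difference would keep its sign near that point, although its integral over the
    interval vanishes for some x1 close to x. *)
Lemma resolvent_kernel_unique S1 S2 x y :
  is_resolvent_kernel J K S1 -> is_resolvent_kernel J K S2 ->
  closure J x -> closure J y -> S1 x y = S2 x y.
Proof.
move=> r1 r2 cx cy; apply/eqP/negPn/negP => ne.
pose D := S1 x y - S2 x y.
have D0 : 0 < `|D| by rewrite normr_gt0 subr_eq0.
have e0 : 0 < `|D| / 4 by rewrite divr_gt0.
have [d1 d10 P1] := resolvent_kernel_near r1 cx cy e0.
have [d2 d20 P2] := resolvent_kernel_near r2 cx cy e0.
have dd : 0 < Num.min d1 d2 by rewrite lt_min d10.
have [y1 [r [r0 rU]]] := closure_ball cy dd.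
pose c := y1 - r / 2; pose d := y1 + r / 2.
have cd : c < d by rewrite /c /d; lra.
have cdU z : c <= z -> z <= d -> J z /\ `|y - z| < Num.min d1 d2.
  move=> cz zd; apply: rU; rewrite ltr_norml; move: cz zd; rewrite /c /d => h1 h2.
  by apply/andP; split; lra.
have sub : `[c, d]%classic `<=` J by move=> z /=; rewrite in_itv /= => /andP[h1 h2]; case: (cdU z h1 h2).
have lI : L2on J (\1_(`[c, d]%classic)).
  apply: (L2on_bounded hab mJ Jb ler01) => [|z _].
    by apply: measurable_indic; exact: measurable_itv.
  by rewrite indicE; case: (_ \in _); rewrite ?normr1 ?normr0.
have [g sg] := existsL2 lI.
have a1 := r1.2 _ _ lI sg; have a2 := r2.2 _ _ lI sg.
have a12 : ae_eq_on J (int_op J S1 (\1_(`[c, d]%classic))) (int_op J S2 (\1_(`[c, d]%classic))).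
  by apply: ae_imply2 a1 a2 => z h1 h2 Jz; rewrite -h1 // h2.
have [x1 [Jx1]] := ae_dense a12 cx dd; rewrite lt_min => /andP[xd1 xd2].
rewrite !int_op_indic //; try exact: ltW.
have mI : measurable (`[c, d]%classic : set R) by exact: measurable_itv.
pose I : set R := `[c, d]%classic; rewrite -/I in mI sub *.
have cx1 : closure J x1 by exact: subset_closure.
have ii S' : is_resolvent_kernel J K S' -> mu.-integrable I (EFin \o S' x1).
  move=> r'; apply: continuous_compact_integrable; first exact: segment_compact.
  apply: (continuous_subspaceW _ (resolvent_kernel_row r' cx1)).
  by move=> z /sub; exact: subset_closure.
have i1 := ii _ r1; have i2 := ii _ r2.
have close z : c <= z -> z <= d -> `|D - (S1 x1 z - S2 x1 z)| <= `|D| / 2.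
  move=> cz zd; have [Jz] := cdU z cz zd; rewrite lt_min => /andP[zd1 zd2].
  have cz' : closure J z by exact: subset_closure.
  have h1 := P1 x1 z cx1 cz' xd1 zd1; have h2 := P2 x1 z cx1 cz' xd2 zd2.
  have -> : D - (S1 x1 z - S2 x1 z) = (S1 x y - S1 x1 z) - (S2 x y - S2 x1 z).
    by rewrite /D; ring.
  apply: le_trans (ler_normB _ _) _; lra.
move/eqP; rewrite -subr_eq0 -(@RintegralB _ _ _ mu I _ _ mI i1 i2) => /eqP I0.
have mcd : fine (mu I) = d - c.
  by rewrite lebesgue_measure_itv /= lte_fin cd.
have iB : mu.-integrable I (EFin \o (fun z => S1 x1 z - S2 x1 z)).
  by have := (@integrableB _ _ _ mu I mI _ _) i1 i2.
have iC (k : R) : mu.-integrable I (EFin \o (fun=> k : R)).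
  apply: continuous_compact_integrable; first exact: segment_compact.
  by apply: continuous_subspaceT => ?; exact: cvg_cst.
have up : \int[mu]_(z in I) (S1 x1 z - S2 x1 z) <= \int[mu]_(z in I) (D + `|D| / 2).
  apply: (@le_Rintegral _ _ _ mu I _ _ mI iB (iC _)) => z; rewrite /I /= in_itv /= => /andP[h1 h2].
  by have := close z h1 h2; rewrite ler_distlC => /andP[].
have dn : \int[mu]_(z in I) (D - `|D| / 2) <= \int[mu]_(z in I) (S1 x1 z - S2 x1 z).
  apply: (@le_Rintegral _ _ _ mu I _ _ mI (iC _) iB) => z; rewrite /I /= in_itv /= => /andP[h1 h2].
  by have := close z h1 h2; rewrite ler_distlC => /andP[].
move: up dn; rewrite I0 !(@Rintegral_cst _ _ _ mu I mI) mcd.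
have dc : 0 < d - c by rewrite subr_gt0.
rewrite pmulr_lge0 // pmulr_lle0 //; move: D0; case: (ger0P D) => _; lra.
Qed.

Lemma resolvent_kernelE x y : closure J x -> closure J y ->
  resolvent_kernel J K x y = S x y.
Proof.
move=> cx cy; have rK := resolvent_is_kernel.
apply: resolvent_kernel_unique => //.
exact: (@getI _ _ _ rK).
Qed.

End Representatives.

(** * Commutator with x and translation *)

Section Commutators.
Context (R : realType) (al be : R) (hab : al <= be).
Local Notation inbox := (inbox al be).
Local Notation lip1 := (lip1 al be).
Local Notation lip2 := (lip2 al be).
Context (T : (R -> R) -> R) (V : R) (w : forall N, 'I_N.+1 -> R) (dT : disc al be T V w).
Context (K S : R -> R -> R) (rS : resolv al be T K S).
Hypothesis Ssym : forall x y, inbox x -> inbox y -> S x y = S y x.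
Let bT := disc_bfun hab dT.
Let lK := resolvK rS.
Let lS := resolvS rS.

Lemma resfD f g x : lip1 f -> lip1 g -> inbox x ->
  resf T S (fun z => f z + g z) x = resf T S f x + resf T S g x.
Proof.
move=> lf lg bx; have lSx := lip2_row lS bx.
rewrite /resf addrACA; congr (_ + _); rewrite -(bfunD bT); try exact: lipMM.
by congr T; apply/funext => z; rewrite mulrDr.
Qed.

Lemma resfZ c f x : lip1 f -> inbox x ->
  resf T S (fun z => c * f z) x = c * resf T S f x.
Proof.
move=> lf bx; have lSx := lip2_row lS bx.
rewrite /resf mulrDr -(bfunZ bT); last exact: lipMM.
by congr (_ + T _); apply/funext => z; rewrite mulrCA.
Qed.

Lemma resf_sum (I : finType) (F : I -> R -> R) x : (forall i, lip1 (F i)) -> inbox x ->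
  resf T S (fun z => \sum_i F i z) x = \sum_i resf T S (F i) x.
Proof.
move=> lF bx; have lSx := lip2_row lS bx.
rewrite /resf big_split /=; congr (_ + _); rewrite -(bfun_sum bT).
  by congr T; apply/funext => z; rewrite mulr_sumr.
by move=> i; apply: lipMM => //; exact: lF.
Qed.

Lemma resf_col x y : inbox x -> inbox y -> resf T S (K ^~ y) x = S x y.
Proof. by move=> bx b_y; rewrite [RHS](resolvr rS). Qed.

(** It gives (A', (I - K)^-1 A) = v, so that two different terms in the derivative of p_j both
    become q_j v and produce the coefficient 2. *)
Lemma resf_sym f g : lip1 f -> lip1 g ->
  T (fun z => f z * resf T S g z) = T (fun z => g z * resf T S f z).
Proof.
move=> lf lg.
have lSf := lip1_kernel bT lS lf; have lSg := lip1_kernel bT lS lg.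
have E p q : lip1 p -> lip1 q -> T (fun z => p z * resf T S q z) =
    T (fun z => p z * q z) + T (fun z => p z * T (fun t => S z t * q t)).
  move=> lp lq; have lSq := lip1_kernel bT lS lq.
  rewrite -(bfunD bT); try exact: lipMM.
  by congr T; apply/funext => z; rewrite mulrDr.
rewrite (E f g lf lg) (E g f lg lf); congr (_ + _).
  by congr T; apply/funext => z; rewrite mulrC.
have lF : lip2 (fun z t => f z * (S z t * g t)).
  by apply: lipMM; [exact: (lip2_fst lf)|apply: lipMM => //; exact: (lip2_snd lg)].
transitivity (T (fun z => T (fun t => f z * (S z t * g t)))).
  apply: (eq_bfun bT) => [|z bz]; first exact: lipMM.
  by have lSz := lip2_row lS bz; rewrite (bfunZ bT) //; exact: lipMM.
rewrite (disc_fubini hab dT bT lF).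
apply: (eq_bfun bT) => [|t bt]; first exact: (lip1_bfun bT (lip2_swap lF)).
have lSt := lip2_row lS bt; have lSt' := lip2_col lS bt.
rewrite -(bfunZ bT); last exact: lipMM.
apply: (eq_bfun bT) => [|z bz]; last by rewrite (Ssym bz bt); ring.
by apply: lipMM => //; apply: lipMM => //; exact: lipM_cst.
Qed.

Context (A A1 : R -> R) (lA : lip1 A) (lA1 : lip1 A1).
Hypothesis Kcomm : forall x y, inbox x -> inbox y ->
  (x - y) * K x y = A x * A1 y - A1 x * A y.
Local Notation Q := (resf T S A).
Local Notation P := (resf T S A1).

Lemma comm_mul g x : lip1 g -> inbox x ->
  T (fun z => K x z * (z * g z)) = x * T (fun z => K x z * g z)
    - (A x * T (fun z => A1 z * g z) - A1 x * T (fun z => A z * g z)).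
Proof.
move=> lg bx; have lKx := lip2_row lK bx; have lid := lip1_id al be.
have lKg : lip1 (fun z => K x z * g z) by exact: lipMM.
have l1 : lip1 (fun z => A1 z * g z) by exact: lipMM.
have l2 : lip1 (fun z => A z * g z) by exact: lipMM.
have lc (c : R) f : lip1 f -> lip1 (fun z => c * f z).
  by move=> lf; apply: lipMM => //; exact: lipM_cst.
rewrite -!(bfunZ bT) // -(bfunB bT); try exact: lc.
rewrite -(bfunB bT); [|exact: lc|by apply: lipMB; exact: lc].
apply: (eq_bfun bT) => [|z bz].
  by apply: lipMM => //; apply: (lipMM lid).
have := Kcomm bx bz; have -> : K x z * (z * g z) = x * (K x z * g z) - (x - z) * K x z * g z.
  by ring.
by move=> ->; ring.
Qed.

(** By the commutator identity for K, the function z |-> (z - y) S(z, y) solves the equation with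
    right-hand side P(y) A - Q(y) A'; applying (I - K T)^-1 gives the formula. *)
Lemma comm_resolvent x y : inbox x -> inbox y ->
  (x - y) * S x y = Q x * P y - P x * Q y.
Proof.
move=> bx b_y; have lSy := lip2_col lS b_y; have lid := lip1_id al be.
pose tau z := (z - y) * S z y.
have ltau : lip1 tau.
  by apply: lipMM => //; apply: lipMB => //; exact: lipM_cst.
pose f z := P y * A z + - Q y * A1 z.
have lf1 : lip1 (fun z => P y * A z) by apply: lipMM => //; exact: lipM_cst.
have lf2 : lip1 (fun z => - Q y * A1 z) by apply: lipMM => //; exact: lipM_cst.
have lf : lip1 f by exact: lipMD.
have stau : solf al be T K f tau.
  move=> z bz; rewrite /tau; have lKz := lip2_row lK bz.
  have -> : T (fun t => K z t * ((t - y) * S t y)) =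
      T (fun t => K z t * (t * S t y)) - y * T (fun t => K z t * S t y).
    rewrite -(bfunZ bT); last exact: lipMM.
    rewrite -(bfunB bT); first last.
    - by apply: lipMM; [exact: lipM_cst|exact: lipMM].
    - by apply: lipMM => //; exact: (lipMM lid).
    by congr T; apply/funext => t; ring.
  rewrite comm_mul // (resolvl rS bz b_y).
  have E p : lip1 p -> T (fun t => p t * S t y) = resf T S p y - p y.
    move=> lp; rewrite /resf addrC addKr; have lSy' := lip2_row lS b_y.
    apply: (eq_bfun bT) => [|t bt]; first exact: lipMM.
    by rewrite (Ssym bt b_y) mulrC.
  rewrite !E // /f mulrDr Kcomm //; ring.
have := solf_resf hab dT rS lf ltau stau bx.
rewrite /tau => ->; rewrite /f resfD // !resfZ //; ring.
Qed.

(** The function z Q(z) solves the equation with right-hand side z A + v A - u A'. The case matters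
    because Airy's equation makes z A the derivative of A'. *)
Lemma resf_mulx x : inbox x ->
  resf T S (fun z => z * A z) x =
  x * Q x - T (fun z => A1 z * Q z) * Q x + T (fun z => A z * Q z) * P x.
Proof.
move=> bx; have lid := lip1_id al be.
have lQ := lip1_resf bT lS lA.
set v := T _; set u := T _.
pose f z := z * A z + (v * A z + - u * A1 z).
have l0 : lip1 (fun z => z * A z) by exact: (lipMM lid).
have l1 : lip1 (fun z => v * A z) by apply: lipMM => //; exact: lipM_cst.
have l2 : lip1 (fun z => - u * A1 z) by apply: lipMM => //; exact: lipM_cst.
have l12 : lip1 (fun z => v * A z + - u * A1 z) by exact: lipMD.
have lf : lip1 f by exact: lipMD.
have lg : lip1 (fun z => z * Q z) by exact: (lipMM lid).
have sg : solf al be T K f (fun z => z * Q z).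
  move=> z bz; rewrite comm_mul // -/v -/u {1}(resf_solf hab dT rS lA bz) /f; ring.
have := solf_resf hab dT rS lf lg sg bx.
rewrite /f resfD // resfD // !resfZ // => ->; ring.
Qed.

End Commutators.

(** Summing the estimate over the cells of a mesh leaves an error proportional to the mesh. This
    replaces the zero-derivative criterion for functions known only through quadratic estimates. *)
Lemma quad_const (R : realType) (D : R -> R) c d C : c <= d ->
  (forall s t, c <= s -> s <= t -> t <= d -> `|D t - D s| <= C * (t - s) ^+ 2) -> D d = D c.
Proof.
move=> cd DC; apply: (@eta_eq R c d _ _ (C * (d - c))) => N.
have e0 := eta_ge0 cd N.
have -> : D d - D c = \sum_(i < N.+1) (D (ndp c d N i.+1) - D (ndp c d N i)).
  rewrite -(big_mkord predT (fun i => D (ndp c d N i.+1) - D (ndp c d N i))).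
  by rewrite telescope_sumr // ndp_last ndp0.
apply: le_trans (ler_norm_sum _ _ _) _.
have -> : C * (d - c) * eta c d N = \sum_(i < N.+1) C * eta c d N ^+ 2.
  have e : d - c = eta c d N * N.+1%:R by rewrite /eta divfK // pnatr_eq0.
  by rewrite sumr_const card_ord -mulr_natr {1}e; ring.
apply: ler_sum => i _.
have /andP[h1 _] := inbox_ndp cd (ltnW (ltn_ord i)).
have /andP[_ h2] := inbox_ndp cd (ltn_ord i).
apply: le_trans (DC _ _ h1 (ndp_le cd N i) h2) _.
have -> // : ndp c d N i.+1 - ndp c d N i = eta c d N.
by rewrite /ndp -natr1; ring.
Qed.

Lemma lip1_sub (R : realType) (al be al' be' : R) f : al <= al' -> be' <= be ->
  lip1 al be f -> lip1 al' be' f.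
Proof.
move=> aa bb; apply: (lipM_comp (E := box1 al' be') (E' := box1 al be) (h := id)) => //=.
by move=> x /andP[h1 h2]; rewrite /inbox (le_trans aa) // (le_trans h2).
Qed.

Lemma lip2_sub (R : realType) (al be al' be' : R) k : al <= al' -> be' <= be ->
  lip2 al be k -> lip2 al' be' k.
Proof.
move=> aa bb; apply: (lipM_comp (E := box2 al' be') (E' := box2 al be) (h := id)) => //=.
move=> x [/andP[h1 h2] /andP[h3 h4]].
by split; rewrite /inbox ?(le_trans aa) // ?(le_trans h2) ?(le_trans h4).
Qed.

Lemma lip1_shift (R : realType) (al be al' be' h : R) f : al <= al' + h -> be' + h <= be ->
  lip1 al be f -> lip1 al' be' (fun x => f (x + h)).
Proof.
move=> aa bb; apply: (lipM_comp (E := box1 al' be') (E' := box1 al be) (h := fun x => x + h)) => /=.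
  move=> x /andP[h1 h2]; rewrite /inbox (le_trans aa) ?lerD2r //.
  by rewrite (le_trans _ bb) // lerD2r.
by move=> x x' _ _; rewrite opprD addrACA subrr addr0.
Qed.

Lemma norm_sum_sgn (R : realType) n (F : 'I_n -> R) B : (forall k, `|F k| <= B) ->
  `|\sum_k sgn R k * F k| <= n%:R * B.
Proof.
move=> FB; apply: le_trans (ler_norm_sum _ _ _) _.
rewrite mulr_natl -[leRHS](_ : \sum_(k < n) B = _); last by rewrite sumr_const card_ord.
by apply: ler_sum => k _; rewrite normrM normr_sgn mul1r.
Qed.

(** * Translation of the argument and integration by parts on J *)

Section Translation.
Context (R : realType) (al be rho : R) (m : nat).
Hypotheses (rho0 : 0 < rho) (hab2 : al + 2 * rho <= be - 2 * rho).
Local Notation al1 := (al + rho).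
Local Notation be1 := (be - rho).
Local Notation al2 := (al + 2 * rho).
Local Notation be2 := (be - 2 * rho).
Let hab1 : al1 <= be1. Proof. by have := rho0; have := hab2; lra. Qed.
Let hab : al <= be. Proof. by have := rho0; have := hab2; lra. Qed.
Context (a : 'rV[R]_(m.*2)) (ga : sorted_in al2 be2 a).
Local Notation T := (Tint a).

Lemma sorted_in_sub al' be' : al' <= al2 -> be2 <= be' -> sorted_in al' be' a.
Proof.
move=> h1 h2; split=> [|k]; first exact: ga.1.
have /andP[h3 h4] := ga.2 k.
by rewrite /inbox (le_trans h1) // (le_trans h4).
Qed.

(** A primitive of the translate and the translate of a primitive differ by a constant, which
    cancels in the signed sum; boundary terms remain. The endpoints lie in the smallest box so that
    z - h stays where [F] is controlled. *)
Lemma Tint_translate h F L : `|h| <= rho -> lip1 al1 be1 F -> 0 <= L ->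
  (forall x x', inbox al1 be1 x -> inbox al1 be1 x' -> `|F x - F x'| <= L * `|x - x'|) ->
  `|T (fun z => F (z - h)) - T F + h * \sum_k sgn R k * F (a 0 k)| <= (m.*2)%:R * (L * h ^+ 2).
Proof.
rewrite ler_norml => /andP[h1 h2] lF L0 FL.
have ga1 : sorted_in al1 be1 a by apply: sorted_in_sub; lra.
have lFh : lip1 al2 be2 (fun z => F (z - h)) by apply: lip1_shift lF; lra.
pose D t := prim al2 (fun z => F (z - h)) t - prim al1 F (t - h).
have b12 t : inbox al2 be2 t -> inbox al1 be1 (t - h).
  by move=> /andP[h3 h4]; apply/andP; split; lra.
have Dc t : inbox al2 be2 t -> D t = D al2.
  move=> /andP[at_ tb]; apply: (quad_const (C := L + L) at_) => s r as_ sr rt.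
  have bs : inbox al2 be2 s by apply/andP; split; lra.
  have br : inbox al2 be2 r by apply/andP; split; lra.
  have LFh x x' : inbox al2 be2 x -> inbox al2 be2 x' ->
      `|F (x - h) - F (x' - h)| <= L * `|x - x'|.
    move=> bx bx'; apply: le_trans (FL _ _ (b12 _ bx) (b12 _ bx')) _.
    by rewrite opprD addrACA subrr addr0.
  have q1 := prim_quad lFh bs br L0 LFh.
  have q2 := prim_quad lF (b12 _ bs) (b12 _ br) L0 FL.
  have e : r - h - (s - h) = r - s by ring.
  rewrite e in q2; rewrite mulrDl.
  have -> : D r - D s =
    (prim al2 (fun z => F (z - h)) r - prim al2 (fun z => F (z - h)) s - (r - s) * F (s - h)) -
    (prim al1 F (r - h) - prim al1 F (s - h) - (r - s) * F (s - h)) by rewrite /D; ring.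
  by apply: le_trans (ler_normB _ _) _; apply: lerD.
have E1 : T (fun z => F (z - h)) = \sum_k sgn R k * prim al1 F (a 0 k - h).
  rewrite (Tint_prim hab2 ga lFh).
  have -> : \sum_k sgn R k * prim al2 (fun z => F (z - h)) (a 0 k) =
      \sum_k (sgn R k * prim al1 F (a 0 k - h) + sgn R k * D al2).
    by apply: eq_bigr => k _; rewrite -(Dc _ (ga.2 k)) /D; ring.
  by rewrite big_split /= -mulr_suml sum_sgn0 mul0r addr0.
rewrite E1 (Tint_prim hab1 ga1 lF) mulr_sumr -sumrB -big_split /=.
rewrite (eq_bigr (fun k => sgn R k *
   (prim al1 F (a 0 k - h) - prim al1 F (a 0 k) - (a 0 k - h - a 0 k) * F (a 0 k)))); last first.
  by move=> k _; ring.
apply: norm_sum_sgn => k.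
have := prim_quad lF (ga1.2 k) (b12 _ (ga.2 k)) L0 FL.
have -> : a 0 k - h - a 0 k = - h by ring.
by rewrite sqrrN.
Qed.

Context (K S : R -> R -> R) (rS : resolv al be T K S) (A : R -> R) (lA : lip1 al be A).
Context (CK : R) (CK0 : 0 <= CK).
Hypothesis Kshift : forall h x z, `|h| <= rho -> inbox al2 be2 x -> inbox al2 be2 z ->
  `|K (x + h) z - K x (z - h) + h * (A x * A z)| <= CK * h ^+ 2.
Let ga0 : sorted_in al be a. Proof. by apply: sorted_in_sub; have := rho0; lra. Qed.
Let dT0 := disc_Tint hab ga0.
Let dT2 := disc_Tint hab2 ga.
Let bT0 := disc_bfun hab dT0.
Let bT2 := disc_bfun hab2 dT2.
Let lK := resolvK rS.
Let lS := resolvS rS.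
Let aa : al <= al2. Proof. by have := rho0; lra. Qed.
Let bb : be2 <= be. Proof. by have := rho0; lra. Qed.
Let sub x : inbox al2 be2 x -> inbox al be x.
Proof. by have := rho0; move=> r0 /andP[h1 h2]; apply/andP; split; lra. Qed.

Let rS2 : resolv al2 be2 T K S.
Proof.
split; [exact: lip2_sub lK|exact: lip2_sub lS| |] => x y bx b_y.
  by apply: (resolvl rS); exact: sub.
by apply: (resolvr rS); exact: sub.
Qed.

(* Translating G = f + K T G gives (I - K T)(G(. + h) - G)
   = h (f' - A T(A G) - \sum_k sgn_k K(., a_k) G(a_k)) + O(h^2). *)
Lemma resf_shift f f1 Cf : lip1 al be f -> lip1 al be f1 -> 0 <= Cf ->
  (forall h x, `|h| <= rho -> inbox al2 be2 x ->
    `|f (x + h) - f x - h * f1 x| <= Cf * h ^+ 2) ->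
  exists2 C, 0 <= C & forall h x, `|h| <= rho -> inbox al2 be2 x ->
    `|resf T S f (x + h) - resf T S f x - h * (resf T S f1 x
        - T (fun z => A z * resf T S f z) * resf T S A x
        - \sum_k sgn R k * (S x (a 0 k) * resf T S f (a 0 k)))| <= C * h ^+ 2.
Proof.
move=> lf lf1 Cf0 fC.
set G := resf T S f; set u := T (fun z => A z * G z).
have lG : lip1 al be G by exact: (lip1_resf bT0 lS lf).
have sG : solf al be T K f G := resf_solf hab dT0 rS lf.
have [MG [MG0 GB GL]] := lG; have [MK [MK0 KB KL]] := lK; have [MS [MS0 SB _]] := lS.
pose V := Vbox al2 be2 m; have V0 : 0 <= V := bfun_ge0 bT2.
pose LF := MK * MG + MK * MG.
(* The four summands are the Taylor error of [f], the error of the shift identity for [K], that of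
   the translated integral, and the replacement of [G (a 0 k + h)] by [G (a 0 k)]. *)
pose C1 := Cf + V * (CK * MG) + (m.*2)%:R * LF + (m.*2)%:R * (MK * MG).
have LF0 : 0 <= LF by rewrite addr_ge0 // mulr_ge0.
have C10 : 0 <= C1 by rewrite !addr_ge0 // ?mulr_ge0 // mulr_ge0.
have VMS : 0 <= V * (MS * C1) by rewrite !mulr_ge0.
exists (C1 + V * (MS * C1)); first exact: addr_ge0.
move=> h x hr; have /andP[hl hu] : - rho <= h <= rho by rewrite -ler_norml.
have shift_box y : inbox al2 be2 y -> inbox al be (y + h).
  by move=> /andP[h1 h2]; apply/andP; split; lra.
pose phi y := G (y + h) - G y.
have lG2 : lip1 al2 be2 G by exact: lip1_sub lG.
have lA2 : lip1 al2 be2 A by exact: lip1_sub lA.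
have lK2 := resolvK rS2; have lS2 := resolvS rS2.
have lGh : lip1 al2 be2 (fun y => G (y + h)) by apply: lip1_shift lG; lra.
have lphi : lip1 al2 be2 phi by exact: lipMB.
pose psi y := phi y - T (fun z => K y z * phi z).
have lpsi : lip1 al2 be2 psi.
  by apply: lipMB => //; exact: (lip1_kernel bT2 lK2 lphi).
have spsi : solf al2 be2 T K psi phi by move=> y b_y; rewrite /psi subrK.
have ba k : inbox al2 be2 (a 0 k) by exact: ga.2.
pose sK y := \sum_k sgn R k * (K y (a 0 k) * G (a 0 k)).
have lsK' k : lip1 al2 be2 (fun y => (sgn R k * G (a 0 k)) * K y (a 0 k)).
  by apply: lipMM; [exact: lipM_cst|exact: (lip2_col lK2 (ba k))].
pose psi1 y := f1 y + (- u * A y + - 1 * \sum_k (sgn R k * G (a 0 k)) * K y (a 0 k)).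
have lsum : lip1 al2 be2 (fun y => \sum_k (sgn R k * G (a 0 k)) * K y (a 0 k)).
  by apply: lipM_sum => k; exact: lsK'.
have lf12 : lip1 al2 be2 f1 by exact: lip1_sub lf1.
have luA : lip1 al2 be2 (fun y => - u * A y) by apply: lipMM => //; exact: lipM_cst.
have lsum' : lip1 al2 be2 (fun y => - 1 * \sum_k (sgn R k * G (a 0 k)) * K y (a 0 k)).
  by apply: lipMM => //; exact: lipM_cst.
have lrest := lipMD luA lsum'.
have lpsi1 : lip1 al2 be2 psi1 by exact: (lipMD lf12 lrest).
have bound y : inbox al2 be2 y -> `|psi y - h * psi1 y| <= C1 * h ^+ 2.
  move=> b_y; have byh := shift_box _ b_y; have b0 := sub b_y.
  (* Evaluated at z - h, [F] pairs K(y, z - h) with G(z), which the shift identity compares with K(y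
     + h, z) G(z). *)
  pose F z := K y z * G (z + h).
  have lKy1 : lip1 al1 be1 (K y) by apply: lip1_sub (lip2_row lK b0); lra.
  have lGh1 : lip1 al1 be1 (fun z => G (z + h)) by apply: lip1_shift lG; lra.
  have lF1 : lip1 al1 be1 F by exact: lipMM.
  have box1z z : inbox al1 be1 z -> inbox al be z /\ inbox al be (z + h).
    by move=> /andP[h1 h2]; split; apply/andP; split; lra.
  have FL z z' : inbox al1 be1 z -> inbox al1 be1 z' -> `|F z - F z'| <= LF * `|z - z'|.
    move=> /box1z[bz bzh] /box1z[bz' bzh'].
    have -> : F z - F z' = (K y z - K y z') * G (z + h) + K y z' * (G (z + h) - G (z' + h)).
      by rewrite /F; ring.
    apply: le_trans (ler_normD _ _) _; rewrite !normrM /LF mulrDl; apply: lerD.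
      rewrite mulrAC; apply: ler_pM => //; last exact: GB.
      apply: le_trans (KL (y, z) (y, z') _ _) _ => //=.
      by rewrite subrr normr0 add0r.
    rewrite -mulrA; apply: ler_pM => //; first exact: (KB (y, z')).
    apply: le_trans (GL _ _ bzh bzh') _.
    by rewrite /= opprD addrACA subrr addr0.
  have t3 := Tint_translate hr lF1 LF0 FL.
  have lKy2 : lip1 al2 be2 (K y) by exact: lip2_row.
  have lKyh : lip1 al2 be2 (K (y + h)) by exact: (lip1_sub aa bb (lip2_row lK byh)).
  have lKy_h : lip1 al2 be2 (fun z => K y (z - h)) by apply: lip1_shift (lip2_row lK b0); lra.
  have lF2 : lip1 al2 be2 (fun z => F (z - h)) by apply: lip1_shift lF1; lra.
  have lFz : lip1 al2 be2 F by apply: lip1_sub lF1; lra.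
  have psiE : psi y = f (y + h) - f y + (T (fun z => K (y + h) z * G z) - T F).
    rewrite /psi /phi sG // (sG y) //.
    have -> : T (fun z => K y z * phi z) = T F - T (fun z => K y z * G z).
      rewrite -(bfunB bT2) //; last exact: lipMM.
      by congr T; apply/funext => z; rewrite /F /phi mulrBr.
    move: (f (y + h)) (f y) (T (fun z => K (y + h) z * G z)) (T F).
    move: (T (fun z => K y z * G z)) => r1 r2 r3 r4 r5; ring.
  have t2 : `|T (fun z => K (y + h) z * G z) - T (fun z => F (z - h)) + h * (A y * u)|
     <= V * (CK * MG) * h ^+ 2.
    have lAG : lip1 al2 be2 (fun z => A z * G z) by exact: lipMM.
    have lAG' : lip1 al2 be2 (fun z => (h * A y) * (A z * G z)) by apply: lipMM => //; exact: lipM_cst.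
    have lKG : lip1 al2 be2 (fun z => K (y + h) z * G z) by exact: lipMM.
    rewrite mulrA /u -(bfunZ bT2) // -(bfunB bT2) // -(bfunD bT2) //; last exact: lipMB.
    rewrite -mulrA; apply: (bfun_le bT2) => [|z bz].
      by apply: lipMD => //; exact: lipMB.
    have -> : K (y + h) z * G z - F (z - h) + h * A y * (A z * G z) =
      (K (y + h) z - K y (z - h) + h * (A y * A z)) * G z.
      by rewrite /F subrK; ring.
    rewrite normrM mulrAC; apply: ler_pM => //; first exact: Kshift.
    by apply: GB; exact: sub.
  have t4 : `|h * \sum_k sgn R k * (K y (a 0 k) * (G (a 0 k + h) - G (a 0 k)))|
     <= (m.*2)%:R * (MK * MG) * h ^+ 2.
    rewrite normrM.
    apply: (@le_trans _ _ (`|h| * ((m.*2)%:R * (MK * (MG * `|h|))))).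
      apply: ler_wpM2l => //; apply: norm_sum_sgn => k; rewrite normrM.
      have bk := sub (ba k); have bkh := shift_box _ (ba k).
      apply: ler_pM => //; first exact: (KB (y, a 0 k)).
      apply: le_trans (GL _ _ bkh bk) _.
      by rewrite /= (addrAC _ h) subrr add0r.
    by rewrite -(real_normK (num_real h)) le_eqVlt; apply/orP; left; apply/eqP; ring.
  have -> : psi y - h * psi1 y =
    (f (y + h) - f y - h * f1 y) +
    (T (fun z => K (y + h) z * G z) - T (fun z => F (z - h)) + h * (A y * u)) +
    (T (fun z => F (z - h)) - T F + h * \sum_k sgn R k * F (a 0 k)) -
    h * \sum_k sgn R k * (K y (a 0 k) * (G (a 0 k + h) - G (a 0 k))).
    rewrite psiE /psi1.
    have -> : \sum_k sgn R k * (K y (a 0 k) * (G (a 0 k + h) - G (a 0 k))) =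
      \sum_k sgn R k * F (a 0 k) - \sum_k (sgn R k * G (a 0 k)) * K y (a 0 k).
      by rewrite -sumrB; apply: eq_bigr => k _; rewrite /F; ring.
    move: (f (y + h)) (f y) (f1 y) (A y) (u) (T (fun z => K (y + h) z * G z)).
    move: (T (fun z => F (z - h))) (T F) (\sum_k sgn R k * F (a 0 k)).
    move: (\sum_k (sgn R k * G (a 0 k)) * K y (a 0 k)).
    by move=> r1 r2 r3 r4 r5 r6 r7 r8 r9 r10; ring.
  have t1 := fC h y hr b_y.
  rewrite /C1 !mulrDl; apply: le_trans (ler_normB _ _) _; apply: lerD => //.
  apply: le_trans (ler_normD _ _) _; apply: lerD; last by rewrite -mulrA.
  by apply: le_trans (ler_normD _ _) _; apply: lerD.
move=> bx; have bx0 := sub bx.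
have phiE : phi x = resf T S psi x by exact: (solf_resf hab2 dT2 rS2 lpsi lphi spsi bx).
have psi1E : resf T S psi1 x = resf T S f1 x - u * resf T S A x
    - \sum_k sgn R k * (S x (a 0 k) * G (a 0 k)).
  rewrite /psi1 (resfD hab2 dT2 rS2) // (resfD hab2 dT2 rS2) //.
  rewrite (resfZ hab2 dT2 rS2) // (resfZ hab2 dT2 rS2) //.
  rewrite (resf_sum hab2 dT2 rS2) //.
  have -> : \sum_k resf T S (fun y => (sgn R k * G (a 0 k)) * K y (a 0 k)) x =
      \sum_k sgn R k * (S x (a 0 k) * G (a 0 k)).
    apply: eq_bigr => k _; rewrite (resfZ hab2 dT2 rS2) //; last exact: lip2_col.
    by rewrite (resf_col rS2) //; ring.
  ring.
rewrite -psi1E -/(phi x) phiE.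
have lh1 : lip1 al2 be2 (fun y => h * psi1 y) by apply: lipMM => //; exact: lipM_cst.
rewrite -(resfZ hab2 dT2 rS2) //.
have lSx : lip1 al2 be2 (S x) by exact: lip2_row.
have -> : resf T S psi x - resf T S (fun y => h * psi1 y) x =
   (psi x - h * psi1 x) + (T (fun z => S x z * psi z) - T (fun z => S x z * (h * psi1 z))).
  by rewrite /resf; ring.
rewrite mulrDl; apply: le_trans (ler_normD _ _) _; apply: lerD; first exact: bound.
rewrite -mulrA; apply: (bfun_dist bT2); try exact: lipMM.
move=> z bz; rewrite -mulrBr normrM -mulrA; apply: ler_pM => //; last exact: bound.
by apply: (SB (x, z)); split=> //=; exact: sub.
Qed.

End Translation.

(** * The Airy kernel *)

Section DifferentiableFunctions.
Context (R : realType).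
Implicit Types (f : R -> R).

Lemma is_derive_continuous f f' : (forall x, is_derive x (1 : R) f (f' x)) ->
  forall a b, {within `[a, b], continuous f}.
Proof. by move=> df a b; apply: derivable_within_continuous => x _; exact: ex_derive. Qed.

Lemma mean_value f f' : (forall x, is_derive x (1 : R) f (f' x)) -> forall x h,
  exists2 xi, (x <= xi <= x + h) || (x + h <= xi <= x) & f (x + h) - f x = h * f' xi.
Proof.
move=> df x h; have [h0|h0] := leP 0 h.
  have xh : x <= x + h by rewrite lerDl.
  have [xi xiP E] := MVT_segment xh (fun y _ => df y) (@is_derive_continuous _ _ df _ _).
  exists xi; first by move: xiP; rewrite in_itv /= => ->.
  by rewrite E mulrC (addrAC x) subrr add0r.
have xh : x + h <= x by rewrite gerDl ltW.
have [xi xiP E] := MVT_segment xh (fun y _ => df y) (@is_derive_continuous _ _ df _ _).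
exists xi; first by move: xiP; rewrite in_itv /= => ->; rewrite orbT.
by rewrite -opprB E mulrC -mulNr; congr (_ * _); rewrite opprB (addrAC x) subrr add0r.
Qed.

Lemma between_inbox (al be x y xi : R) : inbox al be x -> inbox al be y ->
  (x <= xi <= y) || (y <= xi <= x) -> inbox al be xi.
Proof. by move=> /andP[h1 h2] /andP[h3 h4] /orP[] /andP[h5 h6]; apply/andP; split; lra. Qed.

Lemma between_dist (x h xi : R) : (x <= xi <= x + h) || (x + h <= xi <= x) -> `|xi - x| <= `|h|.
Proof.
move=> /orP[] /andP[h1 h2].
  by rewrite ger0_norm ?subr_ge0 // (le_trans _ (ler_norm h)) //; lra.
rewrite -normrN -(normrN h) ger0_norm; last by lra.
by apply: le_trans _ (ler_norm (- h)); lra.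
Qed.

Lemma lip1_derive (al be : R) f f' : al <= be -> (forall x, is_derive x (1 : R) f (f' x)) ->
  {within `[al, be], continuous f'} -> lip1 al be f.
Proof.
move=> ab df cf'.
have [c _ cM] := EVT_max ab cf'; have [d _ dM] := EVT_min ab cf'.
pose L := `|f' c| + `|f' d|.
have L0 : 0 <= L by rewrite addr_ge0.
have bL x : inbox al be x -> `|f' x| <= L.
  move=> bx; have xi : x \in `[al, be] by rewrite in_itv.
  have := cM x xi; have := dM x xi; rewrite ler_norml /L.
  have := ler_norm (f' c); have := ler_norm (- f' d); rewrite normrN.
  have := normr_ge0 (f' c); have := normr_ge0 (f' d); lra.
apply: (Lip_lip1 ab L0) => x x' bx bx'.
have [xi xiP E] := mean_value df x' (x - x').
have e : x' + (x - x') = x by rewrite addrC subrK.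
rewrite e in E xiP; rewrite E normrM mulrC; apply: ler_wpM2r => //.
exact: bL (between_inbox bx' bx xiP).
Qed.

Lemma derive_quad (al be : R) f f' L : (forall x, is_derive x (1 : R) f (f' x)) -> 0 <= L ->
  (forall x x', inbox al be x -> inbox al be x' -> `|f' x - f' x'| <= L * `|x - x'|) ->
  forall x h, inbox al be x -> inbox al be (x + h) ->
    `|f (x + h) - f x - h * f' x| <= L * h ^+ 2.
Proof.
move=> df L0 f'L x h bx bxh; have [xi xiP ->] := mean_value df x h.
rewrite -mulrBr normrM -(real_normK (num_real h)) expr2 mulrCA.
apply: ler_wpM2l => //; apply: le_trans (f'L _ _ (between_inbox bx bxh xiP) bx) _.
by apply: ler_wpM2l => //; exact: between_dist.
Qed.

(* The divided difference (f y - f x) / (y - x), extended by f' to the diagonal. *)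
Definition ddiff (f' : R -> R) (x y : R) : R := prim 0 (fun t => f' (x + t * (y - x))) 1.

Section DividedDifference.
Context (al be : R) (f f' : R -> R) (hab : al <= be).
Hypotheses (df : forall x, is_derive x (1 : R) f (f' x)) (lf' : lip1 al be f').

Lemma inbox_segment x y t : inbox al be x -> inbox al be y -> inbox 0 1 t ->
  inbox al be (x + t * (y - x)).
Proof.
move=> /andP[h1 h2] /andP[h3 h4] /andP[t0 t1].
have -> : x + t * (y - x) = (1 - t) * x + t * y by ring.
have t1' : 0 <= 1 - t by rewrite subr_ge0.
apply/andP; split.
  have := ler_wpM2l t1' h1; have := ler_wpM2l t0 h3; lra.
have := ler_wpM2l t1' h2; have := ler_wpM2l t0 h4; lra.
Qed.

Lemma lip1_segment x y : inbox al be x -> inbox al be y ->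
  lip1 0 1 (fun t => f' (x + t * (y - x))).
Proof.
move=> bx b_y; have [C [C0 Cb Cl]] := lf'.
have d0 : 0 <= C * `|y - x| by rewrite mulr_ge0.
apply: (Lip_lip1 ler01 d0) => t t' bt bt'.
apply: le_trans (Cl _ _ (inbox_segment bx b_y bt) (inbox_segment bx b_y bt')) _.
rewrite -mulrA; apply: ler_wpM2l => //=.
by rewrite opprD addrACA subrr add0r -mulrBl normrM mulrC.
Qed.

(** Along the segment from x to y, [f] minus (y - x) times the primitive of [f'] changes only to
    second order, hence is constant. *)
Lemma ddiffE x y : inbox al be x -> inbox al be y -> (y - x) * ddiff f' x y = f y - f x.
Proof.
move=> bx b_y; have lg := lip1_segment bx b_y.
pose g t := f' (x + t * (y - x)).
have [C [C0 Cb Cl]] := lf'; have [L [L0 _ gL]] := lg.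
pose D t := f (x + t * (y - x)) - (y - x) * prim 0 g t.
suff : D 1 = D 0.
  have e : x + (y - x) = y by rewrite addrC subrK.
  by rewrite /D mul1r mul0r addr0 e prim_al mulr0 subr0 => <-; rewrite opprB [RHS]addrC subrK.
apply: (quad_const (C := C * (y - x) ^+ 2 + `|y - x| * L) ler01) => s t s0 st t1.
have bs : inbox 0 1 s by apply/andP; split; lra.
have bt : inbox 0 1 t by apply/andP; split; lra.
have q1 := prim_quad lg bs bt L0 gL.
have e : x + s * (y - x) + (t - s) * (y - x) = x + t * (y - x) by ring.
have bs' := inbox_segment bx b_y bs.
have bt' : inbox al be (x + s * (y - x) + (t - s) * (y - x)).
  by rewrite e; exact: inbox_segment.
have := derive_quad df C0 Cl bs' bt'; rewrite e => q2.
have -> : D t - D s =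
  (f (x + t * (y - x)) - f (x + s * (y - x)) - (t - s) * (y - x) * f' (x + s * (y - x))) -
  (y - x) * (prim 0 g t - prim 0 g s - (t - s) * g s) by rewrite /D /g; ring.
apply: le_trans (ler_normB _ _) _; rewrite [leRHS]mulrDl; apply: lerD.
  by apply: le_trans q2 _; rewrite le_eqVlt; apply/orP; left; apply/eqP; ring.
by rewrite normrM -mulrA; apply: ler_wpM2l.
Qed.

Lemma ddiff_diag x : inbox al be x -> ddiff f' x x = f' x.
Proof.
move=> bx; rewrite /ddiff.
have -> : (fun t => f' (x + t * (x - x))) = (fun=> f' x).
  by apply/funext => t; rewrite subrr mulr0 addr0.
have := @prim_est R 0 1 (fun=> f' x) 0 1 (f' x) 0 (lipM_cst _ _) (lexx _) ler01 (lexx _).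
rewrite subr0 !mulr1 prim_al subr0 => H.
apply/eqP; rewrite -subr_eq0 -normr_le0; apply: H => t _ _.
by rewrite subrr normr0.
Qed.

Lemma lip2_ddiff : lip2 al be (ddiff f').
Proof.
have [C [C0 Cb Cl]] := lf'.
have b1 : inbox 0 1 (1 : R) by rewrite /inbox ler01 lexx.
have bP := disc_bfun ler01 (disc_prim ler01 b1).
exists C; split=> // [[x y] [/= bx b_y]|[x y] [x' y'] [/= bx b_y] [/= bx' b_y']].
  have := bfun_le bP (lip1_segment bx b_y) (B := C).
  by rewrite subr0 mul1r; apply => t bt; apply: Cb; exact: inbox_segment.
have := bfun_dist bP (lip1_segment bx b_y) (lip1_segment bx' b_y')
  (B := C * (`|x - x'| + `|y - y'|)).
rewrite subr0 mul1r; apply => t bt.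
apply: le_trans (Cl _ _ (inbox_segment bx b_y bt) (inbox_segment bx' b_y' bt)) _ => /=.
apply: ler_wpM2l => //; have /andP[t0 t1] := bt.
have -> : x + t * (y - x) - (x' + t * (y' - x')) = (1 - t) * (x - x') + t * (y - y') by ring.
have t1' : 0 <= 1 - t by rewrite subr_ge0.
apply: le_trans (ler_normD _ _) _; rewrite !normrM (ger0_norm t0) (ger0_norm t1').
by apply: lerD; apply: ler_piMl => //; lra.
Qed.

End DividedDifference.

End DifferentiableFunctions.

Section AiryKernel.
Context (R : realType) (A : R -> R).
Local Notation A1 := (derive1 A).
Hypotheses (dA : forall x, is_derive x (1 : R) A (A1 x))
  (dA1 : forall x, is_derive x (1 : R) A1 (x * A x)).
Local Notation K := (airy_kernel A).

Lemma lip1_A al be : al <= be -> lip1 al be A.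
Proof. by move=> ab; apply: (lip1_derive ab dA); exact: (is_derive_continuous dA1). Qed.

Lemma lip1_A1 al be : al <= be -> lip1 al be A1.
Proof.
move=> ab; apply: (lip1_derive ab dA1); apply: lip1_continuous.
by apply: (lipMM (lip1_id _ _)); exact: lip1_A.
Qed.

Lemma lip1_A2 al be : al <= be -> lip1 al be (fun x => x * A x).
Proof. by move=> ab; apply: (lipMM (lip1_id _ _)); exact: lip1_A. Qed.

(* A(x) A'(y) - A'(x) A(y) over x - y, with the difference quotients of A and A' in
   y - x replaced by divided differences, so that it is Lipschitz across x = y. *)
Definition Kdd x y : R := A1 x * ddiff A1 x y - A x * ddiff (fun x => x * A x) x y.

Lemma lip2_Kdd al be : al <= be -> lip2 al be Kdd.
Proof.
move=> ab; apply: lipMB.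
  by apply: lipMM; [exact: (lip2_fst (lip1_A1 ab))|exact: (lip2_ddiff (lip1_A1 ab))].
by apply: lipMM; [exact: (lip2_fst (lip1_A ab))|exact: (lip2_ddiff (lip1_A2 ab))].
Qed.

Lemma Kdd_neq x y : x != y -> Kdd x y = (A x * A1 y - A1 x * A y) / (x - y).
Proof.
move=> xy; pose al := Num.min x y; pose be := Num.max x y.
have ab : al <= be by rewrite /al /be ge_min le_max lexx.
have bx : inbox al be x by rewrite /inbox /al /be ge_min le_max lexx.
have b_y : inbox al be y by rewrite /inbox /al /be ge_min le_max lexx !orbT.
have d1 := ddiffE dA (lip1_A1 ab) bx b_y.
have d2 := ddiffE dA1 (lip1_A2 ab) bx b_y.
have xy0 : x - y != 0 by rewrite subr_eq0.
apply: (mulIf xy0); rewrite divfK // /Kdd.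
have -> : A1 y = A1 x + (y - x) * ddiff (fun x => x * A x) x y by rewrite d2 addrC subrK.
have -> : A y = A x + (y - x) * ddiff A1 x y by rewrite d1 addrC subrK.
ring.
Qed.

Lemma Kdd_diag x : Kdd x x = A1 x ^+ 2 - x * A x ^+ 2.
Proof.
have bx : inbox x x x by rewrite /inbox lexx.
rewrite /Kdd !(ddiff_diag _ bx); ring.
Qed.

Lemma airy_kernelE x y : K x y = Kdd x y.
Proof.
rewrite /airy_kernel; case: eqVneq => [<-{y}|xy]; last by rewrite Kdd_neq.
apply/cvg_lim => //.
have ab : x - 1 <= x + 1 by lra.
have bx : inbox (x - 1) (x + 1) x by apply/andP; split; lra.
have [C [C0 _ Cl]] := lip2_row (lip2_Kdd ab) bx.
have C1 : 0 < C + 1 by rewrite ltr_wpDl.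
apply/cvgrPdist_lt => e e0.
have d0 : 0 < Num.min 1 (e / (C + 1)) by rewrite lt_min ltr01 divr_gt0.
exists (Num.min 1 (e / (C + 1))) => // z /=; rewrite lt_min => /andP[xz1 xz2] zx.
have xz : x != z by rewrite eq_sym.
rewrite -(Kdd_neq xz).
have bz : inbox (x - 1) (x + 1) z.
  by move: xz1; rewrite ltr_norml => /andP[h1 h2]; apply/andP; split; lra.
apply: le_lt_trans (Cl x z bx bz) _ => /=.
move: xz2; rewrite ltr_pdivlMr // mulrC; apply: le_lt_trans.
by apply: ler_wpM2r => //; rewrite lerDl.
Qed.

Lemma lip2_airy al be : al <= be -> lip2 al be K.
Proof. by move=> ab; apply: eq_lipM (lip2_Kdd ab) => z _; rewrite airy_kernelE. Qed.

Lemma airy_sym x y : K x y = K y x.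
Proof.
have [->//|xy] := eqVneq x y.
have yx : y != x by rewrite eq_sym.
have xy0 : x - y != 0 by rewrite subr_eq0.
rewrite !airy_kernelE (Kdd_neq xy) (Kdd_neq yx) -(opprB x y) invrN mulrN -mulNr.
by congr (_ / _); ring.
Qed.

Lemma airy_comm x y : (x - y) * K x y = A x * A1 y - A1 x * A y.
Proof.
have [->|xy] := eqVneq x y; first by rewrite subrr mul0r mulrC subrr.
by rewrite airy_kernelE Kdd_neq // mulrC divfK // subr_eq0.
Qed.

Lemma derive_shift (f f' : R -> R) (c t : R) : (forall x, is_derive x (1 : R) f (f' x)) ->
  is_derive t (1 : R) (fun s => f (c + s)) (f' (c + t)).
Proof.
move=> df; have -> : (fun s => f (c + s)) = f \o shift c by apply/funext => s; rewrite /= addrC.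
rewrite -[f' _]mulr1; have d1 := is_derive_shift t (1 : R) c.
have d2 : is_derive (shift c t) (1 : R) f (f' (c + t)) by rewrite /shift addrC; exact: df.
exact: is_derive1_comp.
Qed.

(** In this direction x - y stays constant, so off the diagonal only the numerator is
    differentiated, and Airy's equation turns its derivative into (y - x) A A. On the diagonal the
    closed form of K is used. *)
Lemma airy_kernel_diag_derive x y t :
  is_derive t (1 : R) (fun s => K (x + s) (y + s)) (- (A (x + t) * A (y + t))).
Proof.
have dx := derive_shift x t dA; have dx1 := derive_shift x t dA1.
have dy := derive_shift y t dA; have dy1 := derive_shift y t dA1.
have [xy|xy] := eqVneq x y.
  have -> : (fun s => K (x + s) (y + s)) =
     (fun s => A1 (x + s)) * (fun s => A1 (x + s)) -
     (fun s => x + s) * ((fun s => A (x + s)) * (fun s => A (x + s))).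
    by apply/funext => s; rewrite xy airy_kernelE Kdd_diag -!expr2.
  have d0 := derive_shift x t (fun x => is_derive_id x (1 : R)).
  have D := is_deriveB (is_deriveM dx1 dx1) (is_deriveM d0 (is_deriveM dx dx)).
  apply: is_derive_eq D _; rewrite -xy ?fctE /= /GRing.scale /=; ring.
have -> : (fun s => K (x + s) (y + s)) =
   (x - y)^-1 \*: ((fun s => A (x + s)) * (fun s => A1 (y + s)) -
     (fun s => A1 (x + s)) * (fun s => A (y + s))).
  apply/funext => s; rewrite airy_kernelE Kdd_neq; last by rewrite (inj_eq (addIr s)).
  by rewrite opprD addrACA subrr addr0 /= mulrC.
have D := is_deriveZ (x - y)^-1 (is_deriveB (is_deriveM dx dy1) (is_deriveM dx1 dy)).
apply: is_derive_eq D _; rewrite ?fctE /= /GRing.scale /=.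
have xy0 : x - y != 0 by rewrite subr_eq0.
by field.
Qed.

(* (d/dx + d/dy) K(x, y) = - A(x) A(y). *)
Lemma airy_shift al be : al <= be -> exists2 C, 0 <= C &
  forall h x z, inbox al be x -> inbox al be z -> inbox al be (x + h) -> inbox al be (z - h) ->
  `|K (x + h) z - K x (z - h) + h * (A x * A z)| <= C * h ^+ 2.
Proof.
move=> ab; have [C [C0 Cb Cl]] := lip1_A ab.
exists (C * C + C * C); first by rewrite addr_ge0 // mulr_ge0.
move=> h x z bx bz bxh bzh.
(* The path s |-> (x + s, z - h + s) joins the two points (x, z - h) and (x + h, z) at which K is
   compared. *)
have D t := airy_kernel_diag_derive x (z - h) t.
have [xi xiP] := mean_value D 0 h.
rewrite !add0r !addr0 subrK => ->.
rewrite mulrN addrC -mulrBr normrM.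
have bt : `|xi| <= `|h| by have := between_dist xiP; rewrite subr0.
have e0 : (x <= x + xi <= x + h) || (x + h <= x + xi <= x).
  move: xiP; rewrite add0r => /orP[] /andP[h1 h2]; apply/orP; [left|right]; apply/andP; split; lra.
have e1 : (z - h <= z - h + xi <= z) || (z <= z - h + xi <= z - h).
  move: xiP; rewrite add0r => /orP[] /andP[h1 h2]; apply/orP; [left|right]; apply/andP; split; lra.
have b1 := between_inbox bx bxh e0; have b2 := between_inbox bzh bz e1.
have d2 : `|z - (z - h + xi)| <= `|h|.
  have -> : z - (z - h + xi) = h - xi by ring.
  move: xiP; rewrite add0r => /orP[] /andP[h1 h2].
    by rewrite !ger0_norm; lra.
  by rewrite !ler0_norm; lra.
have -> : A x * A z - A (x + xi) * A (z - h + xi) =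
  (A x - A (x + xi)) * A z + A (x + xi) * (A z - A (z - h + xi)) by ring.
rewrite -(real_normK (num_real h)) expr2 mulrCA; apply: ler_wpM2l => //.
apply: le_trans (ler_normD _ _) _; rewrite !normrM mulrDl; apply: lerD.
  rewrite mulrAC; apply: ler_pM => //; last exact: Cb.
  apply: le_trans (Cl _ _ bx b1) _; apply: ler_wpM2l => //=.
  by rewrite opprD addrA subrr add0r normrN.
rewrite -mulrA; apply: ler_pM => //; first exact: Cb.
by apply: le_trans (Cl _ _ bz b2) _; apply: ler_wpM2l.
Qed.

End AiryKernel.

(** * Derivatives in the endpoints *)

Lemma is_derive_quad (R : realType) (m : nat) (F : 'rV[R]_(m.*2) -> R) a k d C del :
  0 < del -> (forall t, `|t| < del -> `|F (shiftJ a k t) - F a - t * d| <= C * t ^+ 2) ->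
  is_derive a (delta_mx 0 k) F d.
Proof.
move=> del0 FC.
have C0 : 0 <= C.
  have h : `|del / 2| < del by rewrite ger0_norm; lra.
  have := le_trans (normr_ge0 _) (FC _ h).
  by rewrite pmulr_lge0 // exprn_gt0 // divr_gt0.
have C1 : 0 < C + 1 by rewrite ltr_wpDl.
have lim : h^-1 *: ((F \o shift a) (h *: delta_mx 0 k) - F a) @[h --> 0^'] --> d.
  apply/cvgrPdist_lt => e e0.
  have d0 : 0 < Num.min del (e / (C + 1)) by rewrite lt_min del0 divr_gt0.
  exists (Num.min del (e / (C + 1))) => // t /=; rewrite sub0r normrN lt_min => /andP[t1 t2] t0.
  have := FC t t1; rewrite /shiftJ; set v := F _ - F a => vE.
  have -> : d - t^-1 *: v = - (t^-1 * (v - t * d)).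
    by rewrite /GRing.scale /=; field.
  rewrite normrN normrM normfV.
  have nt0 : 0 < `|t| by rewrite normr_gt0.
  rewrite mulrC ltr_pdivrMr //; apply: le_lt_trans vE _.
  rewrite -(real_normK (num_real t)) expr2 mulrA ltr_pM2r //.
  move: t2; rewrite ltr_pdivlMr // mulrC; apply: le_lt_trans.
  by apply: ler_wpM2r => //; rewrite lerDl.
by split; [exact: cvgP lim|exact: cvg_lim lim].
Qed.

Lemma iter_intE (R : realType) (J : set R) n F :
  iter_int J n F = iterT (fun f => \int[@lebesgue_measure R]_(x in J) f x) n F.
Proof. by elim: n F => [//|n IHn] F /=; congr Rintegral; apply/funext => x; rewrite IHn. Qed.

Lemma fredholm_detE (R : realType) (J : set R) K :
  fredholm_det J K =
  limn (series (fredholm_coef (fun f => \int[@lebesgue_measure R]_(x in J) f x) K)).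
Proof.
rewrite /fredholm_det; congr (limn (series _)); apply/funext => n.
by rewrite /fredholm_coef iter_intE.
Qed.

(** The parity of [j] tells whether [a 0 j] is the left or the right end of the interval with index
    [j./2]. *)
Lemma endpoint_closure (R : realType) m (a : 'rV[R]_(m.*2)) :
  (forall i j : 'I_(m.*2), (i < j)%N -> a 0 i < a 0 j) ->
  forall j, closure (intervals a) (a 0 j).
Proof.
move=> sa j.
have jm : (j./2 < m)%N by rewrite ltn_half_double.
pose i := Ordinal jm; set l := Ordinal (left_subproof i); set r := Ordinal (right_subproof i).
have lr : a 0 l < a 0 r by apply: sa.
have jlr : j = l \/ j = r.
  have := odd_double_half j; case: (odd j) => /= e; [right|left]; apply: val_inj => /=.
    by rewrite -[LHS]e add1n.
  by rewrite -[LHS]e add0n.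
have mem x : a 0 l < x -> x < a 0 r -> intervals a x.
  by move=> h1 h2; exists i => //=; rewrite in_itv /= h1 h2.
move=> B /nbhs_ballP[e /= e0 eB].
pose s := Num.min (e / 2) ((a 0 r - a 0 l) / 2).
have s0 : 0 < s by rewrite lt_min !divr_gt0 // subr_gt0.
have se : s < e by rewrite gt_min; apply/orP; left; lra.
have sr : s < a 0 r - a 0 l by rewrite gt_min; apply/orP; right; lra.
case: jlr => jE; rewrite jE in eB.
  exists (a 0 l + s); split; first by apply: mem; lra.
  by apply: eB; rewrite /ball /= opprD addrA subrr add0r normrN ger0_norm // ltW.
exists (a 0 r - s); split; first by apply: mem; lra.
by apply: eB; rewrite /ball /= opprB addrC subrK ger0_norm // ltW.
Qed.

Lemma shiftJ0 (R : realType) m (a : 'rV[R]_(m.*2)) k : shiftJ a k 0 = a.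
Proof. by rewrite /shiftJ scale0r add0r. Qed.

(** The radius is the smallest gap between endpoints, capped at 1: a single moving endpoint then
    cannot reach another one, and the margin 1 keeps it in the box. *)
Lemma shiftJ_sorted (R : realType) m (a : 'rV[R]_(m.*2)) al be :
  sorted_in (al + 1) (be - 1) a ->
  exists2 d, 0 < d & forall k t, `|t| < d -> sorted_in al be (shiftJ a k t).
Proof.
move=> [sa ba].
pose g := \big[Num.min/1]_(p : 'I_(m.*2) * 'I_(m.*2) | (p.1 < p.2)%N) (a 0 p.2 - a 0 p.1).
have g0 : 0 < g.
  by apply: lt_bigmin => // p pp; rewrite subr_gt0; exact: sa.
have g1 : g <= 1 by exact: bigmin_le_id.
have gP (i j : 'I_(m.*2)) : (i < j)%N -> g <= a 0 j - a 0 i.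
  by move=> ij; exact: (bigmin_le_cond _ (fun p => a 0 p.2 - a 0 p.1) (j := (i, j)) ij).
exists g => // k t tg; move: (tg); rewrite ltr_norml => /andP[t1 t2].
split=> [i j ij|j].
  have := gP i j ij; rewrite !shiftJE.
  case: (eqVneq i k) (eqVneq j k) ij => [->|ik] [->|jk]; rewrite ?ltnn //; lra.
have /andP[h1 h2] := ba j; rewrite shiftJE; case: ifP => _; apply/andP; split; lra.
Qed.

Section Perturbation.
Context (R : realType) (al be : R) (m : nat) (a : 'rV[R]_(m.*2)).
Hypotheses (hab : al <= be) (ga1 : sorted_in (al + 1) (be - 1) a).
Local Notation inbox := (inbox al be).
Local Notation lip1 := (lip1 al be).
Local Notation lip2 := (lip2 al be).
Local Notation T := (Tint a).
Hypothesis ga : sorted_in al be a.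
Let dT := disc_Tint hab ga.
Let bT := disc_bfun hab dT.
Context (K S : R -> R -> R) (rS : resolv al be T K S).
Let lK := resolvK rS.
Let lS := resolvS rS.

Lemma kernel_mul_Lip k f : lip2 k -> lip1 f -> exists2 L, 0 <= L &
  forall x, inbox x -> lip1 (fun z => k x z * f z) /\
    forall z z', inbox z -> inbox z' -> `|k x z * f z - k x z' * f z'| <= L * `|z - z'|.
Proof.
move=> lk lf; have lF : lip2 (fun x z => k x z * f z).
  by apply: lipMM => //; exact: (lip2_snd lf).
have [L [L0 _ Ll]] := lF; exists L => // x bx.
split; first by apply: lipMM => //; exact: lip2_row.
move=> z z' bz bz'; apply: le_trans (Ll (x, z) (x, z') _ _) _ => //=.
by rewrite subrr normr0 add0r.
Qed.

(* For small t the continuous solution g for the endpoint a_k moved to a_k + t is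
   the fixed point of g = G + S (T' - T) g, hence G + t sgn_k S(., a_k) G(a_k) + O(t^2). *)
Lemma inv_ImK_shift f : lip1 f -> exists C d, [/\ 0 <= C, 0 < d & forall k t, `|t| < d ->
  sorted_in al be (shiftJ a k t) /\ exists g, [/\ lip1 g,
    forall x, closure (intervals (shiftJ a k t)) x ->
      inv_ImK (intervals (shiftJ a k t)) K f x = g x,
    forall x, inbox x -> `|g x - resf T S f x| <= C * `|t| &
    forall x, inbox x -> `|g x - resf T S f x
      - t * (sgn R k * (S x (a 0 k) * resf T S f (a 0 k)))| <= C * t ^+ 2]].
Proof.
move=> lf; have [d0 d00 sd] := shiftJ_sorted ga1.
set G := resf T S f; have lG : lip1 G by exact: (lip1_resf bT lS lf).
have [M [M0 SM' _]] := lS; have [B [B0 GB _]] := lG.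
have SM x y : inbox x -> inbox y -> `|S x y| <= M by move=> bx b_y; exact: (SM' (x, y)).
have [L L0 LP] := kernel_mul_Lip lS lG.
(* [2 * B] bounds the perturbed solution for all admissible k and t, so C1 |t| bounds its distance
   from [G]. *)
pose C1 := M * (2 * B); have C10 : 0 <= C1 by rewrite !mulr_ge0.
pose C := C1 + (M * C1 + L).
have MC0 : 0 <= M * C1 by rewrite mulr_ge0.
have M1 : 0 < 2 * (M + 1) by rewrite mulr_gt0 // ltr_wpDl.
(* The second radius ensures the contraction condition |t| M <= 1/2; [M + 1] avoids a division by
   0. *)
exists C, (Num.min d0 (2 * (M + 1))^-1); split.
- by rewrite !addr_ge0.
- by rewrite lt_min d00 invr_gt0.
move=> k t; rewrite lt_min => /andP[td0 tM]; have ga' := sd k t td0; split=> //.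
have bU := bfun_Ushift hab ga ga'; set U := Ushift al a k t in bU.
have hM : `|t| * M <= 2^-1.
  have h1 : `|t| * (2 * (M + 1)) <= 1.
    by rewrite -ler_pdivlMr // mul1r ltW.
  have := normr_ge0 t; lra.
have [g lg gE] := picard_exists bU lS SM hM lG.
have gB := picard_bound hab bU lS SM hM lg GB gE.
have T'E h : lip1 h -> Tint (shiftJ a k t) h = T h + U h by exact: Tint_shift.
have sg : solf al be (Tint (shiftJ a k t)) K f g.
  by apply/(solf_perturb hab dT rS bU T'E lf lg).
have mJ : measurable (intervals (shiftJ a k t)) by exact: measurable_intervals.
have oJ : open (intervals (shiftJ a k t)) by exact: open_intervals.
have Jb x : intervals (shiftJ a k t) x -> inbox x by exact: intervals_inbox.
have gG x : inbox x -> `|g x - G x| <= C1 * `|t|.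
  move=> bx; rewrite gE // addrC addKr.
  by have := picard_step bU lS SM lg gB bx; rewrite /C1 -mulrA mulrC.
exists g; split=> //.
- apply: (inv_ImK_unique hab mJ oJ Jb lK lf lg sg) => h lh sh.
  have hE := (solf_perturb hab dT rS bU T'E lf lh).1 sh.
  exact: (picard_unique hab bU lS SM hM lh lg hE gE).
- move=> x bx; apply: le_trans (gG x bx) _; apply: ler_wpM2r => //.
  by rewrite lerDl addr_ge0.
move=> x bx; have [lSG SGL] := LP x bx; have lSx := lip2_row lS bx.
have -> : g x - G x - t * (sgn R k * (S x (a 0 k) * G (a 0 k))) =
  (U (fun z => S x z * g z) - U (fun z => S x z * G z)) +
  (U (fun z => S x z * G z) - sgn R k * (t * (S x (a 0 k) * G (a 0 k)))).
  by rewrite gE //; ring.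
have u1 := Ushift_quad ga ga' lSG L0 SGL.
have u2 : `|U (fun z => S x z * g z) - U (fun z => S x z * G z)| <= `|t| * (M * (C1 * `|t|)).
  apply: (bfun_dist bU); try exact: lipMM.
  move=> z bz; rewrite -mulrBr normrM; apply: ler_pM => //; [exact: SM|exact: gG].
apply: le_trans (ler_normD _ _) _; apply: (@le_trans _ _ ((M * C1 + L) * t ^+ 2)); last first.
  by apply: ler_wpM2r; [exact: sqr_ge0|rewrite lerDr].
rewrite mulrDl; apply: lerD => //; apply: le_trans u2 _.
by rewrite -(real_normK (num_real t)) le_eqVlt; apply/orP; left; apply/eqP; ring.
Qed.

Lemma fredholm_det_neq0 : fredholm_det (intervals a) K != 0.
Proof.
have := fredholm_inv hab dT rS; rewrite fredholm_detE => E.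
by apply/negP => /eqP E0; move: E; rewrite E0 mul0r => /esym/eqP; rewrite oner_eq0.
Qed.

Lemma fredholm_det_derive k : is_derive a (delta_mx 0 k) (fun b => fredholm_det (intervals b) K)
  (- sgn R k * S (a 0 k) (a 0 k) * fredholm_det (intervals a) K).
Proof.
have [d0 d00 sd] := shiftJ_sorted ga1.
have [M [M0 SM' _]] := lS.
have SM x y : inbox x -> inbox y -> `|S x y| <= M by move=> bx b_y; exact: (SM' (x, y)).
have lsd := lip2_diag lS; have [L [L0 _ Ll]] := lsd.
have M1 : 0 < 2 * (M + 1) by rewrite mulr_gt0 // ltr_wpDl.
set Da := fredholm_det (intervals a) K.
(* [Db] is the inverse of [Da], so an estimate for a product with [Db] is one for the ratio of the
   two determinants. *)
pose Db := limn (series (fredholm_coef T (fun x y => - S x y))).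
have DD : Da * Db = 1 by rewrite /Da fredholm_detE; exact: (fredholm_inv hab dT rS).
apply: (@is_derive_quad _ _ _ _ _ _ (`|Da| * (2 * M ^+ 2 + L)) (Num.min d0 (2 * (M + 1))^-1)).
  by rewrite lt_min d00 invr_gt0.
move=> t; rewrite lt_min => /andP[td0 tM]; have ga' := sd k t td0.
have hM : M * `|t| < 2^-1.
  have h1 : `|t| * (2 * (M + 1)) < 1.
    by rewrite -ltr_pdivlMr // mul1r.
  have := normr_ge0 t; lra.
have H := fredholm_mul hab dT (disc_Tint hab ga') rS (wJ_shift hab ga ga') SM hM.
move: H; rewrite -/Db (Tint_shift hab ga ga' lsd) (addrC (T _)) addrK.
have := Ushift_quad ga ga' lsd L0 Ll.
set U := Ushift _ _ _ _ _; rewrite -[limn _]fredholm_detE => u1 u2.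
set Dt := fredholm_det _ _ in u2 *; set s := S (a 0 k) (a 0 k) in u1 *.
have -> : Dt - Da - t * (- sgn R k * s * Da) =
  Da * ((Dt * Db - 1 + U) - (U - sgn R k * (t * s))).
  have -> : Dt = Dt * (Da * Db) by rewrite DD mulr1.
  by move: DD => /(congr1 (fun z => z * Da)); rewrite mul1r => DD; ring: DD.
rewrite normrM -mulrA; apply: ler_wpM2l => //.
apply: le_trans (ler_normB _ _) _; rewrite mulrDl; apply: lerD => //.
by apply: le_trans u2 _; rewrite exprMn real_normK ?num_real // mulrA.
Qed.

End Perturbation.

Section EndpointDerivatives.
Context (R : realType) (al be : R) (m : nat) (a : 'rV[R]_(m.*2)).
Hypotheses (hab : al <= be) (ga1 : sorted_in (al + 1) (be - 1) a).
Local Notation inbox := (inbox al be).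
Local Notation lip1 := (lip1 al be).
Local Notation T := (Tint a).
Hypothesis ga : sorted_in al be a.
Let dT := disc_Tint hab ga.
Let bT := disc_bfun hab dT.
Context (K S : R -> R -> R) (rS : resolv al be T K S).
Hypothesis Ssym : forall x y, inbox x -> inbox y -> S x y = S y x.
Let lS := resolvS rS.
Context (f : R -> R) (lf : lip1 f).
Local Notation G := (resf T S f).
Let lG : lip1 G. Proof. exact: (lip1_resf bT lS lf). Qed.

(** The shift estimate at t = 0. It needs an index to shift; if there is none, J is empty. *)
Lemma inv_ImK_resf x : closure (intervals a) x -> inv_ImK (intervals a) K f x = G x.
Proof.
move=> cx; have [C [d [C0 d0 H]]] := inv_ImK_shift hab ga1 ga rS lf.
have h0 : `|0 : R| < d by rewrite normr0.
have [[k _]|nk] := pselect (exists k : 'I_(m.*2), True); last first.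
  have : intervals a = set0.
    rewrite -subset0 => y [i _] _; apply: nk.
    by exists (Ordinal (left_subproof i)).
  by move=> e; move: cx; rewrite e closure0.
have bx : inbox x.
  by apply: (closure_inbox _ cx) => y; exact: intervals_inbox.
have [_ [g [_ gE gG _]]] := H k 0 h0; rewrite shiftJ0 in gE.
rewrite gE //; apply/eqP; rewrite -subr_eq0 -normr_le0.
by have := gG x bx; rewrite normr0 mulr0.
Qed.

Lemma inv_ImK_derive_neq j k : j != k ->
  is_derive a (delta_mx 0 k) (fun b : 'rV[R]_(m.*2) => inv_ImK (intervals b) K f (b 0 j))
    (sgn R k * (S (a 0 j) (a 0 k) * G (a 0 k))).
Proof.
move=> jk; have [C [d [C0 d0 H]]] := inv_ImK_shift hab ga1 ga rS lf.
apply: (is_derive_quad (C := C) d0) => t td.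
have [ga' [g [lg gE _ gG2]]] := H k t td.
have cj' := @endpoint_closure _ _ _ ga'.1 j.
have aj : shiftJ a k t 0 j = a 0 j by rewrite shiftJE (negPf jk) addr0.
rewrite gE // aj (inv_ImK_resf (@endpoint_closure _ _ _ ga.1 j)).
by apply: gG2; exact: ga.2.
Qed.

(** The endpoint moves both the set J and the point of evaluation; to first order the two effects
    add, [G1] being the derivative of [G] in its argument. *)
Lemma inv_ImK_derive_eq k G1 CG : 0 <= CG ->
  (forall t, `|t| <= 1 -> `|G (a 0 k + t) - G (a 0 k) - t * G1| <= CG * t ^+ 2) ->
  is_derive a (delta_mx 0 k) (fun b : 'rV[R]_(m.*2) => inv_ImK (intervals b) K f (b 0 k))
    (G1 + sgn R k * (S (a 0 k) (a 0 k) * G (a 0 k))).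
Proof.
move=> CG0 GQ; have [C [d [C0 d0 H]]] := inv_ImK_shift hab ga1 ga rS lf.
have [B [B0 GB _]] := lG; have [L [L0 _ SL]] := lS.
have bk : inbox (a 0 k) by exact: ga.2.
have dd : 0 < Num.min d 1 by rewrite lt_min d0 ltr01.
apply: (is_derive_quad (C := C + CG + L * B) dd) => t; rewrite lt_min => /andP[td t1].
have [ga' [g [lg gE _ gG2]]] := H k t td.
have ck' := @endpoint_closure _ _ _ ga'.1 k.
have ak : shiftJ a k t 0 k = a 0 k + t by rewrite shiftJE eqxx.
have bkt : inbox (a 0 k + t) by rewrite -ak; exact: ga'.2.
rewrite gE // ak (inv_ImK_resf (@endpoint_closure _ _ _ ga.1 k)).
have h1 := gG2 _ bkt; have h2 := GQ t (ltW t1).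
have h3 : `|t * (sgn R k * ((S (a 0 k + t) (a 0 k) - S (a 0 k) (a 0 k)) * G (a 0 k)))| <= L * B * t ^+ 2.
  rewrite !normrM normr_sgn mul1r -(real_normK (num_real t)) expr2.
  have -> : L * B * (`|t| * `|t|) = `|t| * ((L * `|t|) * B) by ring.
  apply: ler_wpM2l => //; apply: ler_pM => //; last exact: GB.
  have := SL (a 0 k + t, a 0 k) (a 0 k, a 0 k) (conj bkt bk) (conj bk bk).
  by rewrite /= (addrAC _ t) !subrr add0r normr0 addr0.
have -> : g (a 0 k + t) - G (a 0 k) - t * (G1 + sgn R k * (S (a 0 k) (a 0 k) * G (a 0 k))) =
  (g (a 0 k + t) - G (a 0 k + t) - t * (sgn R k * (S (a 0 k + t) (a 0 k) * G (a 0 k)))) +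
  (G (a 0 k + t) - G (a 0 k) - t * G1) +
  t * (sgn R k * ((S (a 0 k + t) (a 0 k) - S (a 0 k) (a 0 k)) * G (a 0 k))).
  move: (G (a 0 k + t)) (G (a 0 k)) (g (a 0 k + t)) => r1 r2 r3; ring.
rewrite (mulrDl (C + CG)) (mulrDl C); apply: le_trans (ler_normD _ _) _; apply: lerD => //.
by apply: le_trans (ler_normD _ _) _; apply: lerD.
Qed.

Lemma inner_on_inv (b : 'rV[R]_(m.*2)) A g : lip1 A -> sorted_in al be b -> lip1 g ->
  (forall x, closure (intervals b) x -> inv_ImK (intervals b) K f x = g x) ->
  inner_on (intervals b) A (inv_ImK (intervals b) K f) = Tint b (fun x => A x * g x).
Proof.
move=> lA gb lg gE; apply: eq_Rintegral => x /set_mem Jx.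
by rewrite gE //; exact: subset_closure.
Qed.

(** Two effects add up: the boundary term A(a_k) G(a_k), and the change of the solution, which
    contributes T(A S(., a_k)) G(a_k). By the symmetry of S, the factor A(a_k) + T(A S(., a_k)) is
    (I - K T)^-1 A at a_k. *)
Lemma inner_on_derive A k : lip1 A ->
  is_derive a (delta_mx 0 k)
    (fun b : 'rV[R]_(m.*2) => inner_on (intervals b) A (inv_ImK (intervals b) K f))
    (sgn R k * (resf T S A (a 0 k) * G (a 0 k))).
Proof.
move=> lA; have [C [d [C0 d0 H]]] := inv_ImK_shift hab ga1 ga rS lf.
have [B [B0 AB _]] := lA; have V0 := bfun_ge0 bT.
have bk : inbox (a 0 k) by exact: ga.2.
have lAG : lip1 (fun x => A x * G x) by exact: lipMM.
have [L [L0 _ AL]] := lAG.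
set V := Vbox al be m in V0.
apply: (is_derive_quad (C := V * (B * C) + B * C + L) d0) => t td.
have [ga' [g [lg gE gG gG2]]] := H k t td.
rewrite (inner_on_inv lA ga' lg gE) (inner_on_inv lA ga lG (@inv_ImK_resf)).
have lAg : lip1 (fun x => A x * g x) by exact: lipMM.
rewrite (Tint_shift hab ga ga' lAg).
have bU := bfun_Ushift hab ga ga'; set U := Ushift al a k t in bU *.
have u1 := Ushift_quad ga ga' lAG L0 AL; rewrite -/U in u1.
have u2 : `|U (fun x => A x * g x) - U (fun x => A x * G x)| <= `|t| * (B * (C * `|t|)).
  apply: (bfun_dist bU) => // x bx; rewrite -mulrBr normrM.
  by apply: ler_pM => //; [exact: AB|exact: gG].
have lSk : lip1 (fun x => S x (a 0 k)) by exact: lip2_col.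
have lAS : lip1 (fun x => A x * S x (a 0 k)) by exact: lipMM.
pose c := t * (sgn R k * G (a 0 k)).
have lcAS : lip1 (fun x => c * (A x * S x (a 0 k))) by apply: lipMM => //; exact: lipM_cst.
have TAS : T (fun x => A x * S x (a 0 k)) = resf T S A (a 0 k) - A (a 0 k).
  rewrite /resf addrC addKr; apply: (eq_bfun bT) => // x bx.
  by rewrite (Ssym bx bk) mulrC.
have u3 : `|T (fun x => A x * g x) - T (fun x => A x * G x) - c * (resf T S A (a 0 k) - A (a 0 k))|
    <= V * (B * (C * t ^+ 2)).
  rewrite -TAS -(bfunB bT) // -(bfunZ bT) // -(bfunB bT) //; last exact: lipMB.
  apply: (bfun_le bT) => [|x bx]; first by apply: lipMB => //; exact: lipMB.
  have -> : A x * g x - A x * G x - c * (A x * S x (a 0 k)) =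
    A x * (g x - G x - t * (sgn R k * (S x (a 0 k) * G (a 0 k)))).
    by rewrite /c; move: (G x) (G (a 0 k)) => r1 r2; ring.
  by rewrite normrM; apply: ler_pM => //; [exact: AB|exact: gG2].
set Ug := U (fun x => A x * g x) in u2 *; set UG := U _ in u1 u2.
set Tg := T (fun x => A x * g x) in u3 *; set TG := T (fun x => A x * G x) in u3 *.
have -> : Tg + Ug - TG - t * (sgn R k * (resf T S A (a 0 k) * G (a 0 k))) =
  (Tg - TG - c * (resf T S A (a 0 k) - A (a 0 k))) + (Ug - UG) +
  (UG - sgn R k * (t * (A (a 0 k) * G (a 0 k)))).
  rewrite /c; move: (resf T S A (a 0 k)) (G (a 0 k)) Tg Ug TG UG {u1 u2 u3} => r1 r2 r3 r4 r5 r6; ring.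
rewrite (mulrDl (V * (B * C) + B * C)) (mulrDl (V * (B * C))).
apply: le_trans (ler_normD _ _) _; apply: lerD => //.
apply: le_trans (ler_normD _ _) _; apply: lerD.
  by apply: le_trans u3 _; rewrite !mulrA.
apply: le_trans u2 _.
by rewrite -(real_normK (num_real t)) le_eqVlt; apply/orP; left; apply/eqP; ring.
Qed.

End EndpointDerivatives.

Lemma airy_scaled_derive (R : realType) (Ai : R -> R) (c : R) : is_airy Ai ->
  let A := fun x => c * Ai x in
  (forall x, is_derive x (1 : R) A (derive1 A x)) /\
  (forall x, is_derive x (1 : R) (derive1 A) (x * A x)).
Proof.
move=> [dAi dAi1 _ _] A.
have dA x : is_derive x (1 : R) A (c * derive1 Ai x).
  have d0 : is_derive x (1 : R) Ai (derive1 Ai x) by rewrite derive1E; exact: derivableP.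
  exact: is_deriveZ.
have A1E : derive1 A = fun x => c * derive1 Ai x.
  by apply/funext => x; rewrite derive1E; exact: derive_val.
split=> x; rewrite A1E //.
have D := is_deriveZ c (dAi1 x).
by apply: is_derive_eq D _; rewrite /GRing.scale /= /A mulrCA.
Qed.

Lemma inbox_shift (R : realType) (al be c t x : R) : `|t| <= c ->
  inbox (al + c) (be - c) x -> inbox al be (x + t).
Proof. by rewrite ler_norml => /andP[h1 h2] /andP[h3 h4]; apply/andP; split; lra. Qed.

Theorem mainTheorem1 (R : realType) (Ai : R -> R) (hAi : is_airy Ai)
    (lambda : R) (hlambda : 0 < lambda) (m : nat) (hm : (1 <= m)%N) :
  let A := fun x : R => Num.sqrt lambda * Ai x in
  let A' := derive1 A in
  let K := airy_kernel A in
  let J := @intervals R m in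
  let D := fun a => fredholm_det (J a) K in
  let Rk := fun a => resolvent_kernel (J a) K in
  let Q := fun a => inv_ImK (J a) K A in
  let P := fun a => inv_ImK (J a) K A' in
  let q := fun j (a : 'rV[R]_(m.*2)) => Q a (a 0 j) in
  let p := fun j (a : 'rV[R]_(m.*2)) => P a (a 0 j) in
  let u := fun a => inner_on (J a) A (Q a) in
  let v := fun a => inner_on (J a) A (P a) in
  let e := fun j => delta_mx 0 j : 'rV[R]_(m.*2) in
  let sgn := fun j : 'I_(m.*2) => (-1) ^+ j.+1 : R in
  forall a : 'rV[R]_(m.*2),
  (forall i j : 'I_(m.*2), (i < j)%N -> a 0 i < a 0 j) ->
  invertible_ImK (J a) K ->
  let r := fun j k =>
    (q j a * p k a - p j a * q k a) / (a 0 j - a 0 k) in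
  forall j k : 'I_(m.*2),
  (D a != 0 /\ derivable D a (e j) /\
     (D a)^-1 * 'D_(e j) D a = - sgn j * Rk a (a 0 j) (a 0 j)) /\
  (j != k -> is_derive a (e k) (q j) (sgn k * r j k * q k a)) /\
  (j != k -> is_derive a (e k) (p j) (sgn k * r j k * p k a)) /\
  is_derive a (e j) (q j)
    (- (\sum_(l < m.*2 | l != j) sgn l * r j l * q l a)
     + p j a - q j a * u a) /\
  is_derive a (e j) (p j)
    (- (\sum_(l < m.*2 | l != j) sgn l * r j l * p l a)
     + a 0 j * q j a + p j a * u a - 2%:R * q j a * v a) /\
  is_derive a (e j) u (sgn j * q j a ^+ 2) /\
  is_derive a (e j) v (sgn j * (p j a * q j a)) /\
  Rk a (a 0 j) (a 0 j) =
    \sum_(l < m.*2 | l != j)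
      sgn l * ((q j a * p l a - p j a * q l a) ^+ 2 / (a 0 j - a 0 l))
    + p j a ^+ 2 - a 0 j * q j a ^+ 2
    - 2%:R * p j a * q j a * u a + 2%:R * q j a ^+ 2 * v a.
Proof.
move=> A A' K J D Rk Q P q p u v e sgn0 a sa inv r j k.
have [dA dA1] := airy_scaled_derive (Num.sqrt lambda) hAi.
rewrite -/A -/A' in dA dA1.
pose M := \sum_l `|a 0 l|.
(* The box leaves room for the two margins of width [rho = 1] in the translation argument. *)
pose al := - M - 3; pose be := M + 3.
have aM l : - M <= a 0 l <= M.
  rewrite -ler_norml /M (bigD1 l) //= lerDl; exact: sumr_ge0.
have M0 : 0 <= M by exact: sumr_ge0.
have hab : al <= be by rewrite /al /be; lra.
have hab2 : al + 2 * 1 <= be - 2 * 1 by rewrite /al /be; lra.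
have inb c l : 0 <= c -> c <= 3 -> inbox (al + c) (be - c) (a 0 l).
  move=> c0 c3; have /andP[h1 h2] := aM l.
  by rewrite /al /be; apply/andP; split; lra.
have ga2 : sorted_in (al + 2 * 1) (be - 2 * 1) a.
  by split=> // l; apply: inb; lra.
have ga1 : sorted_in (al + 1) (be - 1) a by split=> // l; apply: inb; lra.
have ga : sorted_in al be a.
  by split=> // l; have := inb 0 l; rewrite addr0 subr0; apply; lra.
clearbody al be.
have dT := disc_Tint hab ga; have bT := disc_bfun hab dT.
have lK : lip2 al be K by exact: lip2_airy.
have mJ : measurable (J a) by exact: measurable_intervals.
have oJ : open (J a) by exact: open_intervals.
have Jb x : J a x -> inbox al be x by exact: intervals_inbox.
have [S rS Ssym] := resolvent_exists hab mJ Jb lK dT (fun x y _ _ => airy_sym dA dA1 x y) inv.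
have lA : lip1 al be A by exact: lip1_A.
have lA' : lip1 al be A' by exact: lip1_A1.
have lA2 : lip1 al be (fun x => x * A x) by exact: lip1_A2.
have lS := resolvS rS.
pose G := resf (Tint a) S A; pose H := resf (Tint a) S A'.
have lG : lip1 al be G by exact: (lip1_resf bT lS lA).
have lH : lip1 al be H by exact: (lip1_resf bT lS lA').
have QE x : closure (J a) x -> Q a x = G x by exact: (inv_ImK_resf hab ga1 ga rS lA).
have PE x : closure (J a) x -> P a x = H x by exact: (inv_ImK_resf hab ga1 ga rS lA').
have cl l : closure (J a) (a 0 l) by exact: endpoint_closure.
have bl l : inbox al be (a 0 l) by exact: ga.2.
have qE l : q l a = G (a 0 l) by exact: QE.
have pE l : p l a = H (a 0 l) by exact: PE.
have uE : u a = Tint a (fun x => A x * G x) := inner_on_inv lA ga lG QE.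
have vE : v a = Tint a (fun x => A x * H x) := inner_on_inv lA ga lH PE.
have vE' : v a = Tint a (fun x => A' x * G x).
  by rewrite vE; exact: (resf_sym hab dT rS Ssym lA lA').
have Kcomm x y : inbox al be x -> inbox al be y ->
  (x - y) * K x y = A x * A' y - A' x * A y by move=> _ _; exact: airy_comm.
have comm x y : inbox al be x -> inbox al be y ->
    (x - y) * S x y = G x * H y - H x * G y.
  exact: (comm_resolvent hab dT rS Ssym lA lA' Kcomm).
have rE i l : i != l -> r i l = S (a 0 i) (a 0 l).
  move=> il; have ail : a 0 i - a 0 l != 0.
    rewrite subr_eq0; apply/eqP => ail.
    case: (ltngtP i l) => [h|h|/val_inj h]; last by rewrite h eqxx in il.
      by have := sa i l h; rewrite ail ltxx.
    by have := sa l i h; rewrite ail ltxx.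
  apply: (mulfI ail); rewrite comm // /r !qE !pE; by rewrite mulrC divfK.
have RE : Rk a (a 0 j) (a 0 j) = S (a 0 j) (a 0 j).
  by apply: (resolvent_kernelE hab mJ oJ Jb lK dT rS) => //; case: inv.
(* [G1] and [H1] are the derivatives of [G] and [H] in the argument at a_j, for fixed J. The terms
   [l = j] of their sums will cancel against the effect of moving J. *)
pose G1 := H (a 0 j) - u a * G (a 0 j) - \sum_l sgn R l * (S (a 0 j) (a 0 l) * G (a 0 l)).
pose H1 := a 0 j * G (a 0 j) + u a * H (a 0 j) - 2%:R * v a * G (a 0 j)
   - \sum_l sgn R l * (S (a 0 j) (a 0 l) * H (a 0 l)).
have in2 l : inbox (al + 2 * 1) (be - 2 * 1) (a 0 l) by exact: ga2.2.
have shin t x : `|t| <= 1 -> inbox (al + 2 * 1) (be - 2 * 1) x -> inbox al be (x + t).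
  by rewrite mulr1 => t1; apply: inbox_shift; rewrite (le_trans t1) // ler1n.
have sub x : inbox (al + 2 * 1) (be - 2 * 1) x -> inbox al be x.
  by rewrite -{2}(addr0 x); apply: shin; rewrite normr0 ler01.
have [CK CK0 KS] := airy_shift dA dA1 hab.
have Kshift h x z : `|h| <= 1 -> inbox (al + 2 * 1) (be - 2 * 1) x ->
    inbox (al + 2 * 1) (be - 2 * 1) z ->
    `|K (x + h) z - K x (z - h) + h * (A x * A z)| <= CK * h ^+ 2.
  move=> h1 bx bz; apply: KS; [exact: sub|exact: sub|exact: shin|].
  by apply: shin => //; rewrite normrN.
have [LA LA0 LAP] := lip1_Lip lA'.
have [LA2 LA20 LA2P] := lip1_Lip lA2.
have quadA h x : `|h| <= 1 -> inbox (al + 2 * 1) (be - 2 * 1) x ->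
    `|A (x + h) - A x - h * A' x| <= LA * h ^+ 2.
  by move=> h1 bx; apply: (derive_quad dA LA0 LAP); [exact: sub|exact: shin].
have quadA' h x : `|h| <= 1 -> inbox (al + 2 * 1) (be - 2 * 1) x ->
    `|A' (x + h) - A' x - h * (x * A x)| <= LA2 * h ^+ 2.
  by move=> h1 bx; apply: (derive_quad dA1 LA20 LA2P); [exact: sub|exact: shin].
have [CG CG0 GQ] := resf_shift ltr01 hab2 ga2 rS lA CK0 Kshift lA lA' LA0 quadA.
have [CH CH0 HQ] := resf_shift ltr01 hab2 ga2 rS lA CK0 Kshift lA' lA2 LA20 quadA'.
have G1P t : `|t| <= 1 -> `|G (a 0 j + t) - G (a 0 j) - t * G1| <= CG * t ^+ 2.
  by move=> t1; have := GQ t (a 0 j) t1 (in2 j); rewrite -uE.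
have H1P t : `|t| <= 1 -> `|H (a 0 j + t) - H (a 0 j) - t * H1| <= CH * t ^+ 2.
  move=> t1; have := HQ t (a 0 j) t1 (in2 j).
  rewrite (resf_mulx hab dT rS lA lA' Kcomm (bl j)) -vE -vE' -uE.
  have -> : a 0 j * G (a 0 j) - v a * G (a 0 j) + u a * H (a 0 j) - v a * G (a 0 j)
    - \sum_l sgn R l * (S (a 0 j) (a 0 l) * H (a 0 l)) = H1.
    by rewrite /H1; ring.
  by [].
(* The commutator formula at x = a_j + t, y = a_j is divided by t; [B] collects the second-order
   errors of [G] and [H] and the Lipschitz constant of [S]. *)
have S_diag : S (a 0 j) (a 0 j) = G1 * H (a 0 j) - H1 * G (a 0 j).
  have [LS [LS0 _ SL]] := lS.
  pose B := `|H (a 0 j)| * CG + `|G (a 0 j)| * CH + LS.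
  have B0 : 0 <= B by rewrite !addr_ge0 // mulr_ge0.
  have B1 : 0 < B + 1 by rewrite ltr_wpDl.
  have est t : 0 < t -> t <= 1 ->
      `|S (a 0 j) (a 0 j) - (G1 * H (a 0 j) - H1 * G (a 0 j))| <= B * t.
    move=> t0 t1; have nt : `|t| <= 1 by rewrite gtr0_norm.
    have bt := shin t _ nt (in2 j).
    have c1 := comm _ _ bt (bl j); rewrite (addrAC _ t) subrr add0r in c1.
    have h1 := G1P t nt; have h2 := H1P t nt.
    have h3 : `|S (a 0 j + t) (a 0 j) - S (a 0 j) (a 0 j)| <= LS * t.
      have := SL (a 0 j + t, a 0 j) (a 0 j, a 0 j) (conj bt (bl j)) (conj (bl j) (bl j)).
      by rewrite /= (addrAC _ t) !subrr add0r normr0 addr0 (gtr0_norm t0).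
    rewrite -(ler_pM2l t0) -{1}(gtr0_norm t0) -normrM.
    have -> : t * (S (a 0 j) (a 0 j) - (G1 * H (a 0 j) - H1 * G (a 0 j))) =
      H (a 0 j) * (G (a 0 j + t) - G (a 0 j) - t * G1)
      - G (a 0 j) * (H (a 0 j + t) - H (a 0 j) - t * H1)
      - t * (S (a 0 j + t) (a 0 j) - S (a 0 j) (a 0 j)).
      rewrite [t * (_ - S (a 0 j) (a 0 j))]mulrBr c1.
      move: (G (a 0 j)) (H (a 0 j)) (G (a 0 j + t)) (H (a 0 j + t)) (G1) (H1) (S (a 0 j) (a 0 j)).
      by move=> r1 r2 r3 r4 r5 r6 r7; ring.
    have -> : t * (B * t) = `|H (a 0 j)| * (CG * t ^+ 2) + `|G (a 0 j)| * (CH * t ^+ 2)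
      + t * (LS * t) by rewrite /B; ring.
    apply: le_trans (ler_normB _ _) _; apply: lerD.
      apply: le_trans (ler_normB _ _) _; rewrite !normrM.
      by apply: lerD; apply: ler_wpM2l.
    by rewrite normrM (gtr0_norm t0); apply: ler_wpM2l => //; exact: ltW.
  apply/eqP; rewrite -subr_eq0 -normr_le0; apply/ler_addgt0Pl => eps eps0.
  rewrite addr0; pose t := Num.min 1 (eps / (B + 1)).
  have t0 : 0 < t by rewrite lt_min ltr01 divr_gt0.
  have t1 : t <= 1 by rewrite ge_min lexx.
  have t2 : t <= eps / (B + 1) by rewrite ge_min lexx orbT.
  apply: le_trans (est t t0 t1) _.
  move: t2; rewrite ler_pdivlMr // mulrC; apply: le_trans.
  by apply: ler_wpM2r; [exact: ltW|rewrite lerDl].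
have ds := fredholm_det_derive hab ga1 ga rS j.
have sumE (F : R -> R) : \sum_(l < m.*2 | l != j) sgn0 l * r j l * F (a 0 l) =
    \sum_l sgn R l * (S (a 0 j) (a 0 l) * F (a 0 l)) - sgn R j * (S (a 0 j) (a 0 j) * F (a 0 j)).
  rewrite [in RHS](bigD1 j) //= [X in _ = X - _]addrC addrK; apply: eq_bigr => l lj.
  by rewrite rE 1?eq_sym // mulrA.
split; last split; last split; last split; last split; last split; last split.
- have Da0 : D a != 0 by exact: (fredholm_det_neq0 hab ga rS).
  have [dD vD] := ds; split=> //; split; first exact: dD.
  by rewrite RE [X in _ * X]vD mulrC mulfK.
- move=> jk; rewrite rE // qE -mulrA; exact: (inv_ImK_derive_neq hab ga1 ga rS lA jk).
- move=> jk; rewrite rE // pE -mulrA; exact: (inv_ImK_derive_neq hab ga1 ga rS lA' jk).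
- have D1 := inv_ImK_derive_eq hab ga1 ga rS lA CG0 G1P.
  apply: is_derive_eq D1 _; under eq_bigr do rewrite qE.
  by rewrite sumE /G1 qE pE -/G; ring.
- have D1 := inv_ImK_derive_eq hab ga1 ga rS lA' CH0 H1P.
  apply: is_derive_eq D1 _; under eq_bigr do rewrite pE.
  by rewrite sumE /H1 qE pE -/H; ring.
- have D1 := inner_on_derive hab ga1 ga rS Ssym lA j lA.
  by apply: is_derive_eq D1 _; rewrite qE expr2.
- have D1 := inner_on_derive hab ga1 ga rS Ssym lA' j lA.
  by apply: is_derive_eq D1 _; rewrite qE pE mulrC [RHS]mulrC (mulrC (H _)).
rewrite RE S_diag.
(* One factor q_j p_l - p_j q_l divided by a_j - a_l is S(a_j, a_l); the terms [l = j] of the two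
   full sums cancel each other. *)
have -> : \sum_(l < m.*2 | l != j)
      sgn0 l * ((q j a * p l a - p j a * q l a) ^+ 2 / (a 0 j - a 0 l)) =
    G (a 0 j) * (\sum_l sgn R l * (S (a 0 j) (a 0 l) * H (a 0 l))) -
    H (a 0 j) * (\sum_l sgn R l * (S (a 0 j) (a 0 l) * G (a 0 l))).
  rewrite !mulr_sumr -sumrB [RHS](bigD1 j) //= [X in _ = X + _](_ : _ = 0) ?add0r; last by ring.
  apply: eq_bigr => l lj; have jl : j != l by rewrite eq_sym.
  rewrite -(rE _ _ jl) /r !qE !pE /sgn0 /sgn.
  by move: (G _) (H _) (G _) (H _) ((_ - _)^-1) => r1 r2 r3 r4 r5; ring.
by rewrite /G1 /H1 qE pE; ring.
Qed.
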